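(* Let $M$ be a connected complete Riemannian manifold of nonpositive sectional curvature with $\operatorname{vol}(M) < \infty$, and let $K$ be its universal covering space. Let $x \in K$, $r > 0$ and $m \in \mathbb{N}$, $m \geq 1$, be such that the ball $B_r(x) \subset K$ satisfies $$\operatorname{vol}(B_r(x)) > m \operatorname{vol}(M).$$ Then there exist a point $q \in M$ and non-trivial geodesic loops $\delta_2, \dots, \delta_m \subset M$ with common base point $q$ such that $$l(\delta_i) \leq 2r \quad \text{for all } i \in \{2, \dots, m\}.$$ Furthermore, these geodesic loops are all in different homotopy classes, i.e. they represent pairwise distinct elements of $\pi_1(M,q)$.
   Context: The universal covering $K$ carries the Riemannian metric pulled back from $M$. $\operatorname{vol}$ denotes Riemannian volume, $B_r(x) \subset K$ is the ball of radius $r$ with center $x$ in $K$, and $l(\delta)$ is the length of $\delta$. A geodesic loop with base point $q$ is a geodesic arc in $M$ starting and ending at $q$ (not required to be smooth at $q$); it defines a homotopy class in $\pi_1(M,q)$. *)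

(* Defs.v *)
From HB Require Import structures.
From mathcomp Require Import all_boot all_order all_algebra.
From mathcomp Require Import all_classical all_reals all_analysis.

Set Implicit Arguments.
Unset Strict Implicit.
Unset Printing Implicit Defensive.

Import Order.TTheory GRing.Theory Num.Theory.
Import numFieldNormedType.Exports.

Local Open Scope classical_set_scope.
Local Open Scope ring_scope.

(* Calculus on R^n = 'rV[R]_n.  Coordinates are row vectors, so that the
   library's Jacobian acts on the right: 'D_v f x = v *m 'J f x. *)

Definition partial (R : realType) (n : nat) (V : normedModType R)
    (a : 'I_n) (f : 'rV[R]_n -> V) (x : 'rV[R]_n) : V :=
  'D_(delta_mx 0 a) f x.

(* U is meant to be open. *)
Fixpoint Ck_on (R : realType) (n : nat) (V : normedModType R) (k : nat)
    (U : set 'rV[R]_n) (f : 'rV[R]_n -> V) : Prop :=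
  if k is k'.+1 then
    forall a : 'I_n, (forall x, U x -> derivable f x (delta_mx 0 a)) /\
                     Ck_on k' U (partial a f)
  else forall x, U x -> {for x, continuous f}.

Definition smooth_on (R : realType) (n : nat) (V : normedModType R)
    (U : set 'rV[R]_n) (f : 'rV[R]_n -> V) : Prop :=
  forall k, Ck_on k.+1 U f.

(* The Lebesgue integral over R^n of a nonnegative Borel function, as an
   iterated one-dimensional integral (Tonelli). *)
Fixpoint integral_rV (R : realType) (n : nat) : ('rV[R]_n -> \bar R) -> \bar R :=
  match n return ('rV[R]_n -> \bar R) -> \bar R with
  | 0 => fun f => f 0
  | n'.+1 => fun f =>
      (\int[lebesgue_measure]_(t in [set: R])
         integral_rV (fun y : 'rV[R]_n' => f (row_mx (t%:M : 'M[R]_1) y)))%E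
  end.

(* Only the restrictions of coord to dom and of inv to coord @` dom matter. *)
Record chart (R : realType) (n : nat) (T : topologicalType) := Chart {
  dom : set T;
  coord :> T -> 'rV[R]_n;
  inv : 'rV[R]_n -> T;
  dom_open : open dom;
  im_open : open (coord @` dom);
  coord_continuous : {within dom, continuous coord};
  inv_continuous : {within coord @` dom, continuous inv};
  coordK : {in dom, cancel coord inv} }.

Section ChartExpressions.
Context {R : realType} {n : nat}.

Definition im (T : topologicalType) (c : chart R n T) : set 'rV[R]_n :=
  c @` dom c.

Context {T S : topologicalType}.
Implicit Types (c : chart R n T) (d : chart R n S) (f : T -> S).

Definition local_expr f c d : 'rV[R]_n -> 'rV[R]_n := d \o f \o inv c.

Definition local_dom f c d : set 'rV[R]_n :=
  [set x | im c x /\ dom d (f (inv c x))].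

Definition smooth_in f c d : Prop :=
  smooth_on (local_dom f c d) (local_expr f c d).

(* gd is the matrix of a metric in the chart d; at the points of local_dom, gc
   is the matrix in the chart c of its pullback by f. *)
Definition pulls_back f c d (gc gd : 'rV[R]_n -> 'M[R]_n) : Prop :=
  forall x, local_dom f c d x ->
    gc x = 'J (local_expr f c d) x *m gd (local_expr f c d x)
           *m ('J (local_expr f c d) x)^T.

End ChartExpressions.

(* metric c x is the Gram matrix at inv c x of the coordinate frame of c; it is
   relevant for c in the atlas and x in im c only.  chart_at is an auxiliary
   choice of charts, on which the length of a piecewise C^1 curve does not depend. *)
Record riemannianManifold (R : realType) (n : nat) := RiemannianManifold {
  carrier :> ptopologicalType;
  atlas : set (chart R n carrier);
  chart_at : carrier -> chart R n carrier;
  metric : chart R n carrier -> 'rV[R]_n -> 'M[R]_n;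
  carrier_hausdorff : hausdorff_space carrier;
  carrier_second_countable : @second_countable carrier;
  chart_at_atlas : forall p, atlas (chart_at p);
  chart_at_dom : forall p, dom (chart_at p) p;
  atlas_compatible : forall c d, atlas c -> atlas d -> smooth_in idfun c d;
  atlas_maximal : forall c,
    (forall d, atlas d -> smooth_in idfun c d /\ smooth_in idfun d c) -> atlas c;
  metric_smooth : forall c, atlas c -> smooth_on (im c) (metric c);
  metric_sym : forall c x, atlas c -> im c x -> (metric c x)^T = metric c x;
  metric_pos : forall c x (v : 'rV[R]_n), atlas c -> im c x -> v != 0 ->
    0 < (v *m metric c x *m v^T) 0 0;
  metric_compatible : forall c d, atlas c -> atlas d ->
    pulls_back idfun c d (metric c) (metric d) }.

Section Riemannian.
Context {R : realType} {n : nat} (M : riemannianManifold R n).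
Implicit Types (c : chart R n M) (x u v w : 'rV[R]_n) (g : R -> M).

Definition inner c x u v : R := (u *m metric c x *m v^T) 0 0.

(* christoffel c x k a b is Gamma^k_ab. *)
Definition christoffel c x (k a b : 'I_n) : R :=
  2^-1 * \sum_l invmx (metric c x) k l *
    (partial a (fun y => metric c y b l) x + partial b (fun y => metric c y a l) x
     - partial l (fun y => metric c y a b) x).

(* riemann_coef c x l e a b is the coefficient along the l-th coordinate field
   of R(d_a, d_b) d_e = nabla_a nabla_b d_e - nabla_b nabla_a d_e. *)
Definition riemann_coef c x (l e a b : 'I_n) : R :=
  partial a (fun y => christoffel c y l b e) x
  - partial b (fun y => christoffel c y l a e) x
  + \sum_h (christoffel c x l a h * christoffel c x h b e
            - christoffel c x l b h * christoffel c x h a e).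

Definition curvature c x u v w : 'rV[R]_n :=
  \row_l \sum_a \sum_b \sum_e riemann_coef c x l e a b * u 0 a * v 0 b * w 0 e.

Definition sectional_curvature c x u v : R :=
  inner c x (curvature c x u v v) u /
  (inner c x u u * inner c x v v - inner c x u v ^+ 2).

Definition nonpositively_curved : Prop :=
  forall c x u v, atlas c -> im c x -> row_free (col_mx u v) ->
    sectional_curvature c x u v <= 0.

(* The restriction of g to [a, b] extends to a curve on an open interval
   containing [a, b], all of whose points satisfy P. *)
Definition on_segment (P : (R -> M) -> R -> Prop) g (a b : R) : Prop :=
  exists (h : R -> M) (e : R), [/\ 0 < e,
    forall t, a <= t <= b -> h t = g t &
    forall t, a - e < t < b + e -> P h t].

Definition C1_at g (t : R) : Prop :=
  {for t, continuous g} /\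
  forall c, atlas c -> dom c (g t) ->
    (\forall s \near t, derivable (c \o g) s 1) /\
    {for t, continuous (derive1 (c \o g))}.

Definition piecewise_C1 g (a b : R) : Prop :=
  exists s : seq R,
    path (fun t t' : R => (t < t') && `[< on_segment C1_at g t t' >]) a s /\
    last a s = b.

Definition speed g (t : R) : R :=
  let c := chart_at (g t) in
  let v := derive1 (c \o g) t in Num.sqrt (inner c (c (g t)) v v).

Definition curve_length g (a b : R) : \bar R :=
  (\int[lebesgue_measure]_(t in `[a, b]) (speed g t)%:E)%E.

Definition edist (p q : M) : \bar R :=
  ereal_inf [set l | exists (g : R -> M) (a b : R),
    [/\ piecewise_C1 g a b, g a = p, g b = q & l = curve_length g a b]].

Definition rball (p : M) (r : R) : set M := [set q | (edist p q < r%:E)%E].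

Definition metrically_complete : Prop :=
  forall s : nat -> M,
    (forall e : R, 0 < e -> exists N : nat, forall i j : nat,
       (N <= i)%N -> (N <= j)%N -> (edist (s i) (s j) < e%:E)%E) ->
    exists l : M, forall e : R, 0 < e ->
      exists N : nat, forall i : nat, (N <= i)%N -> (edist (s i) l < e%:E)%E.

Definition geodesic_at g (t : R) : Prop :=
  {for t, continuous g} /\
  forall c, atlas c -> dom c (g t) ->
    [/\ \forall s \near t, derivable (c \o g) s 1,
        derivable (derive1 (c \o g)) t 1 &
        forall k, derive1n 2 (c \o g) t 0 k +
          \sum_a \sum_b christoffel c (c (g t)) k a b *
             derive1 (c \o g) t 0 a * derive1 (c \o g) t 0 b = 0].

Definition geodesic_arc g (a b : R) : Prop := on_segment geodesic_at g a b.

Definition geodesic_loop (q : M) g : Prop :=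
  [/\ geodesic_arc g 0 1, g 0 = q & g 1 = q].

(* By second countability there is exactly one such measure. *)
Definition riemannian_volume
    (mu : {measure set (g_sigma_algebraType (@open M)) -> \bar R}) : Prop :=
  forall c (A : set (g_sigma_algebraType (@open M))),
    atlas c -> measurable A -> A `<=` dom c ->
    mu A = integral_rV (fun x =>
             (Num.sqrt (\det (metric c x)) * \1_(c @` A) x)%:E).

End Riemannian.

(* Paths are parametrised by [0, 1]; their values elsewhere are irrelevant. *)
Section Homotopy.
Context {R : realType} {T : topologicalType}.
Implicit Types g h : R -> T.

Definition path_homotopic g h : Prop :=
  exists H : R * R -> T,
    [/\ {within `[0, 1] `*` `[0, 1], continuous H},
        forall t, 0 <= t <= 1 -> H (0, t) = g t,
        forall t, 0 <= t <= 1 -> H (1, t) = h t,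
        forall s, 0 <= s <= 1 -> H (s, 0) = g 0 &
        forall s, 0 <= s <= 1 -> H (s, 1) = g 1].

End Homotopy.

Definition simply_connected (R : realType) (T : topologicalType) : Prop :=
  (forall x y : T, exists g : R -> T,
     [/\ {within `[0, 1], continuous g}, g 0 = x & g 1 = y]) /\
  (forall g : R -> T, {within `[0, 1], continuous g} -> g 0 = g 1 ->
     path_homotopic g (fun=> g 0)).

Definition evenly_covered (T S : topologicalType) (p : T -> S) (U : set S) : Prop :=
  exists sheets : set (set T),
    [/\ trivIset sheets idfun,
        \bigcup_(V in sheets) V = p @^-1` U &
        forall V, sheets V -> open V /\
          exists s : S -> T, [/\ {within U, continuous s},
            forall y, U y -> V (s y) /\ p (s y) = y &
            forall x, V x -> s (p x) = x]].

Definition covering_map (T S : topologicalType) (p : T -> S) : Prop :=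
  [/\ continuous p, forall y, exists x, p x = y &
      forall y, exists U : set S, [/\ open U, U y & evenly_covered p U]].

(* K carries the smooth structure and the metric pulled back along p. *)
Definition riemannian_universal_covering (R : realType) (n : nat)
    (K M : riemannianManifold R n) (p : K -> M) : Prop :=
  [/\ covering_map p, simply_connected R K &
      forall (c : chart R n K) (d : chart R n M), atlas c -> atlas d ->
        smooth_in p c d /\ pulls_back p c d (metric c) (metric d)].

(* Main.v *)
From mathcomp Require Import all_boot all_order all_algebra.
From mathcomp Require Import all_classical all_reals all_analysis.
From mathcomp Require Import measurable_realfun ring lra.
Require Import Defs.

Set Implicit Arguments.
Unset Strict Implicit.
Unset Printing Implicit Defensive.

Import Order.TTheory GRing.Theory Num.Theory.
Import numFieldNormedType.Exports.

Local Open Scope classical_set_scope.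
Local Open Scope ring_scope.

(** The map p preserves volumes on small sets and the volume of the ball exceeds
    m vol(M), so some point q of M has m + 1 preimages in the ball, among them y_1, ..., y_m
    (many_preimages). Two points of the ball are at distance less than 2 r. The covering K
    is complete since M is (covering_complete), so y_1 is joined to y_i by a minimising
    geodesic, of length less than 2 r (minimising_geodesic_exists). Since p is a local
    isometry, its projection is a geodesic loop at q of the same length
    (projected_geodesic). A homotopy between two of these loops lifts to K, and the lifts
    from y_1 of the two loops then have the same end (homotopic_lifts_end); the ends y_i
    are distinct, and distinct from y_1, the end of the lift of the constant loop. So the
    loops are not homotopic to one another, and none is trivial.

    The existence of minimising geodesics is the Hopf-Rinow theorem. One half of it concerns
    complete locally compact length spaces: bounded sets are relatively compact
    (ball_in_compact), and a cluster point of almost shortest paths is a shortest path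
    (shortest_path_exists). The other half is local. Near a point, the boundary value problem
    for the geodesic equation is solved by contraction (boundary_value_problem), and the
    solutions are compared with arbitrary curves by means of a calibration, a function of
    time and position whose increments bound the length of curves from below, with equality
    on the geodesic only (calibrated_length). Hence short geodesics minimise, and they
    contain all the points which lie between their end points (local_geodesics). Applied
    to short pieces of a shortest path, this uniqueness shows that the path satisfies the
    geodesic equation in all charts and that it extends a little beyond its ends
    (metric_geodesic_extension).

    The covering enters through lifted charts: a chart of M composed with p is a chart of the
    maximal atlas of K, in which the two metrics have the same coefficients
    (lifted_chart_atlas). So p preserves speeds, geodesics and, on the domains of these
    charts, volumes. *)

(** * Coordinates and partial derivatives *)

Section Coordinates.
Context {R : realType}.

Lemma mx_entry_norm m n (A : 'M[R]_(m, n)) i j : `|A i j| <= `|A|.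
Proof.
by rewrite [in leRHS]/Num.Def.normr/= mx_normrE; exact: (le_bigmax _ _ (i, j)).
Qed.

Lemma mx_norm_le m n (A : 'M[R]_(m, n)) (e : R) :
  0 <= e -> (forall i j, `|A i j| <= e) -> `|A| <= e.
Proof.
by move=> e0 Ae; rewrite [in leLHS]/Num.Def.normr/= mx_normrE; apply: bigmax_le => // -[].
Qed.

Lemma rV_norm_le n (v : 'rV[R]_n) (e : R) :
  0 <= e -> (forall j, `|v 0 j| <= e) -> `|v| <= e.
Proof. by move=> e0 ve; apply: mx_norm_le => // i j; rewrite ord1. Qed.

Lemma is_derive_rVP (V : normedModType R) n (f : V -> 'rV[R]_n) x v df :
  is_derive x v f df <-> forall k, is_derive x v (fun y => f y 0 k) (df 0 k).
Proof.
split=> [[fx <-] k|H].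
  have fk := (derivable_mxP f x v).1 fx; split=> //.
  by rewrite (derive_mx fx) mxE.
have fx : derivable f x v by apply/derivable_mxP => i j; rewrite ord1; apply: ex_derive.
split=> //; rewrite derive_mx //; apply/rowP => k; rewrite mxE.
by apply: derive_val.
Qed.

Lemma cvg_mxP T (F : set_system T) (FF : Filter F) m n (f : T -> 'M[R]_(m, n)) (l : 'M[R]_(m, n)) :
  f @ F --> l <-> forall i j, (fun t => f t i j) @ F --> l i j.
Proof.
split=> [fl i j|fl].
  apply/cvgrPdist_le => e e0; move/cvgrPdist_le: fl => /(_ _ e0).
  apply: filterS => t; apply: le_trans.
  by have := mx_entry_norm (l - f t) i j; rewrite !mxE.
apply/cvgrPdist_le => e e0.
have H : \forall t \near F, forall ij : 'I_m * 'I_n, `|l ij.1 ij.2 - f t ij.1 ij.2| <= e.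
  by apply: filter_forall => -[i j]; move/cvgrPdist_le: (fl i j); apply.
apply: filterS H => t Ht; apply: mx_norm_le; first exact: ltW.
by move=> i j; have := Ht (i, j); rewrite !mxE.
Qed.

Lemma continuous_mxP (T : topologicalType) m n (f : T -> 'M[R]_(m, n)) x :
  {for x, continuous f} <-> forall i j, {for x, continuous (fun y => f y i j)}.
Proof.
split=> [/cvg_mxP fx i j|fx]; first exact: fx.
by apply/cvg_mxP => i j; exact: fx.
Qed.

Lemma continuous_rVP (T : topologicalType) n (f : T -> 'rV[R]_n) x :
  {for x, continuous f} <-> forall k, {for x, continuous (fun y => f y 0 k)}.
Proof.
split=> [/cvg_mxP fx k|fx]; first exact: fx.
by apply/cvg_mxP => i j; rewrite ord1; apply: fx.
Qed.

Lemma entry_continuous m n i j : continuous (fun A : 'M[R]_(m, n) => A i j).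
Proof. by move=> A; exact: ((cvg_mxP (nbhs_filter A) id A).1 (@cvg_id _ (nbhs A)) i j). Qed.

Lemma near_forall (T : topologicalType) (I : finType) (x : T) (P : I -> T -> Prop) :
  (forall i, \forall y \near x, P i y) -> \forall y \near x, forall i, P i y.
Proof. by move=> H; apply: filter_forall. Qed.

Lemma continuous_near_dist (T : topologicalType) (V : normedModType R) (f : T -> V) x e :
  {for x, continuous f} -> 0 < e -> \forall y \near x, `|f x - f y| < e.
Proof. by move=> /cvgrPdist_lt; apply. Qed.

Lemma continuous_of_dist (T : topologicalType) (V : normedModType R) (f : T -> V) x :
  (forall e, 0 < e -> \forall y \near x, `|f x - f y| <= e) -> {for x, continuous f}.
Proof. by move=> H; apply/cvgrPdist_le. Qed.

Lemma continuous_sumr (T : topologicalType) (I : Type) (r : seq I) (f : I -> T -> R) x :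
  (forall i, {for x, continuous (f i)}) ->
  {for x, continuous (fun y => \sum_(i <- r) f i y)}.
Proof.
move=> fx; apply: (cvg_big add_continuous) => i _; exact: fx.
Qed.

Lemma continuous_mulr (T : topologicalType) (f g : T -> R) x :
  {for x, continuous f} -> {for x, continuous g} ->
  {for x, continuous (fun y => f y * g y)}.
Proof. exact: cvgM. Qed.

Lemma continuous_addr (T : topologicalType) (f g : T -> R) x :
  {for x, continuous f} -> {for x, continuous g} ->
  {for x, continuous (fun y => f y + g y)}.
Proof. exact: cvgD. Qed.

Lemma continuous_cst (T U : topologicalType) (a : U) (x : T) : {for x, continuous (fun=> a)}.
Proof. exact: cvg_cst. Qed.

Lemma ballE_norm (V : normedModType R) (x y : V) e : ball x e y <-> `|x - y| < e.
Proof. by rewrite -ball_normE. Qed.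

Lemma is_derive_line (V W : normedModType R) (f : V -> W) (x v : V) (s : R) :
  derivable f (x + s *: v) v ->
  is_derive s 1 (fun t => f (x + t *: v)) ('D_v f (x + s *: v)).
Proof.
move=> df.
have E : (fun h : R => h^-1 *: (((fun t => f (x + t *: v)) \o shift s) h%:A -
             f (x + s *: v))) =
    (fun h => h^-1 *: ((f \o shift (x + s *: v)) (h *: v) - f (x + s *: v))).
  apply/funext => h /=; congr (_ *: (f _ - _)).
  by rewrite [h%:A]mulr1 scalerDl; rewrite addrA addrAC addrC.
by split; rewrite /derivable /derive E.
Qed.

End Coordinates.

Section PartialDerivatives.
Context {R : realType} {n : nat}.

(* Passing from y to z one coordinate at a time stays in every sup-norm ball that
   contains y and z. *)
Let mix (y z : 'rV[R]_n) (k : nat) : 'rV[R]_n :=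
  \row_j if (j < k)%N then z 0 j else y 0 j.

Lemma partial_lipschitz (f : 'rV[R]_n -> R) x0 (r B : R) y z :
  0 <= B ->
  (forall w, ball x0 r w -> forall a, derivable f w (delta_mx 0 a) /\
     `|partial a f w| <= B) ->
  ball x0 r y -> ball x0 r z -> `|f z - f y| <= n%:R * B * `|z - y|.
Proof.
move=> B0 fB yr zr.
have mix0 : mix y z 0 = y by apply/rowP => j; rewrite mxE.
have mixn : mix y z n = z by apply/rowP => j; rewrite mxE ltn_ord.
have -> : f z - f y = \sum_(k < n) (f (mix y z k.+1) - f (mix y z k)).
  transitivity (f (mix y z n) - f (mix y z 0)); first by rewrite mixn mix0.
  by rewrite -(telescope_sumr (fun k => f (mix y z k)) (leq0n n)) big_mkord.
rewrite (le_trans (ler_norm_sum _ _ _))//.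
have -> : n%:R * B * `|z - y| = \sum_(k < n) (B * `|z - y|).
  by rewrite sumr_const card_ord mulr_natl mulrnAl.
apply: ler_sum => k _.
pose e : 'rV[R]_n := delta_mx 0 k.
have mixS : mix y z k.+1 = mix y z k + (z 0 k - y 0 k) *: e.
  apply/rowP => j; rewrite !mxE eqxx /= ltnS leq_eqVlt.
  case: (eqVneq j k) => [->|jk]; first by rewrite eqxx ltnn mulr1 addrC subrK.
  by rewrite -val_eqE in jk; rewrite (negbTE jk) mulr0 addr0.
have r0 : 0 < r by rewrite (le_lt_trans _ ((ballE_norm _ _ _).1 yr)).
have inball s : `|s| <= `|z 0 k - y 0 k| -> 0 <= s * (z 0 k - y 0 k) ->
    ball x0 r (mix y z k + s *: e).
  move=> s1 s2; apply/ballE_norm.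
  have [e' [e'r e'y e'z]] : exists e', [/\ e' < r, `|x0 - y| <= e' & `|x0 - z| <= e'].
    exists (Num.max `|x0 - y| `|x0 - z|); split; rewrite ?le_max ?lexx ?orbT//.
    by rewrite gt_max; apply/andP; split; apply/ballE_norm.
  apply: le_lt_trans e'r; apply: rV_norm_le; first exact: le_trans e'y.
  move=> j; rewrite !mxE eqxx /=.
  have := le_trans (mx_entry_norm (x0 - y) 0 j) e'y.
  have := le_trans (mx_entry_norm (x0 - z) 0 j) e'z.
  rewrite !mxE; case: (eqVneq j k) => [->|jk] zj yj; last first.
    by rewrite mulr0 addr0; case: ifP.
  rewrite ltnn mulr1.
  have [zy|zy] := leP (y 0 k) (z 0 k).
    have s0 : 0 <= s.
      have [zy'|zy'] := eqVneq (z 0 k) (y 0 k).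
        by move: s1; rewrite zy' subrr normr0 normr_le0 => /eqP ->.
      by move: s2; rewrite pmulr_lge0// subr_gt0 lt_neqAle eq_sym zy' zy.
    rewrite !ger0_norm// ?subr_ge0// in s1.
    by move: zj yj; rewrite !ler_norml; lra.
  have s0 : s <= 0 by move: s2; rewrite nmulr_lge0// subr_lt0.
  have zy' : z 0 k - y 0 k <= 0 by rewrite subr_le0 ltW.
  rewrite !ler0_norm// in s1.
  by move: zj yj; rewrite !ler_norml; lra.
pose phi s := f (mix y z k + s *: e).
pose dphi s := partial k f (mix y z k + s *: e).
have -> : f (mix y z k.+1) = phi (z 0 k - y 0 k) by rewrite mixS.
have -> : f (mix y z k) = phi 0 by rewrite /phi scale0r addr0.
have zyk : `|z 0 k - y 0 k| <= `|z - y|.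
  by have := mx_entry_norm (z - y) 0 k; rewrite !mxE.
have der s : `|s| <= `|z 0 k - y 0 k| -> 0 <= s * (z 0 k - y 0 k) ->
    is_derive s 1 phi (dphi s) /\ `|dphi s| <= B.
  move=> s1 s2; have [d1 d2] := fB _ (inball _ s1 s2) k.
  by split; [exact: is_derive_line d1|exact: d2].
have cont a b : a <= b -> (forall s, a <= s <= b -> `|s| <= `|z 0 k - y 0 k| /\ 0 <= s * (z 0 k - y 0 k)) ->
   `|phi b - phi a| <= B * (b - a).
  move=> ab H.
  have [||c cab ->] := @MVT_segment R phi dphi a b ab.
  - move=> s; rewrite in_itv/= => /andP[as_ sb].
    have [? ?] : `|s| <= `|z 0 k - y 0 k| /\ 0 <= s * (z 0 k - y 0 k).
      by apply: H; rewrite !ltW.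
    exact: (der s _ _).1.
  - apply: derivable_within_continuous => s; rewrite in_itv/= => sab.
    by have [h1 h2] := H _ sab; have [[]] := der _ h1 h2.
  rewrite normrM [X in _ * X]ger0_norm ?subr_ge0// ler_wpM2r ?subr_ge0//.
  by move: cab; rewrite in_itv/= => /H[? ?]; apply: (der c _ _).2.
have [zy|zy] := leP (y 0 k) (z 0 k).
  apply: (@le_trans _ _ (B * (z 0 k - y 0 k - 0))).
    apply: cont; first by rewrite subr_ge0.
    move=> s /andP[s0 s1]; rewrite mulr_ge0 ?subr_ge0//.
    by rewrite !ger0_norm ?subr_ge0.
  by rewrite subr0 ler_wpM2l// (le_trans _ zyk)// ler_norm.
rewrite distrC.
apply: (@le_trans _ _ (B * (0 - (z 0 k - y 0 k)))).
  apply: cont; first by rewrite subr_le0 ltW.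
  have zy' : z 0 k - y 0 k <= 0 by rewrite subr_le0 ltW.
  by move=> s /andP[s0 s1]; split; [rewrite !ler0_norm ?lerN2|rewrite mulr_le0].
by rewrite sub0r ler_wpM2l// (le_trans _ zyk)// -normrN ler_norm.
Qed.

End PartialDerivatives.

(** * Taylor estimates and differentiability *)

Section FrechetDerivative.
Context {R : realType} {n : nat}.

(** Subtracting from f its candidate linear part leaves a function with small
    partial derivatives. *)
Lemma taylor1_bound (f : 'rV[R]_n -> R) x (r e : R) (l : 'I_n -> R) :
  0 <= e ->
  (forall w, ball x r w -> forall a, derivable f w (delta_mx 0 a) /\
     `|partial a f w - l a| <= e) ->
  forall y z, ball x r y -> ball x r z ->
   `|f z - f y - \sum_a (z - y) 0 a * l a| <= n%:R * e * `|z - y|.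
Proof.
move=> e0 H y z yr zr.
pose g (w : 'rV[R]_n) := f w - \sum_a w 0 a * l a.
have dl w a : is_derive w (delta_mx 0 a) (fun w : 'rV[R]_n => \sum_b w 0 b * l b) (l a).
  have dw (b : 'I_n) : is_derive w (delta_mx 0 a) (fun w : 'rV[R]_n => w 0 b * l b) ((a == b)%:R * l b).
    have := (is_derive_rVP _ w (delta_mx 0 a) (delta_mx 0 a)).1 (@is_derive_id _ _ w (delta_mx 0 a)) b.
    rewrite mxE eqxx /= eq_sym => dwb.
    have -> : (a == b)%:R * l b = w 0 b *: 0 + l b *: (a == b)%:R :> R by rewrite scaler0 add0r mulrC.
    exact: is_deriveM.
  have -> : (fun w : 'rV[R]_n => \sum_b w 0 b * l b) = \sum_b (fun w : 'rV[R]_n => w 0 b * l b).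
    by apply/funext => w'; rewrite fct_sumE.
  apply: is_derive_eq.
  rewrite (bigD1 a)//= eqxx mul1r big1 ?addr0// => b ba.
  by rewrite eq_sym (negbTE ba) mul0r.
have := @partial_lipschitz _ _ g x r e y z e0 _ yr zr.
have -> : g z - g y = f z - f y - \sum_a (z - y) 0 a * l a.
  have -> : \sum_a (z - y) 0 a * l a = \sum_a z 0 a * l a - \sum_a y 0 a * l a.
    by rewrite -sumrB; apply: eq_bigr => a _; rewrite !mxE mulrBl.
  by rewrite /g; ring.
apply => w wr a; have [d1 d2] := H w wr a; have [dl1 dl2] := dl w a; split.
  exact: derivableB.
by rewrite /partial (deriveB d1 dl1) dl2.
Qed.

(** The bound for the second derivatives makes the first ones Lipschitz, so that
    taylor1_bound applies around y; dividing the radius by 3 keeps the ball around y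
    through z inside the ball around x0. *)
Lemma taylor2_bound (f : 'rV[R]_n -> R) x0 (r B : R) :
  0 <= B ->
  (forall w, ball x0 r w -> forall a, derivable f w (delta_mx 0 a) /\
     forall b, derivable (partial a f) w (delta_mx 0 b) /\
       `|partial b (partial a f) w| <= B) ->
  forall y z, ball x0 (r / 3) y -> ball x0 (r / 3) z ->
   `|f z - f y - \sum_a (z - y) 0 a * partial a f y| <= n%:R * (n%:R * B) * `|z - y| ^+ 2.
Proof.
move=> B0 H y z /ballE_norm yr /ballE_norm zr.
have r0 : 0 < r by rewrite -(@pmulr_lgt0 _ 3^-1)// (le_lt_trans _ yr).
have [->|zy] := eqVneq z y.
  rewrite !subrr big1 ?subr0 ?normr0 ?expr0n ?mulr0// => a _.
  by rewrite mxE mul0r.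
have zy0 : 0 < `|z - y| by rewrite normr_gt0 subr_eq0.
have zyr : `|z - y| < r / 3 + r / 3.
  by rewrite (le_lt_trans (ler_distD x0 _ _))// ltrD// distrC.
have key e : 0 < e -> `|z - y| + e < r / 3 + r / 3 ->
    `|f z - f y - \sum_a (z - y) 0 a * partial a f y| <=
       n%:R * (n%:R * B * (`|z - y| + e)) * `|z - y|.
  move=> e0 er; apply: (@taylor1_bound f y (`|z - y| + e)).
  - by rewrite !mulr_ge0// addr_ge0// ltW.
  - move=> w /ballE_norm wr a.
    have xw : ball x0 r w.
      apply/ballE_norm; rewrite (le_lt_trans (ler_distD y _ _))//.
      rewrite (lt_trans (ltrD yr wr))//; lra.
    have [d1 d2] := H w xw a; split=> //.
    apply: (@le_trans _ _ (n%:R * B * `|w - y|)).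
      apply: (@partial_lipschitz R n (partial a f) x0 r B y w B0).
      - by move=> w' /H /(_ a)[].
      - by apply/ballE_norm; rewrite (lt_trans yr)//; lra.
      - exact: xw.
    by rewrite ler_wpM2l ?mulr_ge0// distrC ltW.
  - by apply/ballE_norm; rewrite subrr normr0 addr_gt0.
  - by apply/ballE_norm; rewrite distrC ltrDl.
have lim : (fun e : R => n%:R * (n%:R * B * (`|z - y| + e)) * `|z - y|) e @[e --> 0^'+] -->
    n%:R * (n%:R * B * (`|z - y| + 0)) * `|z - y|.
  apply: cvg_at_right_filter.
  apply: cvgM; last exact: cvg_cst.
  apply: cvgM; first exact: cvg_cst.
  apply: cvgM; first exact: cvg_cst.
  by apply: cvgD; [exact: cvg_cst|exact: cvg_id].
have -> : n%:R * (n%:R * B) * `|z - y| ^+ 2 = n%:R * (n%:R * B * (`|z - y| + 0)) * `|z - y|.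
  by rewrite addr0; ring.
apply: (cvgr_to_ge lim); near=> e; apply: key; first by near: e; exact: nbhs_right_gt.
rewrite -ltrBrDl; near: e; apply: nbhs_right_lt; by rewrite subr_gt0.
Unshelve. all: by end_near. Qed.

Lemma C1_taylor (f : 'rV[R]_n -> R) (x : 'rV[R]_n) :
  (\forall y \near x, forall a, derivable f y (delta_mx 0 a)) ->
  (forall a, {for x, continuous (partial a f)}) ->
  forall e, 0 < e -> \forall y \near x,
    `|f y - f x - \sum_a (y - x) 0 a * partial a f x| <= e * `|y - x|.
Proof.
move=> df cf e e0.
pose e' := e / (n%:R + 1).
have e'0 : 0 < e' by rewrite divr_gt0// ltr_wpDl.
have : \forall y \near x, forall a, derivable f y (delta_mx 0 a) /\
     `|partial a f y - partial a f x| <= e'.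
  have : \forall y \near x, forall a, `|partial a f y - partial a f x| <= e'.
    refine (@filter_forall _ _ (fun a y => `|partial a f y - partial a f x| <= e') _ (nbhs_filter x) _) => a; move/cvgrPdist_le: (cf a) => /(_ _ e'0).
    by apply: filterS => y; rewrite distrC.
  by apply: filterS2 df => y H1 H2 a; split.
move=> /nbhs_ballP[r /= r0 H].
apply/nbhs_ballP; exists r => //= y yr.
apply: (le_trans (@taylor1_bound f x r e' _ (ltW e'0) H x y (ballxx _ r0) yr)).
rewrite ler_wpM2r// /e' mulrCA ger_pMr// ler_pdivrMr ?mul1r ?lerDl//.
Qed.

(** The differential is chosen by description; an estimate with an explicit matrix
    identifies it. *)
Lemma differentiable_of_taylor m (f : 'rV[R]_n -> 'rV[R]_m) (x : 'rV[R]_n) (A : 'M[R]_(n, m)) :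
  (forall e, 0 < e -> \forall y \near x, `|f y - f x - (y - x) *m A| <= e * `|y - x|) ->
  differentiable f x /\ 'J f x = A.
Proof.
move=> H.
have cA : continuous (mulmxr A : 'rV[R]_n -> 'rV[R]_m).
  move=> v; apply/continuous_rVP => k.
  have -> : (fun y => mulmxr A y 0 k) = (fun y : 'rV[R]_n => \sum_j y 0 j * A j k).
    by apply/funext => y; rewrite mxE.
  apply: continuous_sumr => j.
  by apply: continuous_mulr; [exact: entry_continuous|exact: continuous_cst].
pose L : {linear 'rV[R]_n -> 'rV[R]_m} := mulmxr A.
have E : (f \o shift x : 'rV[R]_n -> 'rV[R]_m) =
    cst (f x) + (L : 'rV[R]_n -> 'rV[R]_m) +o_ (0 : 'rV[R]_n) id.
  apply/eqaddoP => e e0.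
  have := H _ e0; rewrite (near_shift 0 x); apply: filterS => h /=.
  by rewrite subr0 addrK opprD addrA.
have dE := @diff_unique R _ _ f L x cA E.
have df : differentiable f x by apply/diff_locallyP; rewrite dE.
split=> //; apply/row_matrixP => i; rewrite !rowE -[LHS]deriveEjacobian//.
by rewrite deriveE// dE.
Qed.

Lemma differentiable_taylor m (f : 'rV[R]_n -> 'rV[R]_m) (x : 'rV[R]_n) :
  differentiable f x ->
  (forall e, 0 < e -> \forall y \near x, `|f y - f x - (y - x) *m 'J f x| <= e * `|y - x|).
Proof.
move=> df e e0; have /diff_locally/eqaddoP/(_ e e0) H := df.
have {}H : \forall h \near (0 : 'rV[R]_n), `|f (h + x) - f x - h *m 'J f x| <= e * `|h|.
  apply: filterS H => h.
  by rewrite -deriveEjacobian// deriveE// -addrA -opprD; apply.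
rewrite (near_shift x 0) in H; apply: filterS H => y /=.
by rewrite sub0r subrK.
Qed.

Lemma jacobianE m (f : 'rV[R]_n -> 'rV[R]_m) (x : 'rV[R]_n) a b :
  differentiable f x -> 'J f x a b = partial a (fun y => f y 0 b) x.
Proof.
move=> df.
have -> : 'J f x a b = ('D_(delta_mx 0 a) f x) 0 b.
  by rewrite deriveEjacobian// -rowE [RHS]mxE.
by rewrite derive_mx ?mxE//; apply: diff_derivable.
Qed.

Lemma C1_differentiable m (f : 'rV[R]_n -> 'rV[R]_m) (x : 'rV[R]_n) :
  (forall b, \forall y \near x, forall a, derivable (fun z => f z 0 b) y (delta_mx 0 a)) ->
  (forall b a, {for x, continuous (partial a (fun z => f z 0 b))}) ->
  differentiable f x.
Proof.
move=> df cf.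
apply: (proj1 (@differentiable_of_taylor m f x
  (\matrix_(a, b) partial a (fun z => f z 0 b) x) _)) => e e0.
have := near_forall (fun b => C1_taylor (df b) (cf b) e0).
apply: filterS => y Hy; apply: rV_norm_le; first by rewrite mulr_ge0// ltW.
move=> b; have := Hy b; rewrite !mxE; congr (`|_ - _| <= _).
by apply: eq_bigr => a _; rewrite !mxE.
Qed.

End FrechetDerivative.

(** * Calculus of functions of class C^k *)

Section ChainRule.
Context {R : realType}.

(** Reduces a directional derivative to that of a curve, for which the chain
    rule for differentiable maps is available. *)
Lemma is_derive_directionP (V W : normedModType R) (f : V -> W) (x v : V) df :
  is_derive x v f df <-> is_derive (0 : R) 1 (fun h : R => f (h *: v + x)) df.
Proof.
have E : (fun h : R => h^-1 *: (((fun h : R => f (h *: v + x)) \o shift 0) h%:A -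
             f (0 *: v + x))) =
    (fun h => h^-1 *: ((f \o shift x) (h *: v) - f x)).
  by apply/funext => h /=; rewrite addr0 [h%:A]mulr1 scale0r add0r.
by split=> -[d1 d2]; split; move: d1 d2; rewrite /derivable /derive E.
Qed.

Lemma is_derive_chain (V : normedModType R) m p (G : V -> 'rV[R]_m)
    (F : 'rV[R]_m -> 'rV[R]_p) (x v : V) (dG : 'rV[R]_m) :
  is_derive x v G dG -> differentiable F (G x) ->
  is_derive x v (F \o G) (dG *m 'J F (G x)).
Proof.
move=> /is_derive_directionP[dg1 dg2] dF.
apply/is_derive_directionP.
set g := fun h : R => G (h *: v + x) in dg1 dg2.
have g0 : G x = g 0 by rewrite /g scale0r add0r.
rewrite g0 in dF *.
have dg : differentiable g 0 by apply/derivable1_diffP.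
have dFg : differentiable (F \o g) 0 by apply: differentiable_comp.
split; first exact: diff_derivable.
have dE := @diff_comp R _ _ _ g F 0 dg dF.
rewrite -[LHS]/('D_1 (F \o g) 0) deriveE// dE -[RHS]deriveEjacobian// [RHS]deriveE//.
by rewrite -dg2 [in RHS]deriveE.
Qed.

Lemma is_derive_chain1 (V : normedModType R) m (G : V -> 'rV[R]_m)
    (f : 'rV[R]_m -> R) (x v : V) (dG : 'rV[R]_m) :
  is_derive x v G dG ->
  (\forall y \near G x, forall a, derivable f y (delta_mx 0 a)) ->
  (forall a, {for G x, continuous (partial a f)}) ->
  is_derive x v (f \o G) (\sum_b dG 0 b * partial b f (G x)).
Proof.
move=> dg df cf.
pose F (y : 'rV[R]_m) : 'rV[R]_1 := \row_(_ < 1) f y.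
have FE : (fun y => F y 0 0) = f by apply/funext => y; rewrite mxE.
have dF : differentiable F (G x).
  by apply: C1_differentiable => b; rewrite ord1 FE.
have := is_derive_chain dg dF => /is_derive_rVP/(_ 0).
rewrite [in X in is_derive _ _ _ X]mxE.
have -> : (fun y => (F \o G) y 0 0) = f \o G by apply/funext => y; rewrite /= mxE.
by under eq_bigr do rewrite jacobianE// FE.
Qed.

End ChainRule.

Section CkCalculus.
Context {R : realType} {n : nat}.
Implicit Types (U : set 'rV[R]_n) (f g : 'rV[R]_n -> R) (k : nat).

Lemma near_open (T : topologicalType) (U : set T) x (P : T -> Prop) :
  open U -> U x -> (forall y, U y -> P y) -> \forall y \near x, P y.
Proof. by move=> oU Ux UP; apply: filterS (open_nbhs_nbhs (conj oU Ux)). Qed.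

Lemma near_comp (T S : topologicalType) (f : T -> S) (x : T) (P : S -> Prop) :
  {for x, continuous f} -> (\forall y \near f x, P y) -> \forall z \near x, P (f z).
Proof. by move=> cf; apply: cf. Qed.

Lemma near_eq_continuous (T S : topologicalType) (f g : T -> S) (x : T) :
  (\forall y \near x, f y = g y) -> {for x, continuous f} -> {for x, continuous g}.
Proof.
move=> fg cf; rewrite /prop_for /continuous_at -(nbhs_singleton fg).
by apply: cvg_trans cf; apply: near_eq_cvg; apply: filterS fg => y ->.
Qed.

Lemma Ck_on_sub (V : normedModType R) k U U' (f : 'rV[R]_n -> V) :
  U' `<=` U -> Ck_on k U f -> Ck_on k U' f.
Proof.
elim: k f => [|k IH] f UU /= H; first by move=> x /UU; exact: H.
move=> a; have [d H'] := H a; split; first by move=> x /UU; exact: d.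
exact: IH.
Qed.

Lemma Ck_on_eq (V : normedModType R) k U (f g : 'rV[R]_n -> V) : open U ->
  (forall x, U x -> f x = g x) -> Ck_on k U f -> Ck_on k U g.
Proof.
move=> oU; elim: k f g => [|k IH] f g fg /= H.
  move=> x Ux; apply: near_eq_continuous (H x Ux).
  exact: near_open Ux _.
move=> a; have [d H'] := H a; split.
  move=> x Ux; apply: near_eq_derivable (d x Ux).
  exact: near_open Ux _.
apply: IH H' => x Ux; apply: near_eq_derive.
exact: near_open Ux _.
Qed.

Lemma Ck_on_entry k U m p (F : 'rV[R]_n -> 'M[R]_(m, p)) : open U ->
  Ck_on k U F <-> forall i j, Ck_on k U (fun x => F x i j).
Proof.
move=> oU; elim: k F => [|k IH] F /=.
  split=> [H i j x Ux|H x Ux].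
    by have /continuous_mxP := H x Ux; apply.
  by apply/continuous_mxP => i j; apply: H.
split=> [H i j a|H a].
  have [d /IH H'] := H a; split; first by move=> x /d/derivable_mxP.
  apply: Ck_on_eq (H' i j) => // x Ux.
  by rewrite /partial derive_mx ?mxE//; exact: d.
have dF x : U x -> derivable F x (delta_mx 0 a).
  by move=> Ux; apply/derivable_mxP => i j; exact: (H i j a).1.
split=> //; apply/IH => i j; apply: Ck_on_eq (H i j a).2 => // x Ux.
by rewrite /partial derive_mx ?mxE//; exact: dF.
Qed.

Lemma Ck1_bound U f (x : 'rV[R]_n) : open U -> Ck_on 1 U f -> U x ->
  exists2 B : R, 0 < B & \forall r \near 0^'+, forall y, ball x r y ->
    forall a, derivable f y (delta_mx 0 a) /\ `|partial a f y| <= B.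
Proof.
move=> oU H Ux.
exists (1 + \sum_a `|partial a f x|); first by rewrite ltr_wpDr// sumr_ge0.
have : \forall y \near x, forall a, derivable f y (delta_mx 0 a) /\
    `|partial a f y| <= 1 + \sum_a `|partial a f x|.
  apply: near_forall => a.
  have := continuous_near_dist ((H a).2 x Ux) ltr01.
  apply: filterS2 (open_nbhs_nbhs (conj oU Ux)) => y Uy H1.
  split; first exact: (H a).1.
  rewrite -(subrK (partial a f x) (partial a f y)).
  rewrite (le_trans (ler_normD _ _))// lerD//; first by rewrite distrC ltW.
  by rewrite (bigD1 a)//= lerDl sumr_ge0.
move=> /nbhs_ballP[r0 /= r00 H0].
near=> r => y yr; apply: H0; apply: le_ball yr.
by near: r; apply: nbhs_right_le.
Unshelve. all: by end_near. Qed.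

Lemma Ck1_continuous U f : open U -> Ck_on 1 U f -> Ck_on 0 U f.
Proof.
move=> oU H x Ux; have [B B0 HB] := Ck1_bound oU H Ux.
have /filter_ex[r [r0 {}HB]] : \forall r \near 0^'+, 0 < r /\
   forall y, ball x r y -> forall a, derivable f y (delta_mx 0 a) /\ `|partial a f y| <= B.
  near=> r; split; first by near: r; exact: nbhs_right_gt.
  by near: r.
apply: continuous_of_dist => e e0; apply/nbhs_ballP.
have c0 : 0 < (n%:R * B + 1) by rewrite ltr_wpDl// mulr_ge0// ltW.
exists (Num.min r (e / (n%:R * B + 1))) => /=; first by rewrite lt_min r0 divr_gt0.
move=> y xy; have /ballE_norm := xy; rewrite lt_min => /andP[yr ye].
rewrite distrC.
apply: le_trans (partial_lipschitz (ltW B0) HB (ballxx _ r0) _) _.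
  exact/ballE_norm.
rewrite distrC; apply: (@le_trans _ _ ((n%:R * B + 1) * `|x - y|)).
  by rewrite ler_wpM2r// lerDl.
by rewrite mulrC -ler_pdivlMr// ltW.
Unshelve. all: by end_near. Qed.

Lemma Ck_onS k U f : open U -> Ck_on k.+1 U f -> Ck_on k U f.
Proof.
move=> oU; elim: k f => [|k IH] f; first exact: Ck1_continuous.
by move=> H a; have [d H'] := H a; split=> //; exact: IH.
Qed.

Lemma Ck_on_le k l U f : open U -> (k <= l)%N -> Ck_on l U f -> Ck_on k U f.
Proof.
move=> oU /subnK <-; elim: (l - k)%N => [//|j IH] H.
by apply: IH; exact: Ck_onS.
Qed.

Lemma Ck_cst k U (a : R) : Ck_on k U (fun=> a).
Proof.
elim: k a => [|k IH] a /=; first by move=> x _; exact: continuous_cst.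
move=> b; split=> [x _|]; first exact: derivable_cst.
have -> : partial b (fun=> a) = (fun=> 0 : R); last exact: IH.
by apply/funext => x; rewrite /partial derive_cst.
Qed.

Lemma Ck_add k U f g : open U -> Ck_on k U f -> Ck_on k U g ->
  Ck_on k U (fun x => f x + g x).
Proof.
move=> oU; elim: k f g => [|k IH] f g /= Hf Hg.
  by move=> x Ux; apply: continuous_addr; [exact: Hf|exact: Hg].
move=> a; have [df Hf'] := Hf a; have [dg Hg'] := Hg a.
split=> [x Ux|]; first by apply: derivableD; [exact: df|exact: dg].
apply: Ck_on_eq (IH _ _ Hf' Hg') => // x Ux.
by rewrite /partial deriveD; [by []|exact: df|exact: dg].
Qed.

Lemma Ck_mul k U f g : open U -> Ck_on k U f -> Ck_on k U g ->
  Ck_on k U (fun x => f x * g x).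
Proof.
move=> oU; elim: k f g => [|k IH] f g Hf Hg.
  by move=> x Ux; apply: continuous_mulr; [exact: Hf|exact: Hg].
move=> a; have [df Hf'] := Hf a; have [dg Hg'] := Hg a.
split=> [x Ux|]; first by apply: derivableM; [exact: df|exact: dg].
have H1 := IH _ _ (Ck_onS oU Hf) Hg'; have H2 := IH _ _ (Ck_onS oU Hg) Hf'.
apply: Ck_on_eq (Ck_add oU H1 H2) => // x Ux.
by rewrite /partial deriveM; [by []|exact: df|exact: dg].
Qed.

Lemma Ck_sum k U (I : Type) (r : seq I) (f : I -> 'rV[R]_n -> R) : open U ->
  (forall i, Ck_on k U (f i)) -> Ck_on k U (fun x => \sum_(i <- r) f i x).
Proof.
move=> oU H; elim: r => [|i r IH].
  by apply: Ck_on_eq (Ck_cst k U 0) => // x _; rewrite big_nil.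
by apply: Ck_on_eq (Ck_add oU (H i) IH) => // x _; rewrite big_cons.
Qed.

Lemma Ck_prod k U (I : Type) (r : seq I) (f : I -> 'rV[R]_n -> R) : open U ->
  (forall i, Ck_on k U (f i)) -> Ck_on k U (fun x => \prod_(i <- r) f i x).
Proof.
move=> oU H; elim: r => [|i r IH].
  by apply: Ck_on_eq (Ck_cst k U 1) => // x _; rewrite big_nil.
by apply: Ck_on_eq (Ck_mul oU (H i) IH) => // x _; rewrite big_cons.
Qed.

Lemma Ck_inv k U f : open U -> (forall x, U x -> f x != 0) -> Ck_on k U f ->
  Ck_on k U (fun x => (f x)^-1).
Proof.
move=> oU f0; elim: k f f0 => [|k IH] f f0 Hf.
  by move=> x Ux; have := Hf x Ux; apply: continuousV; exact: f0.
move=> a; have [df Hf'] := Hf a.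
split=> [x Ux|]; first by apply: derivableV; [exact: f0|exact: df].
have H1 := IH _ f0 (Ck_onS oU Hf).
have H2 := Ck_mul oU (Ck_cst k U (-1)) (Ck_mul oU (Ck_mul oU H1 H1) Hf').
apply: Ck_on_eq H2 => // x Ux.
rewrite /partial deriveV ?f0//; last exact: df.
by rewrite mulN1r -exprVn -expr2 scaleNr.
Qed.

Lemma Ck_det k U m (A : 'rV[R]_n -> 'M[R]_m) : open U ->
  (forall i j, Ck_on k U (fun x => A x i j)) -> Ck_on k U (fun x => \det (A x)).
Proof.
move=> oU H; rewrite /determinant; apply: Ck_sum => // s.
by apply: Ck_mul => //; [exact: Ck_cst|apply: Ck_prod => // i; exact: H].
Qed.

(** Cramer's rule. *)
Lemma Ck_invmx k U m (A : 'rV[R]_n -> 'M[R]_m) : open U ->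
  (forall x, U x -> A x \in unitmx) ->
  (forall i j, Ck_on k U (fun x => A x i j)) ->
  forall i j, Ck_on k U (fun x => invmx (A x) i j).
Proof.
move=> oU Au H i j.
have H1 : Ck_on k U (fun x => (\det (A x))^-1).
  apply: Ck_inv => //; last exact: Ck_det.
  by move=> x /Au; rewrite unitmxE unitfE.
have H2 : Ck_on k U (fun x => \adj (A x) i j).
  have E : (fun x => (-1) ^+ (j + i) * \det (row' j (col' i (A x)))) =
    (fun x => \adj (A x) i j) by apply/funext => x; rewrite mxE.
  rewrite -E; apply: Ck_mul => //; first exact: Ck_cst.
  apply: Ck_det => // i' j'.
  have -> : (fun x => row' j (col' i (A x)) i' j') = (fun x => A x (lift j i') (lift i j')).
    by apply/funext => x; rewrite !mxE.
  exact: H.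
apply: Ck_on_eq (Ck_mul oU H1 H2) => // x Ux.
by rewrite /invmx Au// [RHS]mxE.
Qed.

Lemma Ck1_is_derive_comp U f (V : normedModType R) (G : V -> 'rV[R]_n) x v dG :
  open U -> Ck_on 1 U f -> U (G x) -> is_derive x v G dG ->
  is_derive x v (f \o G) (\sum_b dG 0 b * partial b f (G x)).
Proof.
move=> oU H Ux dg; apply: is_derive_chain1 => //.
  by apply: near_open Ux _ => // y Uy a; exact: (H a).1.
by move=> a; exact: (H a).2.
Qed.

Lemma Ck1_differentiable U m (F : 'rV[R]_n -> 'rV[R]_m) x :
  open U -> (forall b, Ck_on 1 U (fun y => F y 0 b)) -> U x -> differentiable F x.
Proof.
move=> oU H Ux; apply: C1_differentiable => b.
  by apply: near_open Ux _ => // y Uy a; exact: (H b a).1.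
by move=> a; exact: (H b a).2.
Qed.

End CkCalculus.

Lemma Ck_comp {R : realType} {n m : nat} k (U : set 'rV[R]_n) (W : set 'rV[R]_m)
    (f : 'rV[R]_m -> R) (G : 'rV[R]_n -> 'rV[R]_m) :
  open U -> open W -> (forall x, U x -> W (G x)) ->
  Ck_on k W f -> (forall b, Ck_on k U (fun x => G x 0 b)) -> Ck_on k U (f \o G).
Proof.
move=> oU oW UW; elim: k f => [|k IH] f Hf HG.
  move=> x Ux; apply: continuous_comp; last exact: Hf (UW _ Ux).
  by apply/continuous_rVP => b; exact: HG.
have H1 : Ck_on 1 W f by apply: Ck_on_le Hf.
move=> a.
have dG x : U x -> is_derive x (delta_mx 0 a) G (\row_b partial a (fun y => G y 0 b) x).
  move=> Ux; apply/is_derive_rVP => b; rewrite mxE; apply: DeriveDef => //.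
  exact: (HG b a).1.
have df x : U x -> is_derive x (delta_mx 0 a) (f \o G)
    (\sum_b partial a (fun y => G y 0 b) x * partial b f (G x)).
  move=> Ux.
  have := Ck1_is_derive_comp oW H1 (UW _ Ux) (dG _ Ux).
  by under eq_bigr do rewrite mxE.
split=> [x /df[]//|].
have HG' b : Ck_on k U (fun x => G x 0 b) by exact: Ck_onS.
apply: (@Ck_on_eq _ _ _ k _ (fun x => \sum_b partial a (fun y => G y 0 b) x * partial b f (G x))) => //.
  by move=> x /df[_ <-].
apply: Ck_sum => // b; apply: Ck_mul => //; first exact: (HG b a).2.
by apply: IH => //; exact: (Hf b).2.
Qed.

(** A continuous inverse of a smooth map with invertible Jacobian is smooth:
    its first derivatives are the entries of the inverse Jacobian, so each order
    of differentiability propagates to the next. *)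
Lemma smooth_inverse {R : realType} {n : nat} (U W : set 'rV[R]_n)
    (F G : 'rV[R]_n -> 'rV[R]_n) : open U -> open W ->
  (forall x, U x -> W (F x)) -> (forall x, U x -> G (F x) = x) ->
  (forall y, W y -> U (G y)) -> (forall y, W y -> F (G y) = y) ->
  (forall y, W y -> {for y, continuous G}) ->
  smooth_on U F -> (forall x, U x -> 'J F x \in unitmx) ->
  smooth_on W G.
Proof.
move=> oU oW UW GF WU FG cG sF uF.
have CF k b : Ck_on k U (fun x => F x 0 b).
  exact: Ck_onS oU ((Ck_on_entry k.+1 F oU).1 (sF k) 0 b).
have dF x : U x -> differentiable F x by move=> Ux; apply: Ck1_differentiable Ux.
have dG y : W y -> differentiable G y /\ 'J G y = invmx ('J F (G y)).
  move=> Wy; apply: differentiable_of_taylor => e e0.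
  set A := 'J F (G y); have uA : A \in unitmx by apply/uF/WU.
  pose C := n%:R * `|invmx A| + 1.
  have C0 : 0 < C by rewrite ltr_wpDl// mulr_ge0.
  have mulC (v : 'rV[R]_n) : `|v *m invmx A| <= C * `|v|.
    apply: rV_norm_le => [|k]; first by rewrite mulr_ge0// ltW.
    rewrite mxE (le_trans (ler_norm_sum _ _ _))//.
    apply: (@le_trans _ _ (\sum_(j < n) (`|invmx A| * `|v|))).
      apply: ler_sum => j _; rewrite normrM mulrC.
      by apply: ler_pM => //; exact: mx_entry_norm.
    rewrite sumr_const card_ord -mulrnAl -mulr_natl ler_wpM2r//.
    by rewrite lerDl.
  (* The first bound makes |h| at most 2 C |z - y|, the second one gives the estimate. *)
  pose e1 := Num.min (2 * C)^-1 (e / (2 * C ^+ 2)).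
  have e10 : 0 < e1.
    by rewrite lt_min invr_gt0 mulr_gt0//= divr_gt0// mulr_gt0// exprn_gt0.
  have /(_ _ e10) := differentiable_taylor (dF _ (WU _ Wy)).
  move=> /(cG _ Wy) H; near=> z.
  have Wz : W z by near: z; exact: open_nbhs_nbhs.
  have : `|F (G z) - F (G y) - (G z - G y) *m A| <= e1 * `|G z - G y|.
    by near: z; exact: H.
  rewrite !FG//; set h := G z - G y => Hz.
  have hE : h - (z - y) *m invmx A = - ((z - y - h *m A) *m invmx A).
    by rewrite [in RHS]mulmxBl mulmxK// opprB.
  have h1 : `|h - (z - y) *m invmx A| <= C * (e1 * `|h|).
    by rewrite hE normrN (le_trans (mulC _))// ler_wpM2l// ltW.
  have h2 : `|h| <= 2 * C * `|z - y|.
    have : `|h| <= `|h| / 2 + C * `|z - y|.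
      rewrite -{1}(subrK ((z - y) *m invmx A) h) (le_trans (ler_normD _ _))//.
      rewrite lerD// (le_trans h1)// mulrA mulrC ler_wpM2l//.
      apply: (@le_trans _ _ (C * (2 * C)^-1)).
        by rewrite ler_wpM2l ?ge_min ?lexx// ltW.
      by rewrite invfM mulrCA mulfV ?mulr1// gt_eqF.
    lra.
  rewrite (le_trans h1)// mulrA.
  apply: (@le_trans _ _ (C * (e / (2 * C ^+ 2)) * (2 * C * `|z - y|))).
    apply: ler_pM => //; first by rewrite mulr_ge0// ltW.
    by rewrite ler_wpM2l ?ge_min ?lexx ?orbT// ltW.
  rewrite le_eqVlt; apply/orP; left; apply/eqP.
  field; by rewrite gt_eqF.
have CG k b : Ck_on k W (fun y => G y 0 b).
  elim: k b => [|k IH] b.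
    by move=> y Wy; have /continuous_rVP := cG y Wy; apply.
  move=> a; split=> [y Wy|].
    have : derivable G y (delta_mx 0 a) by apply: diff_derivable (dG _ Wy).1.
    by move=> /derivable_mxP; apply.
  apply: (@Ck_on_eq _ _ _ k _ ((fun x => invmx ('J F x) a b) \o G)) => //.
    by move=> y Wy; have [d e] := dG _ Wy; rewrite /= -e jacobianE.
  apply: (Ck_comp oW oU WU) => //.
  apply: Ck_invmx => // i j.
  apply: Ck_on_eq (CF k.+1 j i).2 => // x Ux.
  by rewrite jacobianE//; exact: dF.
by move=> k; apply/(Ck_on_entry _ _ oW) => i b; rewrite ord1; exact: CG.
Unshelve. all: by end_near. Qed.

(** * The real line *)

Section RealLine.
Context {R : realType}.
Implicit Types (a b t : R).

Definition clamp a b t : R := Num.max a (Num.min b t).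

Lemma clamp_continuous a b : continuous (clamp a b).
Proof.
move=> t; apply: continuous_max; first exact: cvg_cst.
by apply: continuous_min; [exact: cvg_cst|exact: cvg_id].
Qed.

Lemma clamp_id a b t : a <= t <= b -> clamp a b t = t.
Proof. by move=> /andP[aT tb]; rewrite /clamp (min_idPr tb) (max_idPr aT). Qed.

Lemma clamp_in a b t : a <= b -> a <= clamp a b t <= b.
Proof. by move=> ab; rewrite /clamp le_max lexx/= ge_max ab ge_min lexx. Qed.

Lemma near_itv a b t : a < t < b -> \forall s \near t, a < s < b.
Proof.
move=> /andP[aT tb]; near=> s; apply/andP; split; near: s.
  exact: lt_nbhsr.
exact: lt_nbhsl.
Unshelve. all: by end_near. Qed.

(** Monotonicity from the sign of the derivative, for functions that have corners;
    all comparisons of lengths below reduce to it, so that vector-valued integrals are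
    avoided. *)
Lemma nondecreasing_off_finite (s : seq R) (F : R -> R) a b : a <= b ->
  (forall t, a <= t <= b -> {for t, continuous F}) ->
  (forall t, a < t < b -> t \notin s -> exists2 d, is_derive t 1 F d & 0 <= d) ->
  F a <= F b.
Proof.
elim: s a b => [|x s IH] a b ab cF dF.
  have dF' t : t \in `]a, b[ -> derivable F t 1 /\ 0 <= derive1 F t.
    by rewrite in_itv/= => /dF/(_ isT)[d [d1 d2] d0]; rewrite derive1E d2.
  apply: (@ger0_derive1_le_cc R F a b) => //; rewrite ?in_itv/= ?lexx ?ab//.
  - by move=> t /dF'[].
  - by move=> t /dF'[].
  - by apply: continuous_in_subspaceT => t; rewrite inE/= in_itv/=; exact: cF.
have [/andP[ax xb]|axb] := boolP (a < x < b).
  apply: (@le_trans _ _ (F x)); apply: IH; rewrite ?ltW//.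
  - by move=> t /andP[t1 t2]; apply: cF; rewrite t1/= (le_trans t2)// ltW.
  - move=> t /andP[t1 t2] ts; apply: dF; first by rewrite t1 (lt_trans t2).
    by rewrite inE negb_or ts lt_eqF.
  - by move=> t /andP[t1 t2]; apply: cF; rewrite t2 andbT (le_trans _ t1)// ltW.
  - move=> t /andP[t1 t2] ts; apply: dF; first by rewrite t2 (lt_trans ax).
    by rewrite inE negb_or ts gt_eqF.
apply: IH => // t tab ts; apply: dF => //.
by rewrite inE negb_or ts andbT; apply: contraNneq axb => <-.
Qed.

Lemma constant_off_finite (s : seq R) (F : R -> R) a b : a <= b ->
  (forall t, a <= t <= b -> {for t, continuous F}) ->
  (forall t, a < t < b -> t \notin s -> is_derive t 1 F 0) ->
  F a = F b.
Proof.
move=> ab cF dF; apply/le_anti/andP; split.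
  by apply: (@nondecreasing_off_finite s) => // t t1 t2; exists 0 => //; exact: dF.
have cF' t : a <= t <= b -> {for t, continuous (- F)} by move=> /cF; exact: continuousN.
have := @nondecreasing_off_finite s (- F) a b ab cF'.
rewrite -[(- F) a]/(- F a) -[(- F) b]/(- F b) lerN2; apply=> t t1 t2.
by exists 0 => //; rewrite -oppr0; apply: is_deriveN; exact: dF.
Qed.

Lemma primitive_exists (f : R -> R) a b : continuous f ->
  exists F : R -> R, forall t, a < t < b -> is_derive t 1 F (f t).
Proof.
move=> cf; exists (fun x => \int[lebesgue_measure]_(t in `[a, x]) f t)%R => t /andP[aT tb].
have fi : lebesgue_measure.-integrable `[a, b] (EFin \o f).
  apply: continuous_compact_integrable; first exact: segment_compact.
  exact: continuous_subspaceT.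
have [d1 d2] := continuous_FTC1_closed tb fi aT (cf t).
by apply: DeriveDef d1 _; rewrite -derive1E.
Qed.

Lemma is_derive_continuous (V : normedModType R) (f : R -> V) t d :
  is_derive t 1 f d -> {for t, continuous f}.
Proof. by move=> [/derivable1_diffP/differentiable_continuous]. Qed.

Lemma is_derive_addc (V : normedModType R) (f : R -> V) t d c :
  is_derive t 1 f d -> is_derive t 1 (fun x => f x + c) d.
Proof.
move=> df; have -> : (fun x => f x + c) = f + cst c by apply/funext.
by rewrite -[d]addr0; apply: is_deriveD.
Qed.

Lemma integral_continuous_derive (f F : R -> R) a b : a < b -> continuous f ->
  (forall t, a <= t <= b -> is_derive t 1 F (f t)) ->
  (\int[lebesgue_measure]_(t in `[a, b]) (f t)%:E = (F b - F a)%:E)%E.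
Proof.
move=> ab cf dF; rewrite EFinB; apply: continuous_FTC2 => //.
- exact: continuous_subspaceT.
- split.
  + by move=> t; rewrite in_itv/= => /andP[t1 t2]; have [|//] := dF t; rewrite !ltW.
  + apply: cvg_at_right_filter; apply: is_derive_continuous (dF a _).
    by rewrite lexx ltW.
  + apply: cvg_at_left_filter; apply: is_derive_continuous (dF b _).
    by rewrite lexx ltW.
- move=> t; rewrite in_itv/= => /andP[t1 t2]; rewrite derive1E.
  by have [|//] := dF t; rewrite !ltW.
Qed.

(** The supremum of the initial segments on which P holds is b. *)
Lemma segment_induction a b (P : R -> Prop) : a <= b -> P a ->
  (forall t, a <= t < b -> (forall s, a <= s <= t -> P s) ->
     exists2 e, 0 < e & forall s, t < s < t + e -> s <= b -> P s) ->
  (forall t, a < t <= b -> (forall s, a <= s < t -> P s) -> P t) ->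
  forall t, a <= t <= b -> P t.
Proof.
move=> ab Pa step lim.
pose A := [set t | a <= t <= b /\ forall s, a <= s <= t -> P s].
have Aa : A a.
  split; first by rewrite lexx.
  by move=> s; rewrite -eq_le => /eqP <-.
have supA : has_sup A by split; [exists a|exists b => t [/andP[]]].
set m := sup A.
have am : a <= m by apply: ub_le_sup => //; exact: supA.2.
have mb : m <= b by apply: ge_sup; [exists a|move=> t [/andP[]]].
have Plt s : a <= s < m -> P s.
  move=> /andP[as_ sm]; have [t At st] := sup_gt (ex_intro _ a Aa) sm.
  by apply: At.2; rewrite as_ ltW.
have Pm : P m.
  have [->//|am'] := eqVneq m a.
  by apply: lim => //; rewrite lt_neqAle eq_sym am' am.
have Pa' s : a <= s <= m -> P s.
  move=> /andP[as_]; rewrite le_eqVlt => /predU1P[->//|sm].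
  by apply: Plt; rewrite as_.
have {}mb : m = b.
  apply/eqP; rewrite eq_le mb leNgt; apply/negP => mb'.
  have [|e e0 Pe] := step m _ Pa'; first by rewrite am.
  pose m' := Num.min b (m + e / 2).
  have mm' : m < m' by rewrite lt_min mb'/= ltrDl divr_gt0.
  have : A m'.
    split; first by rewrite (le_trans am (ltW mm'))/= ge_min lexx.
    move=> s /andP[as_ sm']; have [sm|ms] := leP s m; first by apply: Pa'; rewrite as_.
    apply: Pe; last by rewrite (le_trans sm')// ge_min lexx.
    rewrite ms/= (le_lt_trans sm')// gt_min; apply/orP; right.
    by rewrite ltrD2l ltr_pdivrMr// ltr_pMr// ltr1n.
  move=> /(ub_le_sup supA.2); rewrite -/m leNgt mm'//.
by move=> t; rewrite -mb; exact: Pa'.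
Qed.

End RealLine.

(** * Charts and curves *)

Section ChartBasics.
Context {R : realType} {n : nat} {T : topologicalType}.
Implicit Types (c d : chart R n T).

Lemma chart_near c z : dom c z -> \forall y \near z, dom c y.
Proof. by move=> cz; apply: near_open (@dom_open _ _ _ c) cz _. Qed.

Lemma chart_coordK c z : dom c z -> inv c (c z) = z.
Proof. by move=> cz; apply: coordK; rewrite inE. Qed.

Lemma chart_im c z : dom c z -> im c (c z).
Proof. by exists z. Qed.

Lemma chart_invK c x : im c x -> dom c (inv c x) /\ c (inv c x) = x.
Proof. by move=> [z cz <-]; rewrite chart_coordK. Qed.

Lemma chart_continuous c z : dom c z -> {for z, continuous c}.
Proof.
move=> cz; have := @coord_continuous _ _ _ c.
by rewrite continuous_open_subspace; [apply; rewrite inE|exact: dom_open].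
Qed.

Lemma chart_inv_continuous c x : im c x -> {for x, continuous (inv c)}.
Proof.
move=> cx; have := @inv_continuous _ _ _ c.
by rewrite continuous_open_subspace; [apply; rewrite inE|exact: im_open].
Qed.

Lemma chart_im_near c x : im c x -> \forall y \near x, im c y.
Proof. by move=> cx; exact: (open_nbhs_nbhs (conj (@im_open _ _ _ c) cx)). Qed.

Lemma near_inv c x (P : T -> Prop) : im c x ->
  (\forall z \near inv c x, P z) -> \forall y \near x, P (inv c y).
Proof. by move=> /chart_inv_continuous cx; apply: cx. Qed.

End ChartBasics.

Section LocalExpressions.
Context {R : realType} {n : nat} {T : topologicalType}.
Implicit Types (c : chart R n T).

Lemma local_dom_open (S : topologicalType) (f : T -> S) c (d : chart R n S) :
  continuous f -> open (local_dom f c d).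
Proof.
move=> cf; rewrite openE => x [cx dx].
have dx' : \forall z \near inv c x, dom d (f z).
  by apply: (cf (inv c x)); exact: chart_near.
by apply: filterS2 (chart_im_near cx) (near_inv cx dx') => y.
Qed.

Lemma local_expr_Ck (S : topologicalType) (f : T -> S) c (d : chart R n S) k b :
  continuous f -> smooth_in f c d ->
  Ck_on k (local_dom f c d) (fun x => local_expr f c d x 0 b).
Proof.
move=> cf sf; have oL := @local_dom_open S f c d cf.
exact: Ck_onS oL ((Ck_on_entry k.+1 _ oL).1 (sf k) 0 b).
Qed.

Lemma local_expr_differentiable (S : topologicalType) (f : T -> S) c (d : chart R n S) x :
  continuous f -> smooth_in f c d -> local_dom f c d x ->
  differentiable (local_expr f c d) x.
Proof.
move=> cf sf; apply: Ck1_differentiable; first exact: local_dom_open.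
by move=> b; exact: local_expr_Ck.
Qed.

End LocalExpressions.

Section Curves.
Context {R : realType} {n : nat} {M : riemannianManifold R n}.
Implicit Types (c d : chart R n M) (g h : R -> M) (t : R).

Lemma transition_differentiable c d x : atlas c -> atlas d ->
  local_dom idfun c d x -> differentiable (local_expr idfun c d) x.
Proof.
move=> ac ad; apply: local_expr_differentiable; first by move=> z; exact: cvg_id.
exact: atlas_compatible.
Qed.

Lemma curve_near g t c : {for t, continuous g} -> dom c (g t) ->
  \forall s \near t, dom c (g s).
Proof. by move=> cg cgt; apply: cg; exact: chart_near. Qed.

Lemma curve_continuous c g t : (\forall s \near t, dom c (g s)) ->
  {for t, continuous (c \o g)} -> {for t, continuous g}.
Proof.
move=> cg ct; apply: (@near_eq_continuous _ _ (inv c \o (c \o g))).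
  by apply: filterS cg => s /chart_coordK.
apply: continuous_comp; first exact: ct.
exact/chart_inv_continuous/chart_im/(nbhs_singleton cg).
Qed.

Lemma is_derive_change_chart c d g t v : atlas c -> atlas d ->
  {for t, continuous g} -> dom c (g t) -> dom d (g t) ->
  is_derive t 1 (c \o g) v ->
  is_derive t 1 (d \o g) (v *m 'J (local_expr idfun c d) (c (g t))).
Proof.
move=> ac ad cg ct dt dg.
have lx : local_dom idfun c d ((c \o g) t).
  by split; [exact: chart_im|rewrite /= chart_coordK].
have := is_derive_chain dg (transition_differentiable ac ad lx).
apply: near_eq_is_derive; apply: filterS (curve_near cg ct) => s cs.
by rewrite /local_expr /= chart_coordK.
Qed.

Lemma inner_change_chart c d x u v : atlas c -> atlas d ->
  local_dom idfun c d x ->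
  inner c x u v = inner d (local_expr idfun c d x)
    (u *m 'J (local_expr idfun c d) x) (v *m 'J (local_expr idfun c d) x).
Proof.
move=> ac ad lx; rewrite /inner (metric_compatible ac ad lx).
by rewrite trmx_mul !mulmxA.
Qed.

(** The metric transforms with the Jacobian of the transition maps, so that the
    chosen chart in the definition of the speed may be replaced by any other one. *)
Lemma speedE c g t v : atlas c -> {for t, continuous g} -> dom c (g t) ->
  is_derive t 1 (c \o g) v -> speed g t = Num.sqrt (inner c (c (g t)) v v).
Proof.
move=> ac cg ct dg.
set d := chart_at (g t).
have ad : atlas d := chart_at_atlas _; have dt : dom d (g t) := chart_at_dom _.
have lx : local_dom idfun c d (c (g t)).
  by split; [exact: chart_im|rewrite /= chart_coordK].
have [_ dE] := is_derive_change_chart ac ad cg ct dt dg.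
rewrite /speed -/d derive1E dE (inner_change_chart _ _ ac ad lx).
by congr (Num.sqrt (inner d _ _ _)); rewrite /local_expr /= chart_coordK.
Qed.

Lemma near_curve_regular c g t : {for t, continuous g} -> dom c (g t) ->
  (\forall s \near t, derivable (c \o g) s 1) ->
  \forall s \near t, [/\ dom c (g s), {for s, continuous g} & derivable (c \o g) s 1].
Proof.
move=> cg ct dg.
have := near_join (curve_near cg ct).
apply: filterS2 dg => s ds cs; split => //; first exact: nbhs_singleton cs.
apply: curve_continuous cs _.
exact: is_derive_continuous (derivableP ds).
Qed.

Lemma jacobian_continuous c d x i j : atlas c -> atlas d ->
  local_dom idfun c d x -> {for x, continuous (fun y => 'J (local_expr idfun c d) y i j)}.
Proof.
move=> ac ad lx.
have cid' : continuous (@idfun M) by move=> z; exact: cvg_id.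
have oL := @local_dom_open _ _ _ _ idfun c d cid'.
have := (local_expr_Ck 1 j cid' (atlas_compatible ac ad) i).2 x lx.
apply: near_eq_continuous; apply: near_open oL lx _ => y ly.
by rewrite jacobianE//; exact: transition_differentiable.
Qed.

(** Transition maps are differentiable, and their Jacobians depend continuously on
    the point. *)
Lemma C1_at_of_chart c g t : atlas c -> {for t, continuous g} -> dom c (g t) ->
  (\forall s \near t, derivable (c \o g) s 1) ->
  {for t, continuous (derive1 (c \o g))} -> C1_at g t.
Proof.
move=> ac cg ct dg cdg; split; [exact: cg|move=> d ad dt].
have near1 : \forall s \near t, is_derive (s : R) 1 (d \o g)
    (derive1 (c \o g) s *m 'J (local_expr idfun c d) (c (g s))).
  apply: filterS2 (curve_near cg dt) (near_curve_regular cg ct dg) => s ds [cs gs dcs].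
  have dcs' : is_derive (s : R) 1 (c \o g) (derive1 (c \o g) s).
    by rewrite derive1E; exact: derivableP.
  exact: (is_derive_change_chart ac ad gs cs ds dcs').
split; first by apply: filterS near1 => s [].
have lx : local_dom idfun c d (c (g t)).
  by split; [exact: chart_im|rewrite /= chart_coordK].
apply: (@near_eq_continuous _ _ (fun s => derive1 (c \o g) s *m 'J (local_expr idfun c d) (c (g s)))).
  by apply: filterS near1 => s [_ <-]; rewrite derive1E.
apply/continuous_rVP => k.
have -> : (fun s => (derive1 (c \o g) s *m 'J (local_expr idfun c d) (c (g s))) 0 k) =
   (fun s => \sum_j derive1 (c \o g) s 0 j * 'J (local_expr idfun c d) (c (g s)) j k).
  by apply/funext => s; rewrite mxE.
apply: continuous_sumr => j; apply: continuous_mulr.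
  by have /continuous_rVP := cdg; apply.
have := @jacobian_continuous c d _ j k ac ad lx.
apply: (@continuous_comp _ _ _ (c \o g)).
by apply: continuous_comp => //; exact: chart_continuous.
Qed.

Lemma metric_entry_Ck c k i j : atlas c -> Ck_on k (im c) (fun x => metric c x i j).
Proof.
move=> ac; have oI : open (im c) := @im_open _ _ _ c.
exact: Ck_onS oI ((Ck_on_entry k.+1 _ oI).1 (metric_smooth ac k) i j).
Qed.

Lemma innerE c x u v : inner c x u v = \sum_j (\sum_i u 0 i * metric c x i j) * v 0 j.
Proof.
rewrite /inner mxE; apply: eq_bigr => j _; rewrite !mxE.
by congr (_ * _).
Qed.

Lemma speed_continuous g t : C1_at g t -> {for t, continuous (speed g)}.
Proof.
move=> [cg H]; set c := chart_at (g t).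
have ac : atlas c := chart_at_atlas _; have ct : dom c (g t) := chart_at_dom _.
have [dg cdg] := H _ ac ct.
apply: (@near_eq_continuous _ _ (fun s => Num.sqrt (inner c (c (g s)) (derive1 (c \o g) s) (derive1 (c \o g) s)))).
  apply: filterS (near_curve_regular cg ct dg) => s [cs gs ds].
  have ds' : is_derive (s : R) 1 (c \o g) (derive1 (c \o g) s).
    by rewrite derive1E; exact: derivableP.
  by rewrite (speedE ac gs cs ds').
apply: (@continuous_comp _ _ _ _ Num.sqrt); last exact: sqrt_continuous.
have -> : (fun s => inner c (c (g s)) (derive1 (c \o g) s) (derive1 (c \o g) s)) =
   (fun s => \sum_j (\sum_i derive1 (c \o g) s 0 i * metric c (c (g s)) i j) * derive1 (c \o g) s 0 j).
  by apply/funext => s; rewrite innerE.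
have cd j : {for t, continuous (fun s => derive1 (c \o g) s 0 j)}.
  by have /continuous_rVP := cdg; apply.
apply: continuous_sumr => j; apply: continuous_mulr => //.
apply: continuous_sumr => i; apply: continuous_mulr => //.
have := @metric_entry_Ck c 0 i j ac _ (chart_im ct).
apply: (@continuous_comp _ _ _ (c \o g)).
by apply: continuous_comp => //; exact: chart_continuous.
Qed.

Lemma speed_ge0 g t : 0 <= speed g t.
Proof. by rewrite /speed sqrtr_ge0. Qed.

Lemma near_eq_derive1 (V : normedModType R) (f1 f2 : R -> V) t :
  (\forall s \near t, f1 s = f2 s) -> derive1 f1 t = derive1 f2 t.
Proof. by move=> H; rewrite !derive1E; exact: near_eq_derive. Qed.

Lemma near_eq_speed g h t : (\forall s \near t, g s = h s) -> speed g t = speed h t.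
Proof.
move=> gh; rewrite /speed (nbhs_singleton gh); set c := chart_at _.
have -> // : derive1 (c \o g) t = derive1 (c \o h) t.
by apply: near_eq_derive1; apply: filterS gh => s /= ->.
Qed.

Lemma near_eq_C1 g h t : (\forall s \near t, g s = h s) -> C1_at g t -> C1_at h t.
Proof.
move=> gh [cg H]; split; first exact: near_eq_continuous gh cg.
rewrite -(nbhs_singleton gh) => c ac ct; have [d1 d2] := H c ac ct.
have cgh : \forall s \near t, \forall r \near s, (c \o g) r = (c \o h) r.
  by apply: near_join; apply: filterS gh => s /= ->.
split; first by apply: filterS2 cgh d1 => s; exact: near_eq_derivable.
by apply: near_eq_continuous d2; apply: filterS cgh => s; exact: near_eq_derive1.
Qed.

Lemma is_derive_affine (V : normedModType R) (f : R -> V) (k l t : R) v :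
  is_derive (k * t + l) 1 f v -> is_derive t 1 (fun s => f (k * s + l)) (k *: v).
Proof.
move=> df.
have da : is_derive t 1 (fun s : R => k * s + l) k.
  have -> : (fun s : R => k * s + l) = (k \*: (id : R -> R)) + cst l by apply/funext.
  by apply: is_derive_eq; rewrite addr0 [LHS]mulr1.
have dfd : differentiable f (k * t + l) by apply/derivable1_diffP; case: df.
have dad : differentiable (fun s : R => k * s + l) t by apply/derivable1_diffP; case: da.
have dc : differentiable (f \o (fun s : R => k * s + l)) t by exact: differentiable_comp.
apply: DeriveDef; first exact/derivable1_diffP.
have := @diff_comp R _ _ _ (fun s : R => k * s + l) f t dad dfd => E.
rewrite -[LHS]/('D_1 (f \o (fun s : R => k * s + l)) t) deriveE// E.
have [_ da2] := da; have [_ df2] := df.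
rewrite -[LHS]/('d f (k * t + l) ('d (fun s : R => k * s + l) t 1)).
have -> : 'd (fun s : R => k * s + l) t 1 = k *: (1 : R).
  by rewrite -deriveE// da2 -[RHS]/(k * 1) mulr1.
by rewrite linearZ/= -deriveE// df2.
Qed.

Lemma affine_continuous (k l : R) : continuous (fun s : R => k * s + l).
Proof.
by move=> t; apply: continuous_addr; [apply: continuous_mulr; [exact: cvg_cst|exact: cvg_id]|exact: cvg_cst].
Qed.

Lemma C1_at_affine g (k l t : R) :
  C1_at g (k * t + l) -> C1_at (fun s => g (k * s + l)) t.
Proof.
move=> [cg H]; set a := fun s : R => k * s + l.
have ca : {for t, continuous a} by apply: affine_continuous.
split; first exact: (continuous_comp ca cg).
move=> c ac ct; have [d1 d2] := H c ac ct.
have near1 : \forall s \near t, is_derive (s : R) 1 (fun r => (c \o g) (k * r + l)) (k *: derive1 (c \o g) (a s)).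
  have d1' := near_comp (f := a) (P := fun s => derivable (c \o g) s 1) ca d1.
  apply: filterS d1' => s ds; apply: is_derive_affine.
  by rewrite derive1E; exact: derivableP.
split; first by apply: filterS near1 => s [].
apply: (@near_eq_continuous _ _ (fun s => k *: derive1 (c \o g) (a s))).
  by apply: filterS near1 => s [_ <-]; rewrite derive1E.
by apply: continuousZl_tmp; exact: (continuous_comp ca d2).
Qed.

Lemma speed_affine g (k l t : R) : C1_at g (k * t + l) ->
  speed (fun s => g (k * s + l)) t = `|k| * speed g (k * t + l).
Proof.
move=> [cg H]; rewrite {1}/speed /speed; set c := chart_at _.
have [d1 _] := H c (chart_at_atlas _) (chart_at_dom _).
have : is_derive t 1 (fun r => (c \o g) (k * r + l)) (k *: derive1 (c \o g) (k * t + l)).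
  by apply: is_derive_affine; rewrite derive1E; exact/derivableP/(nbhs_singleton d1).
move=> [_ dE]; rewrite derive1E dE -sqrtr_sqr -sqrtrM ?sqr_ge0//.
congr Num.sqrt; rewrite /inner -!scalemxAl linearZ/= -scalemxAr scalerA mxE.
by rewrite expr2.
Qed.

End Curves.

(** * Piecewise C^1 curves and arc length *)

Section PiecewiseCurves.
Context {R : realType} {n : nat} {M : riemannianManifold R n}.
Implicit Types (g h : R -> M) (a b t : R).

Lemma pw_refl g a : piecewise_C1 g a a.
Proof. by exists [::]. Qed.

Lemma pw_segment g a b : a < b -> on_segment (@C1_at R n M) g a b -> piecewise_C1 g a b.
Proof. by move=> ab gab; exists [:: b]; split=> //=; rewrite ab/= andbT; apply/asboolP. Qed.

Lemma pw_cat g a m b : piecewise_C1 g a m -> piecewise_C1 g m b -> piecewise_C1 g a b.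
Proof.
move=> [s [ps ls]] [s' [ps' ls']]; exists (s ++ s').
by rewrite cat_path last_cat ls ps.
Qed.

Lemma pw_le g a b : piecewise_C1 g a b -> a <= b.
Proof.
move=> [s []]; elim: s a => [|x s IH] a /=; first by move=> _ ->.
by move=> /andP[/andP[ax _] ps] /(IH _ ps); apply: le_trans (ltW ax).
Qed.

(** Induction on the pieces of a curve, with no mention of the list of corners. *)
Lemma pw_ind g (P : R -> R -> Prop) :
  (forall a, P a a) ->
  (forall a b, a < b -> on_segment (@C1_at R n M) g a b -> P a b) ->
  (forall a m b, a <= m -> m <= b -> P a m -> P m b -> P a b) ->
  forall a b, piecewise_C1 g a b -> P a b.
Proof.
move=> P0 P1 P2 a b [s [ps ls]]; elim: s a ps ls => [|x s IH] a /=.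
  by move=> _ <-.
move=> /andP[/andP[ax /asboolP gax] ps] ls.
have xb : x <= b by apply: (@pw_le g); exists s.
by apply: (P2 _ x) => //; [exact: ltW|exact: P1|exact: IH].
Qed.

Lemma on_segment_sub (P : (R -> M) -> R -> Prop) g a b s t :
  a <= s -> t <= b -> on_segment P g a b -> on_segment P g s t.
Proof.
move=> as_ tb [h [e [e0 hg Ph]]]; exists h, e; split=> //.
  by move=> x /andP[sx xt]; apply: hg; rewrite (le_trans as_)//= (le_trans xt).
move=> x /andP[sx xt]; apply: Ph.
by rewrite (le_lt_trans _ sx) ?lerB//= (lt_le_trans xt) ?lerD2r.
Qed.

Lemma pw_sub g a b s t : piecewise_C1 g a b -> a <= s -> s <= t -> t <= b ->
  piecewise_C1 g s t.
Proof.
move=> gab; move: a b gab s t; apply: pw_ind.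
- move=> a s t as_ st ta; have sa : s = a by apply/le_anti; rewrite as_ (le_trans st).
  have ta' : t = a by apply/le_anti; rewrite ta -sa.
  by rewrite sa ta'; exact: pw_refl.
- move=> a b ab gab s t as_; rewrite le_eqVlt => /predU1P[-> _|st tb]; first exact: pw_refl.
  by apply: pw_segment => //; exact: on_segment_sub gab.
- move=> a m b am mb H1 H2 s t as_ st tb.
  have [tm|mt] := leP t m; first exact: H1.
  have [ms|sm] := leP m s; first exact: H2.
  by apply: (@pw_cat _ _ m); [apply: H1 => //; exact: ltW|apply: H2 => //; exact: ltW].
Qed.

Lemma on_segment_eq (P : (R -> M) -> R -> Prop) g h a b :
  (forall t, a <= t <= b -> g t = h t) -> on_segment P g a b -> on_segment P h a b.
Proof.
move=> gh [g' [e [e0 gg Pg]]]; exists g', e; split=> // t tab.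
by rewrite gg// gh.
Qed.

Lemma pw_eq g h a b : (forall t, a <= t <= b -> g t = h t) ->
  piecewise_C1 g a b -> piecewise_C1 h a b.
Proof.
move=> gh gab; move: a b gab gh; apply: pw_ind.
- by move=> *; exact: pw_refl.
- by move=> a b ab H gh; apply: pw_segment => //; exact: on_segment_eq gh H.
- move=> a m b am mb H1 H2 gh; apply: (@pw_cat _ _ m).
    by apply: H1 => t /andP[t1 t2]; apply: gh; rewrite t1 (le_trans t2).
  by apply: H2 => t /andP[t1 t2]; apply: gh; rewrite t2 (le_trans am).
Qed.

Lemma pw_shift g a b k : piecewise_C1 g a b -> piecewise_C1 (fun t => g (t - k)) (a + k) (b + k).
Proof.
move: a b; apply: pw_ind.
- by move=> *; exact: pw_refl.
- move=> a b ab [h [e [e0 hg hC]]]; apply: pw_segment; first by rewrite ltrD2r.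
  exists (fun t => h (t - k)), e; split=> //.
    by move=> t tab; apply: hg; lra.
  move=> t tab; have -> : (fun t => h (t - k)) = (fun t => h (1 * t + (- k))).
    by apply/funext => s; rewrite mul1r.
  by apply: C1_at_affine; apply: hC; lra.
- by move=> a m b _ _; exact: pw_cat.
Qed.

Lemma pw_reverse g a b : piecewise_C1 g a b -> piecewise_C1 (fun t => g (- t)) (- b) (- a).
Proof.
move: a b; apply: pw_ind.
- by move=> *; exact: pw_refl.
- move=> a b ab [h [e [e0 hg hC]]]; apply: pw_segment; first by rewrite ltrN2.
  exists (fun t => h (- t)), e; split=> //.
    by move=> t tab; apply: hg; lra.
  move=> t tab; have -> : (fun t => h (- t)) = (fun t => h ((-1) * t + 0)).
    by apply/funext => s; rewrite mulN1r addr0.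
  by apply: C1_at_affine; apply: hC; lra.
- by move=> a m b _ _ H1 H2; exact: pw_cat H2 H1.
Qed.

(** The curve is frozen outside [a, b], which makes it continuous on the whole
    line; s lists the corners, where S need not be differentiable. *)
Definition arclength g a b (S : R -> R) (s : seq R) :=
  [/\ S a = 0, forall t, {for t, continuous S},
      forall t, {for t, continuous (fun x => g (clamp a b x))} &
      forall t, a < t < b -> t \notin s -> C1_at g t /\ is_derive t 1 S (speed g t)].

Lemma near_clamp a b t : a < t < b -> \forall s \near t, clamp a b s = s.
Proof.
by move=> /near_itv; apply: filterS => s /andP[s1 s2]; rewrite clamp_id// !ltW.
Qed.

Lemma clamp_comp_continuous (T : topologicalType) (h : R -> T) a b : a <= b ->
  (forall t, a <= t <= b -> {for t, continuous h}) ->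
  forall t, {for t, continuous (fun x => h (clamp a b x))}.
Proof.
move=> ab ch t; apply: (@continuous_comp _ _ _ (clamp a b)).
  exact: clamp_continuous.
by apply: ch; exact: clamp_in.
Qed.

(** On a segment the extended speed is continuous, hence has a primitive. *)
Lemma arclength_segment g a b : a < b -> on_segment (@C1_at R n M) g a b ->
  measurable_fun `[a, b] (speed g) /\
  exists S, arclength g a b S [::] /\ curve_length g a b = (S b)%:E.
Proof.
move=> ab [h [e [e0 hg hC]]].
have hC' t : a <= t <= b -> C1_at h t by move=> tab; apply: hC; lra.
pose sp t := speed h (clamp a b t).
have csp : continuous sp.
  by apply: clamp_comp_continuous; [exact: ltW|move=> t /hC'; exact: speed_continuous].
have [F dF] := primitive_exists (a - 1) (b + 1) csp.
have gh t : a < t < b -> \forall s \near t, h s = g s.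
  by move=> /near_itv; apply: filterS => s /andP[s1 s2]; apply: hg; rewrite !ltW.
have spE t : a < t < b -> sp t = speed g t.
  move=> tab; rewrite /sp clamp_id; last by lra.
  exact/near_eq_speed/gh.
have mo : measurable_fun `]a, b[ (speed g).
  apply: (@eq_measurable_fun _ _ _ _ _ sp).
    by move=> t; rewrite inE/= in_itv/=; exact: spE.
  by apply: measurable_funTS; exact: continuous_measurable_fun.
split; first exact: measurable_fun_itv_cc mo.
exists (fun t => F (clamp a b t) - F a); split.
  split.
  - by rewrite clamp_id ?lexx ?ltW// subrr.
  - move=> t; apply: (@continuousB _ _ _ _ (fun t => F a)); last exact: continuous_cst.
    apply: clamp_comp_continuous => [|s sab]; first exact: ltW.
    by apply: is_derive_continuous (dF s _); lra.
  - have -> : (fun x => g (clamp a b x)) = (fun x => h (clamp a b x)).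
      by apply/funext => x; rewrite hg// clamp_in// ltW.
    by apply: clamp_comp_continuous => [|s /hC'[]//]; exact: ltW.
  - move=> t tab _; split.
      by apply: near_eq_C1 (gh t tab) (hC' t _); lra.
    rewrite -spE//.
    have dFt : is_derive t 1 F (sp t) by apply: dF; lra.
    apply: near_eq_is_derive (is_derive_addc (- F a) dFt).
    by apply: filterS (near_clamp tab) => s ->.
rewrite clamp_id ?lexx ?ltW// /curve_length.
transitivity (\int[lebesgue_measure]_(t in `[a, b]) (sp t)%:E)%E.
  apply: (@eq_integral_itv_bounded R a b sp (speed g) true false mo).
    by apply: measurable_funTS; exact: continuous_measurable_fun.
  by move=> t; rewrite in_itv/= => tab; rewrite (spE _ tab).
apply: integral_continuous_derive => // t tab; apply: dF; lra.
Qed.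

Lemma piecewise_arclength_measurable g a b : piecewise_C1 g a b ->
  measurable_fun `[a, b] (speed g) /\
  exists S s, arclength g a b S s /\ curve_length g a b = (S b)%:E.
Proof.
move: a b; apply: pw_ind.
- move=> a; rewrite set_itv1; split; first exact: measurable_fun_set1.
  exists (fun=> 0), [::]; split.
    split=> //; try by move=> t; exact: continuous_cst.
      move=> t; have -> : (fun x => g (clamp a a x)) = (fun=> g a).
        apply/funext => x; congr g; apply/le_anti.
        by have /andP[-> ->] := clamp_in x (lexx a).
      exact: continuous_cst.
    by move=> t /andP[t1 /(lt_trans t1)]; rewrite ltxx.
  by rewrite /curve_length set_itv1 integral_set1.
- move=> a b ab gab; have [H1 [S H2]] := arclength_segment ab gab.
  by split=> //; exists S, [::].
- move=> a m b am mb [m1 [S1 [s1 [[S10 S1c g1c S1d] l1]]]] [m2 [S2 [s2 [[S20 S2c g2c S2d] l2]]]].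
  have E : `[a, b]%classic = `[a, m] `|` `]m, b].
    apply/seteqP; split=> t /=; rewrite !in_itv/=.
      by move=> /andP[-> tb]; case: (leP t m) => [|_]; [left|right; rewrite tb].
    by move=> [/andP[-> tm]|/andP[mt ->]]; [rewrite (le_trans tm)|rewrite (le_trans am) ?ltW].
  have m2' : measurable_fun `]m, b] (speed g).
    by apply: measurable_funS m2 => // t /=; rewrite !in_itv/= => /andP[/ltW -> ->].
  have mab : measurable_fun (`[a, m] `|` `]m, b]) (speed g).
    exact/measurable_funU.
  split; first by rewrite E.
  exists (fun t => S1 (Num.min t m) + S2 (Num.max t m)), (m :: s1 ++ s2); split; last first.
    rewrite /curve_length E ge0_integral_setU//=; last 3 first.
    - exact/measurable_EFinP.
    - by move=> x _; rewrite lee_fin speed_ge0.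
    - apply/disj_set2P/seteqP; split=> // t /= []; rewrite !in_itv/= => /andP[_ tm] /andP[mt _].
      by move: (lt_le_trans mt tm); rewrite ltxx.
    rewrite integral_itv_obnd_cbnd; last exact/measurable_EFinP.
    by rewrite -!/(curve_length g _ _) l1 l2 (min_idPr mb) (max_idPl mb) EFinD.
  split.
  - by rewrite (min_idPl am) (max_idPr am) S10 S20 addr0.
  - move=> t; apply: continuous_addr.
      apply: (@continuous_comp _ _ _ (fun t => Num.min t m)); last exact: S1c.
      by apply: continuous_min; [exact: cvg_id|exact: cvg_cst].
    apply: (@continuous_comp _ _ _ (fun t => Num.max t m)); last exact: S2c.
    by apply: continuous_max; [exact: cvg_id|exact: cvg_cst].
  - move=> t.
    have e1 s : s <= m -> clamp a b s = clamp a m s.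
      by move=> sm; rewrite /clamp (min_idPr sm) (min_idPr (le_trans sm mb)).
    have e2 s : m <= s -> clamp a b s = clamp m b s.
      move=> ms; rewrite /clamp; have : m <= Num.min b s by rewrite le_min mb.
      by move=> H; rewrite (max_idPr H) (max_idPr (le_trans am H)).
    have [tm|mt|->] := ltgtP t m.
    + apply: near_eq_continuous (g1c t).
      near=> s; rewrite e1//; apply: ltW; near: s; exact: lt_nbhsl.
    + apply: near_eq_continuous (g2c t).
      near=> s; rewrite e2//; apply: ltW; near: s; exact: lt_nbhsr.
    + move=> A; rewrite /= => Agm.
      have A1 : nbhs (g (clamp a m m)) A by rewrite -e1.
      have A2 : nbhs (g (clamp m b m)) A by rewrite -e2.
      have B1 := near_comp (g1c m) A1; have B2 := near_comp (g2c m) A2.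
      change (\forall s \near m, A (g (clamp a b s))).
      apply: filterS2 B1 B2 => s /= B1 B2.
      by have [sm|/ltW ms] := leP s m; [rewrite e1|rewrite e2].
  - move=> t /andP[at_ tb]; rewrite inE mem_cat !negb_or => /and3P[tm ts1 ts2].
    have [tm'|mt|tm'] := ltgtP t m; last by rewrite tm' eqxx in tm.
    + have [||h1 h2] := S1d t => //; first by rewrite at_.
      split; first exact: h1.
      apply: near_eq_is_derive (is_derive_addc (S2 m) h2).
      near=> s; have sm : s <= m by apply: ltW; near: s; exact: lt_nbhsl.
      by rewrite (min_idPl sm) (max_idPr sm).
    + have [||h1 h2] := S2d t => //; first by rewrite mt.
      split; first exact: h1.
      apply: near_eq_is_derive (is_derive_addc (S1 m) h2).
      near=> s; have sm : m <= s by apply: ltW; near: s; exact: lt_nbhsr.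
      by rewrite (min_idPr sm) (max_idPl sm) addrC.
Unshelve. all: by end_near. Qed.

Lemma piecewise_arclength g a b : piecewise_C1 g a b ->
  exists S s, arclength g a b S s /\ curve_length g a b = (S b)%:E.
Proof. by move=> /piecewise_arclength_measurable[]. Qed.

(** Two arc length parameters have the same derivative off a finite set. *)
Lemma curve_lengthE g a b (S : R -> R) (s : seq R) : piecewise_C1 g a b ->
  (forall t, a <= t <= b -> {for t, continuous S}) ->
  (forall t, a < t < b -> t \notin s -> is_derive t 1 S (speed g t)) ->
  curve_length g a b = (S b - S a)%:E.
Proof.
move=> gab cS dS; have [S' [s' [[S'0 S'c _ S'd] ->]]] := piecewise_arclength gab.
congr EFin.
have : (S' - S) a = (S' - S) b.
  apply: (@constant_off_finite R (s ++ s') (S' - S) a b (pw_le gab)) => t tab.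
    by apply: continuousB; [exact: S'c|exact: cS].
  rewrite mem_cat negb_or => /andP[ts ts'].
  rewrite -(subrr (speed g t)); apply: is_deriveB; last exact: dS.
  by have [] := S'd t tab ts'.
change (S' a - S a = S' b - S b -> S' b = S b - S a).
by rewrite S'0 => H'; lra.
Qed.

Lemma arclength_mono g a b S s x y : arclength g a b S s -> a <= x -> x <= y -> y <= b ->
  S x <= S y.
Proof.
move=> [_ Sc _ Sd] ax xy yb; apply: (@nondecreasing_off_finite R s) => // t /andP[xt ty] ts.
have [||_ d] := Sd t => //; first by rewrite (le_lt_trans ax)//= (lt_le_trans ty).
by exists (speed g t) => //; exact: speed_ge0.
Qed.

Lemma curve_length_sub g a b S s x y : piecewise_C1 g a b -> arclength g a b S s ->
  a <= x -> x <= y -> y <= b -> curve_length g x y = (S y - S x)%:E.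
Proof.
move=> gab [_ Sc _ Sd] ax xy yb.
apply: (@curve_lengthE _ _ _ _ s) => //; first exact: pw_sub gab ax xy yb.
move=> t /andP[xt ty] ts; have [||_ d] := Sd t => //.
by rewrite (le_lt_trans ax)//= (lt_le_trans ty).
Qed.

Lemma curve_length_ge0 g a b : (0 <= curve_length g a b)%E.
Proof. by apply: integral_ge0 => t _; rewrite lee_fin speed_ge0. Qed.

Lemma curve_length_eq g h a b : (forall t, a <= t <= b -> g t = h t) ->
  piecewise_C1 g a b -> curve_length h a b = curve_length g a b.
Proof.
move=> gh gab; have [S [s [[S0 Sc _ Sd] ->]]] := piecewise_arclength gab.
rewrite -[S b]subr0 -S0.
apply: (@curve_lengthE h a b S s) => [|t _|t tab ts]; [exact: pw_eq gh gab|exact: Sc|].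
have [_ d] := Sd t tab ts.
have -> // : speed h t = speed g t.
apply: near_eq_speed.
by apply: filterS (near_itv tab) => x /andP[x1 x2]; rewrite gh// !ltW.
Qed.

Lemma curve_length_shift g a b k : piecewise_C1 g a b ->
  curve_length (fun t => g (t - k)) (a + k) (b + k) = curve_length g a b.
Proof.
move=> gab; have [S [s [[S0 Sc _ Sd] ->]]] := piecewise_arclength gab.
have aE (T : Type) (f : R -> T) : (fun t => f (t - k)) = (fun t => f (1 * t + (- k))).
  by apply/funext => t; rewrite mul1r.
rewrite -[S b]subr0 -S0 -{2}(addrK k a) -{2}(addrK k b).
apply: (@curve_lengthE _ _ _ (fun t => S (t - k)) [seq x + k | x <- s]).
- exact: pw_shift.
- move=> t _; rewrite aE; apply: (continuous_comp (@affine_continuous R 1 (- k) t)).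
  exact: Sc.
- move=> t tab ts; rewrite !aE.
  have tab' : a < 1 * t - k < b by rewrite mul1r; lra.
  have [|C d] := Sd _ tab'.
    apply: contra ts => ts; apply/mapP; exists (1 * t - k) => //.
    by rewrite mul1r subrK.
  rewrite (speed_affine C) normr1; exact: is_derive_affine.
Qed.

Lemma curve_length_reverse g a b : piecewise_C1 g a b ->
  curve_length (fun t => g (- t)) (- b) (- a) = curve_length g a b.
Proof.
move=> gab; have [S [s [[S0 Sc _ Sd] ->]]] := piecewise_arclength gab.
have aE (T : Type) (f : R -> T) : (fun t => f (- t)) = (fun t => f ((-1) * t + 0)).
  by apply/funext => t; rewrite mulN1r addr0.
have -> : S b = - S (- - a) - - S (- - b) by rewrite !opprK S0 oppr0 add0r.
apply: (@curve_lengthE _ _ _ (fun t => - S (- t)) [seq - x | x <- s]).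
- exact: pw_reverse.
- move=> t _; apply: continuousN; rewrite aE.
  by apply: (continuous_comp (@affine_continuous R (-1) 0 t)); exact: Sc.
- move=> t tab ts; rewrite (aE _ (fun y => - S y)) (aE _ g).
  have tab' : a < (-1) * t + 0 < b by rewrite mulN1r; lra.
  have [|C d] := Sd _ tab'.
    apply: contra ts => ts; apply/mapP; exists ((-1) * t + 0) => //.
    by rewrite mulN1r addr0 opprK.
  rewrite (speed_affine C) normrN1 mul1r.
  have dN : is_derive ((-1) * t + 0) 1 (fun y => - S y) (- speed g ((-1) * t + 0)).
    exact: is_deriveN.
  by have := is_derive_affine dN; rewrite scaleN1r opprK.
Qed.

End PiecewiseCurves.

(** * Bounds for the metric in a chart *)

Section LocalBounds.
Context {R : realType} {n : nat}.

Definition bounded_with (f : 'rV[R]_n -> R) (B : R) y :=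
  `|f y| <= B /\ forall a, derivable f y (delta_mx 0 a) /\ `|partial a f y| <= B.

Definition family_bounded (I : Type) (f : I -> 'rV[R]_n -> R) x (r B : R) :=
  forall y, ball x r y -> forall i, bounded_with (f i) B y.

Lemma Ck1_family_bound (I : finType) (U : set 'rV[R]_n) (f : I -> 'rV[R]_n -> R) x :
  open U -> (forall i, Ck_on 1 U (f i)) -> U x ->
  exists2 B : R, 0 < B & \forall r \near 0^'+, family_bounded f x r B.
Proof.
move=> oU Hf Ux.
have H i : exists2 B : R, 0 < B & \forall r \near 0^'+, forall y, ball x r y ->
    `|f i y| <= B /\ forall a, derivable (f i) y (delta_mx 0 a) /\ `|partial a (f i) y| <= B.
  have [B B0 HB] := Ck1_bound oU (Hf i) Ux.
  have := continuous_near_dist (Ck1_continuous oU (Hf i) Ux) ltr01.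
  move=> /nbhs_ballP[r0 /= r00 H0].
  exists (B + (`|f i x| + 1)); first by rewrite addr_gt0// ltr_wpDl.
  near=> r => y yr; split=> [|a].
    rewrite -(subrK (f i x) (f i y)) (le_trans (ler_normD _ _))// addrC.
    rewrite (@le_trans _ _ (`|f i x| + 1))//; last by rewrite lerDr ltW.
    rewrite lerD// distrC ltW// H0//; apply: le_ball yr.
    by near: r; apply: nbhs_right_le.
  have [d1 d2] : derivable (f i) y (delta_mx 0 a) /\ `|partial a (f i) y| <= B.
    by move: a; move: y yr; near: r.
  by split=> //; rewrite (le_trans d2)// lerDl addr_ge0.
pose B i := projT1 (cid2 (H i)).
have B0 i : 0 < B i by rewrite /B; case: cid2.
exists (1 + \sum_i B i); first by rewrite ltr_wpDr// sumr_ge0// => i _; rewrite ltW.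
pose P i (r : R) := forall y, ball x r y ->
    `|f i y| <= B i /\ forall a, derivable (f i) y (delta_mx 0 a) /\ `|partial a (f i) y| <= B i.
have HB : forall i, \forall r \near 0^'+, P i r.
  by move=> i; rewrite /P /B; case: cid2.
have HA : \forall r \near 0^'+, forall i, P i r by apply: filter_forall.
apply: filterS HA => r Hr y yr i.
have Bi : B i <= 1 + \sum_i B i.
  by rewrite (bigD1 i)//= addrCA lerDl addr_ge0// sumr_ge0// => j _; rewrite ltW.
have [h1 h2] := Hr i y yr; split; first exact: le_trans Bi.
by move=> a; have [d1 d2] := h2 a; split=> //; exact: le_trans Bi.
Unshelve. all: by end_near. Qed.

End LocalBounds.

Section MetricAlgebra.
Context {R : realType} {n : nat} {M : riemannianManifold R n}.
Implicit Types (c : chart R n M) (x u v w : 'rV[R]_n).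

Lemma innerDl c x u v w : inner c x (u + v) w = inner c x u w + inner c x v w.
Proof. by rewrite /inner !mulmxDl mxE. Qed.

Lemma innerDr c x u v w : inner c x u (v + w) = inner c x u v + inner c x u w.
Proof. by rewrite /inner linearD/= !mulmxDr mxE. Qed.

Lemma innerZl c x k u v : inner c x (k *: u) v = k * inner c x u v.
Proof. by rewrite /inner -!scalemxAl mxE. Qed.

Lemma innerZr c x k u v : inner c x u (k *: v) = k * inner c x u v.
Proof. by rewrite /inner linearZ/= -!scalemxAr mxE. Qed.

Lemma innerC c x u v : atlas c -> im c x -> inner c x u v = inner c x v u.
Proof.
move=> ac cx; rewrite /inner -[in LHS](trmxK (u *m _ *m _)) [in LHS]mxE.
by rewrite !trmx_mul trmxK (metric_sym ac cx) mulmxA.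
Qed.

Lemma inner0l c x v : inner c x 0 v = 0.
Proof. by rewrite /inner !mul0mx mxE. Qed.

Lemma inner0r c x u : inner c x u 0 = 0.
Proof. by rewrite /inner trmx0 mulmx0 mxE. Qed.

Lemma inner_ge0 c x v : atlas c -> im c x -> 0 <= inner c x v v.
Proof.
move=> ac cx; have [->|v0] := eqVneq v 0; first by rewrite inner0l.
exact/ltW/metric_pos.
Qed.

Lemma inner_cauchy_schwarz c x u v : atlas c -> im c x ->
  inner c x u v ^+ 2 <= inner c x u u * inner c x v v.
Proof.
move=> ac cx; have [->|v0] := eqVneq v 0.
  by rewrite !inner0r mulr0 expr0n.
have vv : 0 < inner c x v v by exact: metric_pos.
have := inner_ge0 (u + (- (inner c x u v / inner c x v v)) *: v) ac cx.
rewrite innerDl !innerDr !innerZl !innerZr (innerC v u)//.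
set p := inner c x u v; set q := inner c x v v in vv *; set r := inner c x u u.
have -> : r + - (p / q) * p + (- (p / q) * p + - (p / q) * (- (p / q) * q)) = (r * q - p ^+ 2) / q.
  by field; rewrite gt_eqF.
by rewrite pmulr_lge0 ?invr_gt0// subr_ge0.
Qed.

Lemma metric_unit c x : atlas c -> im c x -> metric c x \in unitmx.
Proof.
move=> ac cx; rewrite unitmxE unitfE; apply/negP => /det0P[v v0 vG].
have := metric_pos ac cx v0; by rewrite vG mul0mx mxE ltxx.
Qed.

(** The Cauchy-Schwarz inequality for v and the vector whose inner products are
    the i-th coordinates. *)
Lemma coordinate_le_inner c x v i : atlas c -> im c x ->
  v 0 i ^+ 2 <= inner c x v v * invmx (metric c x) i i.
Proof.
move=> ac cx; have uG := metric_unit ac cx.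
pose w := delta_mx 0 i *m invmx (metric c x) : 'rV[R]_n.
have vw y : inner c x w y = y 0 i.
  by rewrite /inner /w mulmxKV// -rowE !mxE.
have := inner_cauchy_schwarz v w ac cx.
rewrite (innerC v w)// !vw.
by rewrite [w 0 i]mxE (bigD1 i)//= big1 ?addr0 ?mxE ?eqxx ?mul1r// => j ji; rewrite mxE (negbTE ji) andbF mul0r.
Qed.

Lemma inner_upper c x (B : R) u v : (forall i j, `|metric c x i j| <= B) ->
  `|inner c x u v| <= n%:R ^+ 2 * B * `|u| * `|v|.
Proof.
move=> GB; rewrite innerE (le_trans (ler_norm_sum _ _ _))//.
have -> : n%:R ^+ 2 * B * `|u| * `|v| = \sum_(j < n) (n%:R * (B * `|u|) * `|v|).
  by rewrite sumr_const card_ord -[RHS]mulr_natl; ring.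
apply: ler_sum => j _; rewrite normrM; apply: ler_pM => //; last exact: mx_entry_norm.
rewrite (le_trans (ler_norm_sum _ _ _))//.
have -> : n%:R * (B * `|u|) = \sum_(j < n) (B * `|u|).
  by rewrite sumr_const card_ord -[RHS]mulr_natl.
by apply: ler_sum => i _; rewrite normrM mulrC; apply: ler_pM => //; exact: mx_entry_norm.
Qed.

Lemma metric_partial_Ck c k i j a : atlas c ->
  Ck_on k (im c) (partial a (fun x => metric c x i j)).
Proof. by move=> ac; exact: (metric_entry_Ck k.+1 i j ac a).2. Qed.

Lemma christoffel_Ck c m k a b : atlas c ->
  Ck_on m (im c) (fun x => christoffel c x k a b).
Proof.
move=> ac; have oI : open (im c) := @im_open _ _ _ c.
apply: (Ck_mul oI); first exact: Ck_cst.
apply: (Ck_sum _ oI) => l; apply: (Ck_mul oI).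
  by apply: (Ck_invmx oI) => [x|i j]; [exact: metric_unit|exact: metric_entry_Ck].
have -> : (fun x : 'rV_n => partial a (fun y => metric c y b l) x + partial b (fun y => metric c y a l) x -
   partial l (fun y => metric c y a b) x) =
  (fun x : 'rV_n => (partial a (fun y => metric c y b l) x + partial b (fun y => metric c y a l) x) +
     -1 * partial l (fun y => metric c y a b) x).
  by apply/funext => x; rewrite mulN1r.
apply: (Ck_add oI); last apply: (Ck_mul oI); last 2 first.
- exact: Ck_cst.
- exact: metric_partial_Ck.
by apply: (Ck_add oI); exact: metric_partial_Ck.
Qed.

(** All that the local arguments use of the metric near a point, with a single
    constant B: the coordinate norm is dominated by the metric, and the coefficients of
    the metric, their derivatives and the Christoffel symbols are bounded together with
    their own derivatives. *)
Definition chart_bounds c x0 (r B : R) := forall y, ball x0 r y ->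
  [/\ im c y,
      forall v, `|v| ^+ 2 <= B * inner c y v v,
      forall i j, bounded_with (fun x => metric c x i j) B y,
      forall i j a, bounded_with (partial a (fun x => metric c x i j)) B y &
      forall k a b, bounded_with (fun x => christoffel c x k a b) B y].

Lemma chart_bounds_exist c x0 : atlas c -> im c x0 ->
  exists2 B : R, 0 < B & \forall r \near 0^'+, chart_bounds c x0 r B.
Proof.
move=> ac cx0; have oI : open (im c) := @im_open _ _ _ c.
pose I := 'I_n.
have [B1 B10 H1] := @Ck1_family_bound R n (I * I)%type _ (fun ij x => metric c x ij.1 ij.2) _
  oI (fun ij => metric_entry_Ck 1 ij.1 ij.2 ac) cx0.
have [B2 B20 H2] := @Ck1_family_bound R n (I * I * I)%type _
  (fun ij => partial ij.2 (fun x => metric c x ij.1.1 ij.1.2)) _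
  oI (fun ij => metric_partial_Ck 1 ij.1.1 ij.1.2 ij.2 ac) cx0.
have [B3 B30 H3] := @Ck1_family_bound R n (I * I * I)%type _
  (fun ij x => christoffel c x ij.1.1 ij.1.2 ij.2) _
  oI (fun ij => christoffel_Ck 1 ij.1.1 ij.1.2 ij.2 ac) cx0.
have Cinv (ij : I * I) : Ck_on 1 (im c) (fun x => invmx (metric c x) ij.1 ij.2).
  by apply: (Ck_invmx oI) => [x|i j]; [exact: metric_unit|exact: metric_entry_Ck].
have [B4 B40 H4] := @Ck1_family_bound R n (I * I)%type _ _ _ oI Cinv cx0.
have sub (f : 'rV[R]_n -> R) (A B : R) y : A <= B ->
    (`|f y| <= A /\ forall a, derivable f y (delta_mx 0 a) /\ `|partial a f y| <= A) -> bounded_with f B y.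
  move=> AB [h1 h2]; split; first exact: le_trans AB.
  by move=> a; have [d1 d2] := h2 a; split=> //; exact: le_trans AB.
exists (B1 + B2 + B3 + B4); first by rewrite !addr_gt0.
move: (chart_im_near cx0) => /nbhs_ballP[r0 /= r00 Hr0].
near=> r.
have rr0 : r <= r0 by near: r; exact: nbhs_right_le.
have h1 : family_bounded (fun (ij : I * I) x => metric c x ij.1 ij.2) x0 r B1 by near: r.
have h2 : family_bounded (fun ij : I * I * I => partial ij.2 (fun x => metric c x ij.1.1 ij.1.2)) x0 r B2.
  by near: r.
have h3 : family_bounded (fun (ij : I * I * I) x => christoffel c x ij.1.1 ij.1.2 ij.2) x0 r B3.
  by near: r.
have h4' : family_bounded (fun (ij : I * I) x => invmx (metric c x) ij.1 ij.2) x0 r B4 by near: r.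
move=> y yr.
have cy : im c y by apply: Hr0; exact: le_ball yr.
split=> //.
- have h4 (ij : I * I) : `|invmx (metric c y) ij.1 ij.2| <= B4 by have [] := h4' y yr ij.
  move=> v; have iv := inner_ge0 v ac cy.
  have Biv : 0 <= (B1 + B2 + B3 + B4) * inner c y v v by rewrite mulr_ge0// !addr_ge0// ltW.
  rewrite -[leRHS]sqr_sqrtr// ler_pXn2r ?nnegrE ?sqrtr_ge0//.
  apply: rV_norm_le => [|i]; first exact: sqrtr_ge0.
  rewrite -sqrtr_sqr ler_sqrt// (le_trans (coordinate_le_inner v i ac cy))// mulrC.
  rewrite ler_wpM2r// (le_trans (ler_norm _))// (le_trans (h4 (i, i)))// lerDr !addr_ge0// ltW//.
- move=> i j; apply: (@sub _ B1); first by rewrite -!addrA lerDl !addr_ge0// ltW.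
  exact: h1 y yr (i, j).
- move=> i j a; apply: (@sub _ B2).
    by rewrite -!addrA addrCA lerDl !addr_ge0// ltW.
  exact: h2 y yr (i, j, a).
- move=> k a b; apply: (@sub _ B3).
    by rewrite -addrA addrCA lerDl !addr_ge0// ltW.
  exact: h3 y yr (k, a, b).
Unshelve. all: by end_near. Qed.

End MetricAlgebra.

(** * Length and coordinates *)

Section LengthEstimates.
Context {R : realType} {n : nat} {M : riemannianManifold R n}.
Implicit Types (c : chart R n M) (g : R -> M) (a b t : R).

Lemma arclength_ge0 g a b S s t : arclength g a b S s -> a <= t <= b -> 0 <= S t.
Proof.
move=> gS /andP[aT tb]; have [S0 _ _ _] := gS.
by rewrite -S0; exact: arclength_mono gS _ aT tb.
Qed.

Lemma clamped_chart_continuous c g a b S s t : arclength g a b S s ->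
  dom c (g (clamp a b t)) -> {for t, continuous (fun x => c (g (clamp a b x)))}.
Proof.
move=> [_ _ gc _] ct; apply: (@continuous_comp _ _ _ (fun x => g (clamp a b x))).
  exact: gc.
exact: chart_continuous.
Qed.

Lemma clamped_is_derive c g a b S s t : arclength g a b S s -> atlas c ->
  a < t < b -> t \notin s -> dom c (g t) ->
  exists v, [/\ is_derive t 1 (fun x => c (g (clamp a b x))) v, is_derive t 1 S (speed g t) &
    speed g t = Num.sqrt (inner c (c (g t)) v v)].
Proof.
move=> [_ _ _ dS] ac tab ts ct; have [[cg dg] dSt] := dS t tab ts.
have [/nbhs_singleton/derivableP d1 _] := dg c ac ct.
exists ('D_1 (c \o g) t); split; [|exact: dSt|exact: (speedE ac cg ct d1)].
by apply: near_eq_is_derive d1; apply: filterS (near_clamp tab) => x ->.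
Qed.

(** The coordinate velocity is at most sqrt B times the speed; comparing each
    coordinate, with either sign, with S gives the bound for the sup norm. *)
Lemma coordinate_displacement c g a b S s x0 r B t : atlas c -> arclength g a b S s ->
  0 < B -> chart_bounds c x0 r B -> a <= t <= b ->
  (forall u, a <= u <= t -> dom c (g u) /\ ball x0 r (c (g u))) ->
  `|c (g t) - c (g a)| <= Num.sqrt B * S t.
Proof.
move=> ac gS B0 bnd /andP[aT tb] gr.
have ab : a <= b := le_trans aT tb.
have [S0 Sc gc dS] := gS.
apply: rV_norm_le => [|k].
  by rewrite mulr_ge0 ?sqrtr_ge0// (arclength_ge0 gS)// aT.
(* e is a sign. *)
have key (e : R) : e ^+ 2 = 1 -> e * (c (g t) - c (g a)) 0 k <= Num.sqrt B * S t.
  move=> e1.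
  pose F u := Num.sqrt B * S u + - e * (c (g (clamp a b u))) 0 k.
  have ca u : a <= u <= t -> clamp a b u = u.
    by move=> /andP[u1 u2]; rewrite clamp_id// u1 (le_trans u2).
  have FF : F a <= F t.
    apply: (@nondecreasing_off_finite R s) => // u.
      move=> uat; apply: continuous_addr; apply: continuous_mulr; try exact: continuous_cst.
        exact: Sc.
      have cu : dom c (g (clamp a b u)) by rewrite ca//; have [] := gr u uat.
      by have /continuous_rVP := clamped_chart_continuous gS cu; apply.
    move=> /andP[au ut] us.
    have uab : a < u < b by rewrite au (lt_le_trans ut).
    have [cu bu] : dom c (g u) /\ ball x0 r (c (g u)) by apply: gr; rewrite !ltW.
    have [v [dv dSu spu]] := clamped_is_derive gS ac uab us cu.
    exists (Num.sqrt B * speed g u + - e * v 0 k).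
      apply: is_deriveD; apply: is_deriveZ => //.
      by move/is_derive_rVP : dv; apply.
    have [cy Bv _ _ _] := bnd _ bu.
    have vB : `|v| <= Num.sqrt B * speed g u.
      rewrite spu -sqrtrM ?(ltW B0)//.
      have <- : Num.sqrt (`|v| ^+ 2) = `|v| by rewrite sqrtr_sqr normr_id.
      by rewrite ler_sqrt// mulr_ge0 ?inner_ge0 ?(ltW B0).
    rewrite mulNr subr_ge0 (le_trans _ vB)// (le_trans (ler_norm _))// normrM.
    have -> : `|e| = 1 by apply/eqP; rewrite -sqrp_eq1// -normrX e1 normr1.
    by rewrite mul1r; exact: mx_entry_norm.
  have -> : (c (g t) - c (g a)) 0 k = c (g t) 0 k - c (g a) 0 k by rewrite !mxE.
  move: FF; rewrite /F S0 !ca ?lexx ?aT//; lra.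
rewrite ler_norml; apply/andP; split; last by rewrite -[leLHS]mul1r key ?expr1n.
by rewrite lerNl -mulN1r key// sqrrN expr1n.
Qed.

Lemma chart_closed_ball_compact c (x : 'rV[R]_n) (e : R) :
  (forall y, `|x - y| <= e -> im c y) ->
  compact (inv c @` [set y | `|x - y| <= e]).
Proof.
move=> H; apply: continuous_compact.
  apply: continuous_in_subspaceT => y; rewrite inE/= => /H.
  exact: chart_inv_continuous.
apply: bounded_closed_compact.
  exists (`|x| + `|e| + 1); split; first by rewrite num_real.
  move=> N HN y /= xy; rewrite ltW// (le_lt_trans _ HN)//.
  have : `|y| <= `|x| + `|x - y| by rewrite -{1}(subKr x y) ler_normB.
  by have := ler_norm e; move: xy; lra.
exact: (@closed_closed_ball_ _ _ x e).
Qed.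

(** By induction along the curve, whose length is too small to reach the boundary
    of the coordinate ball. In the limit step the closed ball is compact, hence closed in
    the Hausdorff space M, so that the curve does not leave the domain of the chart from
    within the ball. *)
Lemma short_curve_in_ball c g a b S s x0 r B : atlas c -> piecewise_C1 g a b ->
  arclength g a b S s ->
  0 < B -> chart_bounds c x0 r B -> dom c (g a) ->
  `|x0 - c (g a)| + Num.sqrt B * S b < r ->
  forall t, a <= t <= b -> dom c (g t) /\ `|c (g t) - c (g a)| <= Num.sqrt B * S t.
Proof.
move=> ac gab gS B0 bnd ca small.
have ab := pw_le gab; have [S0 Sc gc dS] := gS.
set K := Num.sqrt B; have K0 : 0 <= K by exact: sqrtr_ge0.
have Sb0 : 0 <= S b by apply: (arclength_ge0 gS); rewrite ab lexx.
have inball y : `|y - c (g a)| <= K * S b -> ball x0 r y.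
  move=> H; apply/ballE_norm; apply: le_lt_trans small.
  by rewrite (le_trans (ler_distD (c (g a)) _ _))// lerD2l distrC.
have main : forall t, a <= t <= b -> dom c (g t) /\ `|c (g t) - c (g a)| <= K * S b.
  apply: segment_induction => //.
  - by split=> //; rewrite subrr normr0 mulr_ge0.
  - move=> t /andP[aT tb] H.
    have [ct bt] : dom c (g t) /\ `|c (g t) - c (g a)| <= K * S b by apply: H; rewrite aT lexx.
    have clt : clamp a b t = t by rewrite clamp_id// aT ltW.
    have n1 : \forall u \near t, dom c (g (clamp a b u)).
      by apply: (near_comp (gc t)); rewrite clt; exact: chart_near.
    have n2 : \forall u \near t, ball x0 r (c (g (clamp a b u))).
      have cc : {for t, continuous (fun x => c (g (clamp a b x)))}.
        by apply: (clamped_chart_continuous gS); rewrite clt.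
      apply: (near_comp cc); rewrite clt.
      apply: open_nbhs_nbhs; split; first exact: ball_open.
      exact: inball.
    have : \forall u \near t, dom c (g (clamp a b u)) /\ ball x0 r (c (g (clamp a b u))).
      by apply: filterS2 n1 n2.
    move=> /nbhs_ballP[e /= e0 He].
    exists e => // u /andP[tu ute] ub; split.
      have [] := He u; first by rewrite /ball/= ltr0_norm ?subr_lt0// opprB ltrBlDl.
      by rewrite clamp_id// ub andbT (le_trans aT)// ltW.
    have au : a <= u by rewrite (le_trans aT)// ltW.
    apply: le_trans (coordinate_displacement ac gS B0 bnd (t := u) _ _) _.
    + by rewrite au.
    + move=> w /andP[aw wu].
      have [wt|tw] := leP w t.
        have [cw bw] := H w (introT andP (conj aw wt)); split=> //; exact: inball.
      have [] := He w.
        rewrite /ball/= ltr0_norm ?subr_lt0// opprB ltrBlDl.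
        exact: le_lt_trans wu ute.
      by rewrite clamp_id// aw (le_trans wu).
    + by rewrite ler_wpM2l// (arclength_mono gS).
  - move=> t /andP[aT tb] H.
    pose e := K * S b.
    have imc y : `|c (g a) - y| <= e -> im c y.
      by rewrite distrC => /inball/bnd[].
    have cmp := chart_closed_ball_compact imc.
    have cl := compact_closed (@carrier_hausdorff _ _ M) cmp.
    have Q : (inv c @` [set y | `|c (g a) - y| <= e]) (g t).
      apply: contrapT => nQ.
      have oQ : open (~` (inv c @` [set y | `|c (g a) - y| <= e])) by apply: closed_openC.
      have clt : clamp a b t = t by rewrite clamp_id// ltW.
      have : \forall u \near t, ~ (inv c @` [set y | `|c (g a) - y| <= e]) (g (clamp a b u)).
        have nQ' : nbhs (g (clamp a b t)) (~` (inv c @` [set y | `|c (g a) - y| <= e])).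
          by rewrite clt; apply: open_nbhs_nbhs.
        exact: (near_comp (gc t) nQ').
      move=> /nbhs_ballP[d /= d0 Hd].
      pose u := Num.max a (t - d / 2).
      have ut : u < t by rewrite gt_max aT/= ltrBlDr ltrDl divr_gt0.
      have au : a <= u by rewrite le_max lexx.
      have [cu bu] := H u (introT andP (conj au ut)).
      apply: (Hd u).
        rewrite /ball/= gtr0_norm ?subr_gt0//.
        have : t - d / 2 <= u by rewrite le_max lexx orbT.
        lra.
      rewrite clamp_id; last by rewrite au (le_trans (ltW ut)).
      by exists (c (g u)); [rewrite /= distrC|rewrite chart_coordK].
    case: Q => y /= ye <-; have [d1 d2] := chart_invK (imc _ ye).
    by rewrite d2 distrC.
move=> t tab; split; first by have [] := main t tab.
apply: (coordinate_displacement ac gS B0 bnd tab) => u /andP[au ut].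
have [|h1 h2] := main u; first by rewrite au (le_trans ut)//; case/andP: tab.
by split=> //; exact: inball.
Qed.

Lemma curve_length_le g a b (k : R) : piecewise_C1 g a b ->
  (forall t, a < t < b -> C1_at g t -> speed g t <= k) ->
  (curve_length g a b <= (k * (b - a))%:E)%E.
Proof.
move=> gab H; have [S [s [gS ->]]] := piecewise_arclength gab.
have [S0 Sc _ dS] := gS; have ab := pw_le gab.
pose F t := k * t + -1 * S t.
have : F a <= F b.
  apply: (@nondecreasing_off_finite R s) => // t.
    move=> _; apply: continuous_addr; apply: continuous_mulr; try exact: continuous_cst.
      by exact: cvg_id.
    exact: Sc.
  move=> tab ts; have [Ct dSt] := dS t tab ts.
  exists (k * 1 + -1 * speed g t); last by have := H t tab Ct; lra.
  by apply: is_deriveD; exact: is_deriveZ.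
rewrite lee_fin /F S0; lra.
Qed.

Lemma chart_curve_C1 c (u u' : R -> 'rV[R]_n) t : atlas c ->
  (\forall s \near t, im c (u s) /\ is_derive (s : R) 1 u (u' s)) ->
  {for t, continuous u'} ->
  C1_at (inv c \o u) t /\ speed (inv c \o u) t = Num.sqrt (inner c (u t) (u' t) (u' t)).
Proof.
move=> ac H cu'; have [cut dut] := nbhs_singleton H.
have cg : {for t, continuous (inv c \o u)}.
  apply: continuous_comp; first exact: is_derive_continuous dut.
  exact: chart_inv_continuous.
have [ct ctK] := chart_invK cut.
have dcu : \forall s \near t, is_derive (s : R) 1 (c \o (inv c \o u)) (u' s).
  apply: filterS (near_join H) => s Hs; have [_ ds] := nbhs_singleton Hs.
  apply: near_eq_is_derive ds; apply: filterS Hs => w [/chart_invK[_ E] _].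
  by rewrite /= E.
split.
  apply: (@C1_at_of_chart _ _ _ c) => //; first by apply: filterS dcu => s [].
  by apply: near_eq_continuous cu'; apply: filterS dcu => s [_ <-]; rewrite derive1E.
by rewrite (speedE ac cg ct (nbhs_singleton dcu)) /= ctK.
Qed.

End LengthEstimates.

(** * The Riemannian distance *)

Section RiemannianDistance.
Context {R : realType} {n : nat} {M : riemannianManifold R n}.
Implicit Types (c : chart R n M) (g : R -> M) (a b t : R) (p q z : M).

Lemma edist_le_length g a b : piecewise_C1 g a b ->
  (edist (g a) (g b) <= curve_length g a b)%E.
Proof. by move=> gab; apply: ereal_inf_lbound; exists g, a, b. Qed.

Lemma edist_ge0 p q : (0 <= edist p q)%E.
Proof.
by apply: le_ereal_inf_tmp => _ [g [a [b [_ _ _ ->]]]]; exact: curve_length_ge0.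
Qed.

Lemma constant_curve_C1 p t : C1_at (fun=> p : M) t /\ speed (fun=> p : M) t = 0.
Proof.
split.
  split; first exact: continuous_cst.
  move=> c ac cp; split; first by apply: (near_open openT I) => s _; exact: derivable_cst.
  have -> : derive1 (c \o (fun=> p)) = fun=> 0.
    by apply/funext => s; rewrite derive1E derive_cst.
  exact: continuous_cst.
rewrite /speed; set c := chart_at _.
have -> : derive1 (c \o (fun=> p)) t = 0 by rewrite derive1E derive_cst.
by rewrite inner0l sqrtr0.
Qed.

Lemma edist_ltP p q (l : R) : (edist p q < l%:E)%E ->
  exists g a b, [/\ a < b, piecewise_C1 g a b, g a = p, g b = q &
    (curve_length g a b < l%:E)%E].
Proof.
move=> /ereal_inf_lt[_ [g [a [b [gab ga gb ->]]]] lt].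
have [ab|] := ltP a b; first by exists g, a, b.
move=> ba; have ab : a = b by apply/le_anti; rewrite ba (pw_le gab).
have l0 : 0 < l by rewrite -lte_fin (le_lt_trans _ lt)// curve_length_ge0.
have seg : piecewise_C1 (fun=> p : M) 0 1.
  apply: (pw_segment ltr01); exists (fun=> p), 1; split; [exact: ltr01|by []|move=> t _].
  by have [] := constant_curve_C1 p t.
exists (fun=> p), 0, 1; split; [exact: ltr01|exact: seg|by []|by rewrite -gb -ab|].
apply: le_lt_trans (curve_length_le (k := 0) seg _) _.
  by move=> t _ _; have [_ ->] := constant_curve_C1 p t.
by rewrite mul0r lte_fin.
Qed.

Lemma edist_refl p : edist p p = 0%E.
Proof.
apply/le_anti; rewrite edist_ge0 andbT.
have := @edist_le_length (fun=> p) 0 0 (pw_refl _ _).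
by rewrite /curve_length set_itv1 integral_set1.
Qed.

Lemma edist_sym_le p q : (edist p q <= edist q p)%E.
Proof.
apply: le_ereal_inf_tmp => _ [g [a [b [gab <- <- ->]]]].
rewrite -(curve_length_reverse gab) -{1}(opprK a) -{1}(opprK b).
exact: (edist_le_length (pw_reverse gab)).
Qed.

Lemma edist_sym p q : edist p q = edist q p.
Proof. by apply/le_anti; rewrite !edist_sym_le. Qed.

(** Shifting the parameter of the second curve makes the two curves adjacent. *)
Lemma curve_concat g1 a b g2 (a' b' : R) : piecewise_C1 g1 a b -> piecewise_C1 g2 a' b' ->
  g1 b = g2 a' -> (edist (g1 a) (g2 b') <= curve_length g1 a b + curve_length g2 a' b')%E.
Proof.
move=> G1 G2 e; have ab := pw_le G1; have cd := pw_le G2.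
pose k := b - a'; pose g t := if t <= b then g1 t else g2 (t - k).
have g1g t : a <= t <= b -> g1 t = g t by move=> /andP[_ tb]; rewrite /g tb.
have g2g t : b <= t <= b' + k -> g2 (t - k) = g t.
  rewrite /g; have [tb|//] := leP t b => /andP[bt _].
  have -> : t = b by apply/le_anti; rewrite tb.
  by rewrite e /k subKr.
have bE : b = a' + k by rewrite /k addrC subrK.
have G1' := pw_eq g1g G1.
have G2s := pw_shift k G2; rewrite -bE in G2s.
have G2' := pw_eq g2g G2s.
have G := pw_cat G1' G2'.
have := edist_le_length G; rewrite {1}/g ab.
have -> : g (b' + k) = g2 b'.
  rewrite -g2g ?addrK//; rewrite lexx andbT bE lerD2r//.
move=> /le_trans; apply.
have L2 := curve_length_shift k G2; rewrite -bE in L2.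
rewrite -L2 -(curve_length_eq g1g G1) -(curve_length_eq g2g G2s).
have [S [s [gS ->]]] := piecewise_arclength G.
have bd : b <= b' + k by rewrite bE lerD2r.
rewrite (curve_length_sub G gS (lexx a) ab bd) (curve_length_sub G gS ab bd (lexx _)).
have [-> _ _ _] := gS; rewrite -EFinD lee_fin; lra.
Qed.

Lemma edist_triangle p q z (a b : R) : (edist p q < a%:E)%E -> (edist q z < b%:E)%E ->
  (edist p z < (a + b)%:E)%E.
Proof.
move=> /edist_ltP[g1 [a1 [b1 [_ G1 <- e1 l1]]]] /edist_ltP[g2 [a2 [b2 [_ G2 e2 <- l2]]]].
have e : g1 b1 = g2 a2 by rewrite e1 e2.
apply: le_lt_trans (curve_concat G1 G2 e) _.
by rewrite EFinD lteD.
Qed.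

Lemma edist_le_arclength g a b S s x y : piecewise_C1 g a b -> arclength g a b S s ->
  a <= x -> x <= y -> y <= b -> (edist (g x) (g y) <= (S y - S x)%:E)%E.
Proof.
move=> gab gS ax xy yb; rewrite -(curve_length_sub gab gS ax xy yb).
by apply: edist_le_length; exact: pw_sub gab ax xy yb.
Qed.

(** Parametrisation proportional to arc length. The arc length S need not be
    injective, so a parameter of given length is chosen by the intermediate value
    theorem; at 0 and 1 the end points of the curve are imposed. *)
Lemma lipschitz_path p q (l : R) : (edist p q < l%:E)%E ->
  exists f : R -> M, [/\ f 0 = p, f 1 = q &
    forall s t, 0 <= s <= 1 -> 0 <= t <= 1 -> (edist (f s) (f t) <= (`|s - t| * l)%:E)%E].
Proof.
move=> /edist_ltP[g [a [b [ab gab gp gq len]]]].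
have [S [s [gS lenE]]] := piecewise_arclength gab.
have [S0 Sc _ _] := gS.
rewrite lenE lte_fin in len.
have Sb0 : 0 <= S b by apply: (arclength_ge0 gS); rewrite lexx ltW.
have H (u : R) : exists t, 0 <= u <= 1 -> [/\ a <= t <= b, S t = u * S b,
    u = 0 -> t = a & u = 1 -> t = b].
  have [->|u0] := eqVneq u 0.
    by exists a => _; rewrite lexx ltW// mul0r; split=> // /eqP; rewrite eq_sym oner_eq0.
  have [->|u1] := eqVneq u 1.
    by exists b => _; rewrite lexx ltW// mul1r; split=> // /eqP; rewrite oner_eq0.
  have [u01|] := boolP (0 <= u <= 1); last by exists 0.
  have [||t] := @IVT R S a b (u * S b) (ltW ab).
  - exact: continuous_subspaceT.
  - rewrite S0 (min_idPl Sb0) (max_idPr Sb0).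
    by case/andP: u01 => u2 u3; rewrite mulr_ge0//= ler_piMl.
  by rewrite in_itv/= => tab tE; exists t => _; split=> // /eqP; rewrite ?(negbTE u0) ?(negbTE u1).
pose tau u := projT1 (cid (H u)).
have tauP u : 0 <= u <= 1 -> [/\ a <= tau u <= b, S (tau u) = u * S b,
    u = 0 -> tau u = a & u = 1 -> tau u = b] by rewrite /tau; case: cid.
exists (g \o tau); split.
- have [|_ _ tau0 _] := tauP 0; first by rewrite lexx ler01.
  by rewrite /= tau0.
- have [|_ _ _ tau1] := tauP 1; first by rewrite lexx ler01.
  by rewrite /= tau1.
have main x y : 0 <= x <= 1 -> 0 <= y <= 1 -> tau x <= tau y ->
    (edist (g (tau x)) (g (tau y)) <= (`|x - y| * l)%:E)%E.
  move=> x01 y01 xy; have [/andP[tx _] Sx _ _] := tauP x x01.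
  have [/andP[_ ty] Sy _ _] := tauP y y01.
  apply: le_trans (edist_le_arclength gab gS tx xy ty) _.
  rewrite lee_fin Sx Sy -mulrBl.
  apply: (@le_trans _ _ (`|x - y| * S b)); first by rewrite ler_wpM2r// distrC ler_norm.
  by rewrite ler_wpM2l// ltW.
move=> x y x01 y01 /=; have [xy|/ltW yx] := leP (tau x) (tau y); first exact: main.
by rewrite edist_sym distrC; exact: main.
Qed.

(** A curve of length less than r / sqrt B from z stays in the coordinate ball of
    radius r. *)
Lemma edist_chart_ball c z (e : R) : atlas c -> dom c z -> 0 < e ->
  exists2 d : R, 0 < d & forall y, (edist z y < d%:E)%E -> dom c y /\ `|c z - c y| < e.
Proof.
move=> ac cz e0; have [B B0 H] := chart_bounds_exist ac (chart_im cz).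
near (0 : R)^'+ => r.
have r0 : 0 < r by near: r; exact: nbhs_right_gt.
have re : r < e by near: r; exact: nbhs_right_lt.
have bnd : chart_bounds c (c z) r B by near: r.
have K0 : 0 < Num.sqrt B by rewrite sqrtr_gt0.
exists (r / Num.sqrt B); first by rewrite divr_gt0.
move=> y /edist_ltP[g [a [b [ab gab gz gy len]]]].
have [S [s [gS lenE]]] := piecewise_arclength gab.
have small : Num.sqrt B * S b < r.
  by rewrite mulrC -ltr_pdivlMr// -lte_fin -lenE.
have [|||h1 h2] := @short_curve_in_ball R n M c g a b S s (c z) r B ac gab gS B0 bnd _ _ b.
- by rewrite gz.
- by rewrite gz subrr normr0 add0r.
- by rewrite lexx ltW.
rewrite -gy; split=> //; rewrite distrC -gz.
exact: le_lt_trans h2 (lt_trans small re).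
Unshelve. all: by end_near. Qed.

Lemma nbhs_edist z (A : set M) : nbhs z A ->
  exists2 e : R, 0 < e & forall y, (edist z y < e%:E)%E -> A y.
Proof.
move=> zA; set c := chart_at z.
have ac : atlas c := chart_at_atlas z; have cz : dom c z := chart_at_dom z.
have : \forall x \near c z, A (inv c x).
  by apply: near_inv; [exact: chart_im|rewrite chart_coordK].
move=> /nbhs_ballP[e /= e0 He].
have [d d0 Hd] := edist_chart_ball ac cz e0.
exists d => // y /Hd[cy ye]; rewrite -(chart_coordK cy).
by apply: He; apply/ballE_norm.
Qed.

(** The segment between two points of a coordinate ball is a curve of the ball,
    of controlled length. *)
Lemma edist_upper c x0 r B x y : atlas c -> 0 < B -> chart_bounds c x0 r B ->
  ball x0 r x -> ball x0 r y ->
  (edist (inv c x) (inv c y) <= (n%:R * Num.sqrt B * `|y - x|)%:E)%E.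
Proof.
move=> ac B0 bnd /ballE_norm xr /ballE_norm yr.
pose u t : 'rV[R]_n := x + t *: (y - x).
have ux0 (t m : R) : 0 <= m -> - m <= t <= 1 + m ->
    `|x0 - u t| <= Num.max `|x0 - x| `|x0 - y| + m * `|y - x|.
  move=> m0 tm.
  have [s [s01 ts]] : exists s, 0 <= s <= 1 /\ `|s - t| <= m.
    exists (clamp 0 1 t); split; first exact/clamp_in/ler01.
    rewrite /clamp; have [t0|t0] := leP t 0.
      by rewrite (min_idPr (le_trans t0 ler01)) (max_idPl t0) sub0r normrN ler0_norm//; lra.
    have [t1|] := boolP (t <= 1).
      by rewrite (min_idPr t1) (max_idPr (ltW t0)) subrr normr0.
    rewrite -ltNge => t1.
    by rewrite (min_idPl (ltW t1)) (max_idPr ler01) ltr0_norm ?subr_lt0//; lra.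
  have -> : x0 - u t = ((1 - s) *: (x0 - x) + s *: (x0 - y)) + (s - t) *: (y - x).
    by apply/rowP => j; rewrite !mxE; ring.
  rewrite (le_trans (ler_normD _ _))// lerD//; last first.
    by rewrite normrZ ler_wpM2r.
  case/andP: s01 => s0 s1.
  rewrite (le_trans (ler_normD _ _))// !normrZ (ger0_norm s0) ger0_norm ?subr_ge0//.
  set mx := Num.max _ _.
  have h1 : (1 - s) * `|x0 - x| <= (1 - s) * mx by rewrite ler_wpM2l ?subr_ge0// le_max lexx.
  have h2 : s * `|x0 - y| <= s * mx by rewrite ler_wpM2l// le_max lexx orbT.
  apply: le_trans (lerD h1 h2) _; lra.
have du t : is_derive t 1 u (y - x).
  have := is_derive_line (f := id) (@derivable_id _ _ (x + t *: (y - x)) (y - x)).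
  by rewrite derive_id.
set mx := Num.max `|x0 - x| `|x0 - y|.
have mxr : mx < r by rewrite gt_max xr.
pose m := (r - mx) / (`|y - x| + 1).
have den : 0 < `|y - x| + 1 by rewrite ltr_wpDl.
have m0 : 0 < m by rewrite divr_gt0// subr_gt0.
have ur t : - m < t < 1 + m -> ball x0 r (u t).
  move=> /andP[t1 t2]; apply/ballE_norm.
  apply: le_lt_trans (ux0 t m (ltW m0) _) _; first by rewrite !ltW.
  have : m * `|y - x| < m * (`|y - x| + 1) by rewrite ltr_pM2l// ltrDl.
  rewrite {2}/m divfK ?gt_eqF// -/mx; lra.
have main t : - m < t < 1 + m -> C1_at (inv c \o u) t /\
    speed (inv c \o u) t = Num.sqrt (inner c (u t) (y - x) (y - x)).
  move=> tm; apply: (@chart_curve_C1 _ _ _ c u (fun=> y - x)) => //; last exact: continuous_cst.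
  apply: filterS (near_itv tm) => s sm; split; last exact: du.
  by have [] := bnd _ (ur s sm).
have seg : piecewise_C1 (inv c \o u) 0 1.
  apply: pw_segment => //; exists (inv c \o u), m; split=> // t tm.
  by have [] := main t; first by rewrite -[- m]add0r.
have u0 : u 0 = x by rewrite /u scale0r addr0.
have u1 : u 1 = y by rewrite /u scale1r addrC subrK.
have := edist_le_length seg; rewrite /= u0 u1 => /le_trans; apply.
rewrite -[(_ * `|_|)%R]mulr1 -[X in (_ * X)%:E]subr0.
apply: curve_length_le => // t /andP[t0 t1] _.
have tm : - m < t < 1 + m by lra.
have [_ ->] := main t tm.
have [cu _ GB _ _] := bnd _ (ur t tm).
have := @inner_upper R n M c (u t) B (y - x) (y - x) (fun i j => (GB i j).1).
move=> /(le_trans (ler_norm _)) H.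
have -> : n%:R * Num.sqrt B * `|y - x| = Num.sqrt (n%:R ^+ 2 * B * `|y - x| * `|y - x|).
  rewrite -(mulrA _ `|y - x|) -expr2 sqrtrM ?mulr_ge0 ?(ltW B0)// sqrtrM ?exprn_ge0//.
  by rewrite !sqrtr_sqr normr_id ger0_norm.
by rewrite ler_sqrt// !mulr_ge0// ltW.
Qed.

Lemma edist_near z (e : R) : 0 < e -> \forall y \near z, (edist z y < e%:E)%E.
Proof.
move=> e0; set c := chart_at z.
have ac : atlas c := chart_at_atlas z; have cz : dom c z := chart_at_dom z.
have [B B0 H] := chart_bounds_exist ac (chart_im cz).
near (0 : R)^'+ => r.
have r0 : 0 < r by near: r; exact: nbhs_right_gt.
have bnd : chart_bounds c (c z) r B by near: r.
have K0 : 0 < n%:R * Num.sqrt B + 1 by rewrite ltr_wpDl// mulr_ge0// sqrtr_ge0.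
pose r' := Num.min r (e / (n%:R * Num.sqrt B + 1)).
have r'0 : 0 < r' by rewrite lt_min r0 divr_gt0.
have n1 : \forall y \near z, ball (c z) r' (c y).
  by apply: (near_comp (chart_continuous cz)); exact: nbhsx_ballx.
apply: filterS2 (chart_near cz) n1 => y cy /ballE_norm.
rewrite lt_min => /andP[yr ye].
have := @edist_upper c (c z) r B (c z) (c y) ac B0 bnd (ballxx _ r0) ((ballE_norm _ _ _).2 yr).
rewrite !chart_coordK// => /le_lt_trans; apply; rewrite lte_fin.
apply: (@le_lt_trans _ _ ((n%:R * Num.sqrt B + 1) * `|c z - c y|)).
  by rewrite distrC ler_wpM2r// lerDl.
by rewrite mulrC -ltr_pdivlMr.
Unshelve. all: by end_near. Qed.

Lemma rball_open z r : open (rball z r).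
Proof.
rewrite openE => y zy; rewrite /rball /= in zy.
have [l lr zl] : exists2 l : R, l < r & (edist z y < l%:E)%E.
  have : edist z y \is a fin_num.
    by rewrite ge0_fin_numE ?edist_ge0// (lt_trans zy)// ltry.
  move=> /fineK E; rewrite -E lte_fin in zy.
  exists ((fine (edist z y) + r) / 2); first lra.
  by rewrite -E lte_fin; lra.
have rl : 0 < r - l by rewrite subr_gt0.
apply: filterS (edist_near y rl) => w yw.
have := edist_triangle zl yw; by rewrite addrC subrK.
Qed.

Lemma compact_nbhs z : exists2 A : set M, compact A & nbhs z A.
Proof.
set c := chart_at z; have cz : dom c z := chart_at_dom z.
have /nbhs_ballP[e /= e0 He] := chart_im_near (chart_im cz).
exists (inv c @` [set y | `|c z - y| <= e / 2]).
  apply: chart_closed_ball_compact => y ye; apply: He; apply/ballE_norm.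
  by rewrite (le_lt_trans ye)// ltr_pdivrMr// ltr_pMr// ltr1n.
have e20 : 0 < e / 2 by rewrite divr_gt0.
have n1 : \forall y \near z, ball (c z) (e / 2) (c y).
  by apply: (near_comp (chart_continuous cz)); exact: nbhsx_ballx.
apply: filterS2 (chart_near cz) n1 => y cy /ballE_norm ye.
by exists (c y); [exact: ltW|rewrite chart_coordK].
Qed.

End RiemannianDistance.

(** * Complete length spaces *)

Section LengthSpaces.
Context {R : realType} {T : topologicalType}.

(** What the Riemannian distance retains for the proof of the Hopf-Rinow
    theorem: it metrises a locally compact topology, and distances are realised
    up to an arbitrarily small error by Lipschitz paths. *)
Record length_distance (d : T -> T -> \bar R) : Prop := LengthDistance {
  ld_ge0 : forall x y, (0 <= d x y)%E;
  ld_refl : forall x, d x x = 0%E;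
  ld_sym : forall x y, d x y = d y x;
  ld_triangle : forall x y z (a b : R),
    (d x y < a%:E)%E -> (d y z < b%:E)%E -> (d x z < (a + b)%:E)%E;
  ld_separated : forall x y, (forall e : R, 0 < e -> (d x y < e%:E)%E) -> x = y;
  ld_near : forall (x : T) (e : R), 0 < e -> \forall y \near x, (d x y < e%:E)%E;
  ld_nbhs : forall (x : T) (A : set T), nbhs x A ->
    exists2 e : R, 0 < e & forall y, (d x y < e%:E)%E -> A y;
  ld_path : forall x y (l : R), (d x y < l%:E)%E ->
    exists f : R -> T, [/\ f 0 = x, f 1 = y &
      forall s t, 0 <= s <= 1 -> 0 <= t <= 1 -> (d (f s) (f t) <= (`|s - t| * l)%:E)%E];
  ld_locally_compact : forall x : T, exists2 A : set T, compact A & nbhs x A }.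

Definition cauchy_complete (d : T -> T -> \bar R) :=
  forall s : nat -> T,
    (forall e : R, 0 < e -> exists N : nat, forall i j : nat,
       (N <= i)%N -> (N <= j)%N -> (d (s i) (s j) < e%:E)%E) ->
    exists l : T, forall e : R, 0 < e ->
      exists N : nat, forall i : nat, (N <= i)%N -> (d (s i) l < e%:E)%E.

Context (d : T -> T -> \bar R) (ld : length_distance d).

Lemma ld_closed_ball x (l : R) y :
  (forall e : R, 0 < e -> exists2 z, (d x z <= l%:E)%E & (d z y < e%:E)%E) ->
  (d x y <= l%:E)%E.
Proof.
move=> H; apply/lee_addgt0Pr => e e0; rewrite -EFinD.
have e20 : 0 < e / 2 by rewrite divr_gt0.
have [z xz zy] := H _ e20.
have xz' : (d x z < (l + e / 2)%:E)%E.
  by rewrite (le_lt_trans xz)// lte_fin ltrDl.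
apply: ltW; have := ld_triangle ld xz' zy.
by rewrite -addrA -splitr.
Qed.

(** The point is found on an almost shortest path. *)
Lemma ld_intermediate x y (l b : R) : (d x y < l%:E)%E -> 0 < l -> 0 <= b <= l ->
  exists w, (d x w <= (l - b)%:E)%E /\ (d w y <= b%:E)%E.
Proof.
move=> xy l0 /andP[b0 bl]; have [f [fx fy fd]] := ld_path ld xy.
have bl1 : 0 <= b / l <= 1 by rewrite divr_ge0 ?(ltW l0)//= ler_pdivrMr// mul1r.
have bl1' : 0 <= 1 - b / l <= 1 by case/andP: bl1; lra.
exists (f (1 - b / l)); split.
  have := fd 0 (1 - b / l); rewrite fx lexx ler01 => /(_ isT bl1').
  rewrite sub0r normrN ger0_norm; last by case/andP: bl1'.
  by rewrite mulrBl mul1r divfK// gt_eqF.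
have := fd (1 - b / l) 1; rewrite fy lexx ler01 => /(_ bl1' isT).
rewrite addrAC subrr sub0r normrN ger0_norm; last by case/andP: bl1.
by rewrite divfK// gt_eqF.
Qed.

(** The trace of F on K, through a choice of points of K near those of S, has a
    cluster point in K. *)
Lemma ultra_small_ball (F : set_system T) (S K : set T) (e : R) : UltraFilter F -> 0 < e ->
  F S -> compact K -> (forall y, S y -> exists2 w, K w & (d w y < e%:E)%E) ->
  exists2 z, K z & F [set y | (d z y < (e + e)%:E)%E].
Proof.
move=> FU e0 FS cK H; have PF : ProperFilter F by exact: ultra_proper.
have H' y : exists w, S y -> K w /\ (d w y < e%:E)%E.
  by have [/H[w Kw wy]|nS] := pselect (S y); [exists w|exists y].
pose w y := projT1 (cid (H' y)).
have wP y : S y -> K (w y) /\ (d (w y) y < e%:E)%E by rewrite /w; case: cid.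
have FK : F (w @^-1` K) by apply: filterS FS => y /wP[].
have [z [Kz zcl]] := cK (w @ F) _ FK.
exists z => //.
have [//|nF] := in_ultra_setVsetC [set y | (d z y < (e + e)%:E)%E] FU.
have FC : F (w @^-1` (w @` (S `&` ~` [set y | (d z y < (e + e)%:E)%E]))).
  have : F (S `&` ~` [set y | (d z y < (e + e)%:E)%E]) by exact: filterI.
  by apply: filterS => y Hy; exists y.
have [_ [[y [Sy ny] <-] zw]] := zcl _ _ FC (ld_near ld z e0).
by case: ny; apply: (ld_triangle ld zw); have [] := wP y Sy.
Qed.

(** An ultrafilter on the closed ball contains sets of arbitrarily small diameter,
    because every point of the ball is close to a relatively compact smaller ball;
    their centres form a Cauchy sequence. *)
Lemma closed_ball_compact_of_smaller x (l : R) : cauchy_complete d -> 0 < l ->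
  (forall s, s < l -> exists2 A, compact A & forall y, (d x y < s%:E)%E -> A y) ->
  compact [set y | (d x y <= l%:E)%E].
Proof.
move=> comp l0 H; rewrite compact_ultra => F FU FB; have PF : ProperFilter F by exact: ultra_proper.
have small (e : R) : 0 < e -> exists z, F [set y | (d z y < e%:E)%E].
  move=> e0; pose e' := Num.min (e / 2) l.
  have e'0 : 0 < e' by rewrite lt_min l0 divr_gt0.
  have e'l : e' <= l by rewrite ge_min lexx orbT.
  have [|A cA xA] := H (l - e' / 4); first by lra.
  have [|z Az Fz] := ultra_small_ball (S := [set y | (d x y <= l%:E)%E]) (K := A) (e := e') FU e'0 FB cA.
    move=> y /= xy.
    have xy' : (d x y < (l + e' / 4)%:E)%E by rewrite (le_lt_trans xy)// lte_fin; lra.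
    have [||w [xw wy]] := ld_intermediate (b := 3 * e' / 4) xy'; [lra|lra|].
    exists w; last by rewrite (le_lt_trans wy)// lte_fin; lra.
    by apply: xA; rewrite (le_lt_trans xw)// lte_fin; lra.
  exists z; apply: filterS Fz => y /= /lt_le_trans; apply.
  have : e' <= e / 2 by rewrite ge_min lexx.
  by rewrite lee_fin; lra.
have inv0 k : 0 < k.+1%:R^-1 :> R by rewrite invr_gt0 ltr0Sn.
pose z k := projT1 (cid (small _ (inv0 k))).
have zP k : F [set y | (d (z k) y < (k.+1%:R^-1)%:E)%E] by rewrite /z; case: cid.
have dec i j : (i <= j)%N -> j.+1%:R^-1 <= i.+1%:R^-1 :> R.
  by move=> ij; rewrite lef_pV2 ?posrE ?ltr0Sn// ler_nat.
have archi (e : R) : 0 < e -> exists N : nat, N.+1%:R^-1 < e.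
  move=> e0; exists (Num.truncn e^-1).
  by rewrite invf_plt ?posrE ?ltr0Sn// truncnS_gt.
have [|p Hp] := comp z.
  move=> e e0; have [N HN] := archi (e / 2) (divr_gt0 e0 (ltr0Sn _ 1)).
  exists N => i j Ni Nj; have [y [/= yi yj]] := filter_ex (filterI (zP i) (zP j)).
  rewrite (ld_sym ld) in yj; apply: lt_trans (ld_triangle ld yi yj) _.
  by rewrite lte_fin (splitr e) ltrD// (le_lt_trans (dec _ _ _) HN).
have Fp (e : R) : 0 < e -> F [set y | (d p y < e%:E)%E].
  move=> e0; have e20 : 0 < e / 2 by rewrite divr_gt0.
  have [N1 HN1] := archi _ e20; have [N2 HN2] := Hp _ e20.
  have := zP (maxn N1 N2); apply: filterS => y /= zy.
  have pz : (d p (z (maxn N1 N2)) < (e / 2)%:E)%E by rewrite (ld_sym ld) HN2// leq_maxr.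
  apply: lt_le_trans (ld_triangle ld pz zy) _.
  by rewrite lee_fin [leRHS]splitr lerD// ltW// (le_lt_trans (dec _ _ _) HN1)// leq_maxl.
exists p; split.
  apply: ld_closed_ball => e e0.
  have [y [xy py]] := filter_ex (filterI FB (Fp e e0)).
  by exists y => //; rewrite (ld_sym ld).
by move=> A /(ld_nbhs ld)[e e0 eA]; apply: filterS (Fp e e0) => y; exact: eA.
Qed.

(** The Cohn-Vossen part of the Hopf-Rinow theorem. If the radii of relatively compact
    balls had a finite supremum m, the closed ball of radius m would be compact by
    closed_ball_compact_of_smaller, and finitely many compact neighbourhoods of its
    points would contain a larger ball. *)
Lemma ball_in_compact x (l : R) : cauchy_complete d ->
  exists2 A, compact A & forall y, (d x y < l%:E)%E -> A y.
Proof.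
move=> comp; apply: contrapT => nl.
pose P s := exists2 A, compact A & forall y, (d x y < s%:E)%E -> A y.
have Ple s t : s <= t -> P t -> P s.
  by move=> st [A cA xA]; exists A => // y xy; apply: xA; rewrite (lt_le_trans xy).
have Pl s : P s -> s <= l.
  by move=> Ps; rewrite leNgt; apply/negP => /ltW/Ple/(_ Ps).
have [e0 e00 Pe0] : exists2 e : R, 0 < e & P e.
  have [A cA xA] := ld_locally_compact ld x.
  by have [e e0 eA] := ld_nbhs ld xA; exists e => //; exists A.
have supP : has_sup P by split; [exists e0|exists l].
set m := sup P.
have m0 : 0 < m by rewrite (lt_le_trans e00)//; apply: ub_le_sup => //; exact: supP.2.
have Pm s : s < m -> P s.
  by move=> sm; have [t Pt st] := sup_gt (ex_intro _ e0 Pe0) sm; exact: Ple (ltW st) Pt.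
have cB := closed_ball_compact_of_smaller comp m0 Pm.
have cov := (compact_near_coveringP _).1 cB.
(* The radius 8 e of relatively compact balls is uniform on the closed ball. *)
pose Q (e : R) y := exists2 A, compact A & forall w, (d y w < (8 * e)%:E)%E -> A w.
have : \forall e \near (0 : R)^'+, [set y | (d x y <= m%:E)%E] `<=` Q e.
  apply: cov => y xy.
  have [A cA yA] := ld_locally_compact ld y.
  have [r r0 rA] := ld_nbhs ld yA.
  have r20 : 0 < r / 2 by rewrite divr_gt0.
  near=> y' e => /=; exists A => // w y'w; apply: rA.
  have yy' : (d y y' < (r / 2)%:E)%E by near: y'; exact: ld_near.
  apply: lt_le_trans (ld_triangle ld yy' y'w) _.
  rewrite lee_fin; have : e < r / 16; last lra.
  by near: e; apply: nbhs_right_lt; rewrite divr_gt0.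
move=> HQ; near (0 : R)^'+ => e.
have e0' : 0 < e by near: e; exact: nbhs_right_gt.
have em : e < m by near: e; exact: nbhs_right_lt.
have Qe : [set y | (d x y <= m%:E)%E] `<=` Q e by near: e.
have : P (m + e).
  exists [set y | (d x y <= (m + e)%:E)%E]; last by move=> y /ltW.
  rewrite compact_ultra => F FU FB; have PF : ProperFilter F by exact: ultra_proper.
  have e40 : 0 < 4 * e by lra.
  have [|z zB Fz] := ultra_small_ball FU e40 FB cB.
    move=> y /= xy.
    have xy' : (d x y < (m + 2 * e)%:E)%E by rewrite (le_lt_trans xy)// lte_fin; lra.
    have [||w [xw wy]] := ld_intermediate (b := 2 * e) xy'; [lra|lra|].
    exists w; first by rewrite addrK in xw.
    by rewrite (le_lt_trans wy)// lte_fin; lra.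
  have [A cA zA] := Qe z zB.
  have FA : F A.
    apply: filterS Fz => y /= zy; apply: zA.
    by have -> : 8 * e = 4 * e + 4 * e by ring.
  rewrite compact_ultra in cA; have [p [Ap Fp]] := cA F FU FA.
  exists p; split=> //; apply: ld_closed_ball => r r0.
  have := Fp _ (ld_near ld p r0) => Fp'.
  have [y [xy py]] := filter_ex (filterI FB Fp').
  by exists y => //; rewrite (ld_sym ld).
move=> /(ub_le_sup supP.2); rewrite -/m leNgt => /negP; apply.
by rewrite ltrDl.
Unshelve. all: by end_near. Qed.

(** By Tychonoff's theorem, the l-Lipschitz paths from x to y with l decreasing to D
    have a cluster point in the product topology. It is D-Lipschitz, and equality follows
    from the triangle inequality between x and y. *)
Lemma shortest_path_exists x y (D : R) : cauchy_complete d -> d x y = D%:E ->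
  exists f : R -> T, [/\ f 0 = x, f 1 = y &
    forall s t, 0 <= s <= 1 -> 0 <= t <= 1 -> d (f s) (f t) = (`|s - t| * D)%:E].
Proof.
move=> comp xyD.
have H (l : R) : exists f : R -> T, D < l -> [/\ f 0 = x, f 1 = y &
    forall s t, 0 <= s <= 1 -> 0 <= t <= 1 -> (d (f s) (f t) <= (`|s - t| * l)%:E)%E].
  have [Dl|] := boolP (D < l); last by exists (fun=> x).
  by have [|f fP] := @ld_path _ ld x y l; [rewrite xyD lte_fin|exists f].
pose f l s := projT1 (cid (H l)) (clamp 0 1 s).
have fP l : D < l -> [/\ f l 0 = x, f l 1 = y,
    (forall s t, 0 <= s <= 1 -> 0 <= t <= 1 -> (d (f l s) (f l t) <= (`|s - t| * l)%:E)%E) &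
    forall s, (d x (f l s) <= l%:E)%E].
  move=> Dl; rewrite /f; case: cid => g /= /(_ Dl)[g0 g1 gd]; split.
  - by rewrite clamp_id// lexx ler01.
  - by rewrite clamp_id// lexx ler01.
  - by move=> s t s01 t01; rewrite !clamp_id//; exact: gd.
  - move=> s; have c01 := clamp_in s (@ler01 R).
    rewrite -g0; apply: le_trans (gd 0 _ _ c01) _; first by rewrite lexx ler01.
    rewrite lee_fin sub0r normrN; case/andP: c01 => c0 c1.
    rewrite ger0_norm// -[leRHS]mul1r ler_wpM2r//.
    by have := ld_ge0 ld x y; rewrite xyD lee_fin => D0; rewrite (le_trans D0)// ltW.
have [A cA xA] := ball_in_compact x (D + 2) comp.
have cAA : compact [set g : prod_topology (fun _ : R => T) | forall s : R, A (g s)].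
  exact: (@tychonoff R (fun=> T) (fun=> A) (fun=> cA)).
have FA : \forall l \near D^'+, forall s : R, A (f l s).
  near=> l => s; apply: xA.
  have Dl : D < l by near: l; exact: nbhs_right_gt.
  have [_ _ _ /(_ s)] := fP l Dl; move=> /le_lt_trans; apply; rewrite lte_fin.
  by near: l; apply: nbhs_right_lt; rewrite ltrDl.
have [g [gA gcl]] := cAA ((f : R -> prod_topology (fun _ : R => T)) @ D^'+) _ FA.
have approx (e : R) s t : 0 < e -> exists l, [/\ D < l, l < D + e,
    (d (f l s) (g s) < e%:E)%E & (d (f l t) (g t) < e%:E)%E].
  move=> e0.
  have N1 : nbhs g [set h : prod_topology (fun _ : R => T) |
      (d (g s) (h s) < e%:E)%E /\ (d (g t) (h t) < e%:E)%E].
    have n1 := @proj_continuous _ (fun=> T) s g _ (ld_near ld (g s) e0).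
    have n2 := @proj_continuous _ (fun=> T) t g _ (ld_near ld (g t) e0).
    exact: (@filterI _ _ (@nbhs_filter (prod_topology (fun _ : R => T)) g) _ _ n1 n2).
  have N2 : \forall l \near D^'+, (f @` [set l | D < l < D + e]) (f l).
    near=> l; exists l => //=; apply/andP; split; near: l; first exact: nbhs_right_gt.
    by apply: nbhs_right_lt; rewrite ltrDl.
  have [_ [[l /andP[l1 l2] <-] [h1 h2]]] := gcl _ _ N2 N1.
  by exists l; split=> //; rewrite (ld_sym ld).
have g0 : g 0 = x.
  apply/esym/(ld_separated ld) => e e0; have [l [Dl _ + _]] := approx e 0 0 e0.
  by have [-> _ _ _] := fP l Dl.
have g1 : g 1 = y.
  apply/esym/(ld_separated ld) => e e0; have [l [Dl _ + _]] := approx e 1 1 e0.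
  by have [_ -> _ _] := fP l Dl.
have gle s t : 0 <= s <= 1 -> 0 <= t <= 1 -> (d (g s) (g t) <= (`|s - t| * D)%:E)%E.
  move=> s01 t01; apply/lee_addgt0Pr => e e0; rewrite -EFinD.
  have e40 : 0 < e / 4 by rewrite divr_gt0.
  have [l [Dl lD fs ft]] := approx _ s t e40.
  have [_ _ /(_ s t s01 t01) fst _] := fP l Dl.
  have st1 : `|s - t| <= 1 by rewrite ler_norml; lra.
  have fst' : (d (f l s) (f l t) < (`|s - t| * D + 2 * (e / 4))%:E)%E.
    rewrite (le_lt_trans fst)// lte_fin.
    have : `|s - t| * l <= `|s - t| * (D + e / 4) by rewrite ler_wpM2l// ltW.
    have : `|s - t| * (e / 4) <= 1 * (e / 4) by rewrite ler_wpM2r// ltW.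
    by rewrite mulrDr; lra.
  rewrite (ld_sym ld) in fs.
  apply: ltW; have := ld_triangle ld (ld_triangle ld fs fst') ft.
  by congr (_ < _%:E)%E; field.
exists g; split=> // s t s01 t01.
wlog st : s t s01 t01 / s <= t.
  move=> W; have [st|/ltW ts] := leP s t; first exact: W.
  by rewrite (ld_sym ld) distrC; exact: W.
apply/le_anti; rewrite gle//= leNgt; apply/negP => lt.
have /andP[s0 s1] := s01; have /andP[t0 t1] := t01.
have E : d (g s) (g t) \is a fin_num.
  by rewrite ge0_fin_numE ?(ld_ge0 ld)// (lt_trans lt) ?ltry.
move/fineK : E => E; rewrite -E lte_fin in lt.
pose r := (`|s - t| * D - fine (d (g s) (g t))) / 4.
have r0 : 0 < r by rewrite divr_gt0// subr_gt0.
have h1 : (d x (g s) < (s * D + r)%:E)%E.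
  rewrite -g0; apply: le_lt_trans (gle 0 s _ s01) _; first by rewrite lexx ler01.
  by rewrite lte_fin sub0r normrN ger0_norm// ltrDl.
have h2 : (d (g s) (g t) < (fine (d (g s) (g t)) + r)%:E)%E by rewrite -{1}E lte_fin ltrDl.
have h3 : (d (g t) y < ((1 - t) * D + r)%:E)%E.
  rewrite -g1; apply: le_lt_trans (gle t 1 t01 _) _; first by rewrite lexx ler01.
  by rewrite lte_fin distrC ger0_norm ?subr_ge0// ltrDl.
have := ld_triangle ld (ld_triangle ld h1 h2) h3.
rewrite xyD lte_fin.
have := r0; rewrite /r distrC ger0_norm ?subr_ge0//; lra.
Unshelve. all: by end_near. Qed.

End LengthSpaces.

(** * A boundary value problem *)

Section BoundaryValueProblem.
Context {R : realType} {n : nat}.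
Implicit Types (f g u v : R -> 'rV[R]_n) (t : R).

Lemma pow2_small (m e : R) : 0 < e -> exists k, m * 2^-1 ^+ k < e.
Proof.
move=> e0; have h : `|2^-1 : R| < 1 by rewrite ger0_norm// invf_lt1// ltr1n.
have /cvgrPdist_lt /(_ _ e0) := cvg_geometric m h.
move=> [k _ Hk]; exists k; have := Hk k (leqnn k).
by rewrite sub0r normrN => /(le_lt_trans (ler_norm _)).
Qed.

(** The contraction principle for the uniform distance: the iterates of the zero
    function converge uniformly, at the rate of a geometric series. *)
Lemma bounded_contraction (Phi : (R -> 'rV[R]_n) -> R -> 'rV[R]_n) (m : R) : 0 <= m ->
  (forall f, continuous f -> (forall t, `|f t| <= m) ->
     continuous (Phi f) /\ forall t, `|Phi f t| <= m) ->
  (forall f g e, continuous f -> (forall t, `|f t| <= m) ->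
     continuous g -> (forall t, `|g t| <= m) ->
     (forall t, `|f t - g t| <= e) -> forall t, `|Phi f t - Phi g t| <= e / 2) ->
  exists f, [/\ continuous f, forall t, `|f t| <= m & forall t, Phi f t = f t].
Proof.
move=> m0 stab contr.
pose F k := iter k Phi (fun=> 0).
have FE k : continuous (F k) /\ forall t, `|F k t| <= m.
  elim: k => [|k [IH1 IH2]]; last exact: stab.
  by split=> [t|t]; [exact: continuous_cst|rewrite normr0].
have step k t : `|F k.+1 t - F k t| <= m * 2^-1 ^+ k.
  elim: k t => [|k IH] t; first by rewrite subr0 expr0 mulr1; exact: (FE 1%N).2.
  rewrite exprSr mulrA; apply: contr => //; by have [] := FE k; have [] := FE k.+1.
have far k j t : `|F (k + j)%N t - F k t| <= 2 * m * 2^-1 ^+ k * (1 - 2^-1 ^+ j).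
  elim: j => [|j IH]; first by rewrite addn0 subrr normr0 expr0 subrr mulr0.
  rewrite addnS -(subrK (F (k + j)%N t) (F (k + j).+1 t)) -addrA.
  rewrite (le_trans (ler_normD _ _))// (le_trans (lerD (step _ _) IH))//.
  rewrite le_eqVlt; apply/orP; left; apply/eqP.
  by rewrite exprD exprS; field.
have far' k j t : (k <= j)%N -> `|F j t - F k t| <= 2 * m * 2^-1 ^+ k.
  move=> /subnKC <-; apply: le_trans (far _ _ _) _.
  apply: ler_piMr; first by rewrite !mulr_ge0 ?exprn_ge0 ?invr_ge0.
  by rewrite gerBl exprn_ge0 ?invr_ge0.
have cF t : cvgn (fun k => F k t).
  apply/cauchy_cvgP/cauchy_ballP => e e0; near_simpl.
  have e20 : 0 < e / 2 by rewrite divr_gt0.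
  have [k Hk] := pow2_small (2 * m) e20.
  near=> i j => /=; apply/ballE_norm.
  rewrite (le_lt_trans (ler_distD (F k t) _ _))// (splitr e) ltrD//.
    by apply: le_lt_trans (far' _ _ _ _) Hk; near: i; exact: nbhs_infty_ge.
  rewrite distrC; apply: le_lt_trans (far' _ _ _ _) Hk; near: j; exact: nbhs_infty_ge.
pose f t := limn (fun k => F k t).
have fF k t : `|f t - F k t| <= 2 * m * 2^-1 ^+ k.
  have h : `|F j t - F k t| @[j --> \oo] --> `|f t - F k t|.
    by apply: cvg_norm; apply: cvgB; [exact: cF|exact: cvg_cst].
  apply: (cvgr_to_le h); near=> j; apply: far'; near: j; exact: nbhs_infty_ge.
have cf : continuous f.
  move=> t; apply: continuous_of_dist => e e0.
  have e30 : 0 < e / 3 by rewrite divr_gt0.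
  have [k Hk] := pow2_small (2 * m) e30.
  apply: filterS (continuous_near_dist ((FE k).1 t) e30) => s Hs.
  have -> : f t - f s = (f t - F k t) + (F k t - F k s) + (F k s - f s).
    by apply/rowP => j; rewrite !mxE; ring.
  have := fF k t; have := fF k s; rewrite (distrC (f s)) => h1 h2.
  apply: le_trans (ler_normD _ _) _.
  apply: le_trans (lerD (ler_normD _ _) (lexx _)) _.
  by move: h1 h2 (ltW Hk) (ltW Hs); lra.
have fm t : `|f t| <= m.
  have h : `|F j t| @[j --> \oo] --> `|f t| by apply: cvg_norm; exact: cF.
  by apply: (cvgr_to_le h); near=> j; exact: (FE j).2.
exists f; split=> // t; apply/eqP; rewrite -subr_eq0 -normr_le0.
apply/ler_addgt0Pr => e e0; rewrite add0r.
have e40 : 0 < e / 2 by rewrite divr_gt0.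
have [k Hk] := pow2_small (2 * m) e40.
rewrite -(subrK (F k.+1 t) (Phi f t)) -addrA (le_trans (ler_normD _ _))//.
rewrite (splitr e) lerD//.
  have [c1 b1] := FE k.
  apply: le_trans (contr f (F k) (e / 2) cf fm c1 b1 _ t) _ => [s|].
    exact: le_trans (fF k s) (ltW Hk).
  by rewrite ler_pdivrMr// ler_pMr// ler1n.
rewrite distrC (le_trans (fF _ _))// (le_trans _ (ltW Hk))//.
rewrite ler_wpM2l ?mulr_ge0// exprS ger_pMl ?exprn_gt0 ?invr_gt0//.
by rewrite invf_le1// ler1n.
Unshelve. all: by end_near. Qed.

Lemma derive_lipschitz (h h' : R -> R) (a b e : R) s t :
  (forall x, a <= x <= b -> is_derive x 1 h (h' x) /\ `|h' x| <= e) ->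
  a <= s <= b -> a <= t <= b -> `|h s - h t| <= e * `|s - t|.
Proof.
move=> H sab tab.
wlog st : s t sab tab / s <= t.
  move=> W; have [|/ltW ts] := leP s t; first exact: W.
  by rewrite distrC (distrC s); exact: W.
have sub x : s <= x <= t -> a <= x <= b.
  by move: sab tab => /andP[? ?] /andP[? ?] /andP[? ?]; apply/andP; split; lra.
have [x|x|c cst E] := @MVT_segment R h h' s t st.
- by rewrite in_itv/= => /andP[? ?]; have [] := H x (sub x _); first by rewrite !ltW.
- apply: (derivable_within_continuous (i := `[s, t]%R)) => y.
  by rewrite in_itv/= => /sub/H[[]].
- rewrite distrC E normrM (distrC s) ler_wpM2r//.
  by move: cst; rewrite in_itv/= => /sub/H[].
Qed.

Lemma primitive_rV f (a b : R) : continuous f ->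
  exists F : R -> 'rV[R]_n, forall t, a < t < b -> is_derive t 1 F (f t).
Proof.
move=> cf.
have H k : exists F : R -> R, forall t, a < t < b -> is_derive t 1 F (f t 0 k).
  by apply: primitive_exists => t; have /continuous_rVP := cf t; apply.
exists (fun t => \row_k projT1 (cid (H k)) t) => t tab.
apply/is_derive_rVP => k.
have -> : (fun s => (\row_k projT1 (cid (H k)) s) 0 k) = projT1 (cid (H k)).
  by apply/funext => s; rewrite mxE.
by case: cid => F /= HF; exact: HF.
Qed.

Lemma is_derive_linear_fun (c0 : 'rV[R]_n) t :
  is_derive t 1 (fun s : R => s *: c0) c0.
Proof.
have := is_derive_line (f := id) (@derivable_id _ _ (0 + t *: c0) c0).
rewrite derive_id; congr is_derive; apply/funext => s; by rewrite add0r.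
Qed.

(** Two successive primitives of f, corrected by an affine function; the interval
    exceeds [-2, 3] to give two-sided derivatives there. *)
Lemma two_point_problem f (x y : 'rV[R]_n) : continuous f ->
  exists uv : (R -> 'rV[R]_n) * (R -> 'rV[R]_n), [/\ uv.1 0 = x, uv.1 1 = y &
    forall t, -3 < t < 4 -> is_derive t 1 uv.1 (uv.2 t) /\ is_derive t 1 uv.2 (f t)].
Proof.
move=> cf; have [I dI] := primitive_rV (-4) 5 cf.
have cI : continuous (fun t => I (clamp (-3) 4 t)).
  move=> t; apply: clamp_comp_continuous => [|s sI]; first lra.
  by apply: is_derive_continuous (dI s _); lra.
have [II dII] := primitive_rV (-3) 4 cI.
pose c0 := y - x - (II 1 - II 0).
exists (fun t => II t + (x - II 0) + t *: c0, fun t => I t + c0); split => /=.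
- by rewrite scale0r addr0 addrC subrK.
- by rewrite scale1r /c0; apply/rowP => k; rewrite !mxE; ring.
move=> t tI; split.
  have d1 := dII t tI; rewrite clamp_id in d1; last by lra.
  have := is_deriveD (is_derive_addc (x - II 0) d1) (is_derive_linear_fun c0 t).
  by [].
apply: is_derive_addc; apply: dI; lra.
Qed.

(** Each coordinate of w vanishes at 0 and at 1, so its derivative vanishes in
    between; every point of [-2, 3] is at distance at most 3 from these zeros. *)
Lemma two_point_bound (w z h : R -> 'rV[R]_n) (e : R) : w 0 = 0 -> w 1 = 0 ->
  (forall t, -2 <= t <= 3 -> is_derive t 1 w (z t) /\ is_derive t 1 z (h t)) ->
  (forall t, `|h t| <= e) ->
  forall t, -2 <= t <= 3 -> `|z t| <= 3 * e /\ `|w t| <= 9 * e.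
Proof.
move=> w0 w1 dwz he t tI.
have e0 : 0 <= e by exact: le_trans (he 0).
have dw (k : 'I_n) (s : R) : -2 <= s <= 3 -> is_derive s 1 (fun s => w s 0 k) (z s 0 k).
  by move=> /dwz[/is_derive_rVP + _]; apply.
have dz (k : 'I_n) (s : R) : -2 <= s <= 3 -> is_derive s 1 (fun s => z s 0 k) (h s 0 k).
  by move=> /dwz[_ /is_derive_rVP]; apply.
have zb (k : 'I_n) (s : R) : -2 <= s <= 3 -> `|z s 0 k| <= 3 * e.
  move=> sI.
  have [r r01 zr] : exists2 r, 0 <= r <= 1 & z r 0 k = 0.
    have [x|x|r rI] := @MVT_segment R (fun s => w s 0 k) (fun s => z s 0 k) 0 1 ler01.
    - rewrite in_itv/= => /andP[? ?]; apply: dw; lra.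
    - apply: (derivable_within_continuous (i := `[0, 1]%R)) => r.
      by rewrite in_itv/= => /andP[? ?]; have [] := dw k r; first lra.
    - rewrite w0 w1 subrr subr0 mulr1 => /esym E; exists r => //.
  have := @derive_lipschitz (fun s => z s 0 k) (fun s => h s 0 k) (-2) 3 e s r.
  rewrite zr subr0 => H; apply: le_trans (H _ _ _) _ => //; last 2 first.
  - lra.
  - have : `|s - r| <= 3 by rewrite ler_norml; lra.
    by move=> sr; rewrite mulrC ler_wpM2r.
  - by move=> x xI; split; [exact: dz|exact: le_trans (mx_entry_norm _ _ _) (he x)].
split; first by apply: rV_norm_le => [|k]; [rewrite mulr_ge0|exact: zb].
apply: rV_norm_le => [|k]; first by rewrite mulr_ge0.
have := @derive_lipschitz (fun s => w s 0 k) (fun s => z s 0 k) (-2) 3 (3 * e) t 0.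
rewrite w0 [(0 : 'rV_n) _ _]mxE subr0 => H; apply: le_trans (H _ _ _) _ => //; last 2 first.
- lra.
- have : `|t| <= 3 by rewrite ler_norml; lra.
  by move=> t3; rewrite subr0 (_ : 9 * e = 3 * e * 3) ?ler_wpM2l ?mulr_ge0//; ring.
- by move=> x xI; split; [exact: dw|exact: zb].
Qed.

(** The unknown of the fixed point problem is the acceleration, an arbitrary
    continuous function bounded by e: it determines u and v by two_point_problem, and
    the quadratic growth of Q makes the new acceleration Q (u, v) of order e^2. Solutions
    are wanted beyond [0, 1], for the extension of geodesics. *)
Lemma boundary_value_problem (Q : 'rV[R]_n -> 'rV[R]_n -> 'rV[R]_n)
    (x0 : 'rV[R]_n) (r C e : R) :
  0 < C ->
  (forall x v : 'rV[R]_n, ball x0 r x -> `|Q x v| <= C * `|v| ^+ 2) ->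
  (forall x x' v v' : 'rV[R]_n, ball x0 r x -> ball x0 r x' ->
     `|Q x v - Q x' v'| <= C * (`|x - x'| * `|v| ^+ 2 + `|v - v'| * (`|v| + `|v'|))) ->
  0 < e -> e <= 1 -> 16 * e < r -> 510 * (C * e) <= 1 ->
  forall x y : 'rV[R]_n, ball x0 e x -> ball x0 e y ->
  exists u v : R -> 'rV[R]_n, [/\ u 0 = x, u 1 = y &
    forall t, -2 <= t <= 3 -> [/\ is_derive t 1 u (v t), is_derive t 1 v (Q (u t) (v t)),
      `|x0 - u t| <= 16 * e & `|v t| <= 5 * e]].
Proof.
move=> C0 Qb Ql e0 e1 er Ce x y /ballE_norm xe /ballE_norm ye.
have H f : exists uv : (R -> 'rV[R]_n) * (R -> 'rV[R]_n), continuous f -> [/\ uv.1 0 = x, uv.1 1 = y &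
    forall t, -3 < t < 4 -> is_derive t 1 uv.1 (uv.2 t) /\ is_derive t 1 uv.2 (f t)].
  have [cf|ncf] := pselect (continuous f); last by exists (fun=> 0, fun=> 0).
  by have [uv uvP] := two_point_problem x y cf; exists uv.
pose U f := (projT1 (cid (H f))).1; pose V f := (projT1 (cid (H f))).2.
have UV f : continuous f -> [/\ U f 0 = x, U f 1 = y &
    forall t, -3 < t < 4 -> is_derive t 1 (U f) (V f t) /\ is_derive t 1 (V f) (f t)].
  by rewrite /U /V; case: cid.
have yx : `|y - x| <= 2 * e.
  by rewrite (le_trans (ler_distD x0 _ _))// distrC; move: (ltW xe) (ltW ye); lra.
have bnd f : continuous f -> (forall t, `|f t| <= e) -> forall t, -2 <= t <= 3 ->
    `|x0 - U f t| <= 16 * e /\ `|V f t| <= 5 * e.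
  move=> cf fe t tI; have [U0 U1 dUV] := UV f cf.
  (* the deviation from the uniform motion from x to y *)
  pose w t := U f t + (- x) + t *: - (y - x); pose z t := V f t + (- (y - x)).
  have [||s sI|h1 h2] := @two_point_bound w z f e _ _ _ fe t tI.
  - by rewrite /w U0 subrr scale0r addr0.
  - by rewrite /w U1 scale1r subrr.
  - have [d1 d2] : is_derive s 1 (U f) (V f s) /\ is_derive s 1 (V f) (f s) by apply: dUV; lra.
    split; last exact: is_derive_addc.
    exact: (is_deriveD (is_derive_addc (- x) d1) (is_derive_linear_fun (- (y - x)) s)).
  split; last first.
    rewrite -(subrK (y - x) (V f t)) (le_trans (ler_normD _ _))//.
    by move: h1 yx; rewrite /z; lra.
  have -> : x0 - U f t = (x0 - x) - (t *: (y - x)) - w t.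
    by rewrite /w; apply/rowP => k; rewrite !mxE; ring.
  rewrite (le_trans (ler_normB _ _))//.
  have ty : `|t *: (y - x)| <= 3 * (2 * e).
    rewrite normrZ; apply: ler_pM => //.
    by rewrite ler_norml; lra.
  have := ler_normB (x0 - x) (t *: (y - x)).
  by move: ty h2 (ltW xe); lra.
pose th := clamp (-2 : R) 3.
have thI t : -2 <= th t <= 3 by apply: clamp_in; lra.
have inr f t : continuous f -> (forall t, `|f t| <= e) -> ball x0 r (U f (th t)).
  move=> cf fe; apply/ballE_norm; have [h _] := bnd f cf fe _ (thI t).
  exact: le_lt_trans er.
(* Clamping the time makes Phi f bounded and continuous on the whole line. *)
pose Phi f t := Q (U f (th t)) (V f (th t)).
have v2 f t : continuous f -> (forall t, `|f t| <= e) -> `|V f (th t)| ^+ 2 <= 25 * e ^+ 2.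
  move=> cf fe; have [_ h] := bnd f cf fe _ (thI t).
  have -> : 25 * e ^+ 2 = (5 * e) ^+ 2 by ring.
  by rewrite ler_pXn2r ?nnegrE// mulr_ge0// ltW.
have Cee : C * e ^+ 2 * 510 <= e.
  have -> : C * e ^+ 2 * 510 = 510 * (C * e) * e by ring.
  by rewrite ger_pMl.
have [|f f1 f2|f g d cf fe cg ge fg t|f [cf fe fP]] := @bounded_contraction Phi e.
- exact: ltW.
- have [U0 U1 dUV] := UV f f1.
  split=> t; last first.
    rewrite (le_trans (Qb _ _ (inr f t f1 f2)))//.
    have := ler_wpM2l (ltW C0) (v2 f t f1 f2).
    have : 0 <= C * e ^+ 2 by rewrite mulr_ge0 ?exprn_ge0 ?ltW.
    lra.
  have cU s : -2 <= s <= 3 -> {for s, continuous (U f)}.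
    by move=> sI; have [|d _] := dUV s; [lra|exact: is_derive_continuous d].
  have cV s : -2 <= s <= 3 -> {for s, continuous (V f)}.
    by move=> sI; have [|_ d] := dUV s; [lra|exact: is_derive_continuous d].
  have c23 : (-2 : R) <= 3 by lra.
  have cUt := @clamp_comp_continuous R _ (U f) (-2) 3 c23 cU t.
  have cVt := @clamp_comp_continuous R _ (V f) (-2) 3 c23 cV t.
  apply: continuous_of_dist => d d0.
  pose d' := d / (C * (25 * e ^+ 2 + 10 * e)).
  have den : 0 < C * (25 * e ^+ 2 + 10 * e).
    by rewrite mulr_gt0// addr_gt0// mulr_gt0// exprn_gt0.
  have d'0 : 0 < d' by rewrite divr_gt0.
  apply: filterS2 (continuous_near_dist cUt d'0) (continuous_near_dist cVt d'0) => s us vs.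
  rewrite (le_trans (Ql _ _ _ _ (inr f t f1 f2) (inr f s f1 f2)))//.
  have [_ v5t] := bnd f f1 f2 _ (thI t); have [_ v5s] := bnd f f1 f2 _ (thI s).
  have -> : d = C * (d' * (25 * e ^+ 2) + d' * (5 * e + 5 * e)).
    have <- : d' * (C * (25 * e ^+ 2 + 10 * e)) = d by rewrite divfK// gt_eqF.
    by ring.
  rewrite ler_wpM2l ?(ltW C0)//; apply: lerD; apply: ler_pM;
    by [exact: normr_ge0|exact: exprn_ge0|exact: addr_ge0|exact: ltW|exact: v2|exact: lerD].
- have [U0 U1 dUV] := UV f cf; have [U0' U1' dUV'] := UV g cg.
  have [||s sI|h1 h2] := @two_point_bound (fun s => U f s - U g s) (fun s => V f s - V g s) (fun s => f s - g s) d _ _ _ fg (th t) (thI t).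
  + by rewrite U0 U0' subrr.
  + by rewrite U1 U1' subrr.
  + have [d1 d2] : is_derive s 1 (U f) (V f s) /\ is_derive s 1 (V f) (f s) by apply: dUV; lra.
    have [d3 d4] : is_derive s 1 (U g) (V g s) /\ is_derive s 1 (V g) (g s) by apply: dUV'; lra.
    by split; apply: is_deriveB.
  rewrite (le_trans (Ql _ _ _ _ (inr f t cf fe) (inr g t cg ge)))//.
  have d0 : 0 <= d by exact: le_trans (fg 0).
  have [_ v5t] := bnd f cf fe _ (thI t); have [_ v5s] := bnd g cg ge _ (thI t).
  apply: (@le_trans _ _ (C * (9 * d * (25 * e ^+ 2) + 3 * d * (5 * e + 5 * e)))).
    rewrite ler_wpM2l ?(ltW C0)//; apply: lerD; apply: ler_pM;
      by [exact: normr_ge0|exact: exprn_ge0|exact: addr_ge0|exact: v2|exact: lerD|].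
  have e2 : e ^+ 2 <= e by rewrite expr2 ger_pMl.
  have : C * d * e ^+ 2 <= C * d * e by rewrite ler_wpM2l// mulr_ge0// ltW.
  have : (510 * (C * e)) * d <= 1 * d by rewrite ler_wpM2r.
  lra.
have [U0 U1 dUV] := UV f cf.
exists (U f), (V f); split=> // t tI.
have [d1 d2] : is_derive t 1 (U f) (V f t) /\ is_derive t 1 (V f) (f t) by apply: dUV; lra.
have [b1 b2] := bnd f cf fe t tI.
split; [exact: d1| |exact: b1|exact: b2].
have := fP t; rewrite /Phi /th clamp_id// => ->; exact: d2.
Qed.

End BoundaryValueProblem.

(** * The geodesic equation *)

Section DerivativeTools.
Context {R : realType}.

Lemma is_derive_sumf (V : normedModType R) (I : Type) (s : seq I) (f : I -> R -> V) (d : I -> V) (t : R) :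
  (forall i, is_derive t 1 (f i) (d i)) ->
  is_derive t 1 (fun x => \sum_(i <- s) f i x) (\sum_(i <- s) d i).
Proof.
move=> H; elim: s => [|i s IH].
  have -> : (fun x => \sum_(i <- [::]) f i x) = cst 0 by apply/funext => x; rewrite big_nil.
  rewrite big_nil; exact: is_derive_cst.
have -> : (fun x => \sum_(j <- i :: s) f j x) = f i + (fun x => \sum_(j <- s) f j x).
  by apply/funext => x; rewrite big_cons.
by rewrite big_cons; exact: (is_deriveD (H i) IH).
Qed.

Lemma is_derive_reparam (V : normedModType R) (f : R -> V) (tau : R -> R) (t e : R) (d : V) :
  is_derive (tau t) 1 f d -> is_derive t 1 tau e -> is_derive t 1 (f \o tau) (e *: d).
Proof.
move=> [df df2] [da da2].
have dfd : differentiable f (tau t) by apply/derivable1_diffP.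
have dad : differentiable tau t by apply/derivable1_diffP.
have dc : differentiable (f \o tau) t by exact: differentiable_comp.
apply: DeriveDef; first exact/derivable1_diffP.
rewrite deriveE// (diff_comp dad dfd) -[LHS]/('d f (tau t) ('d tau t 1)).
have -> : 'd tau t 1 = e *: (1 : R) by rewrite -deriveE// da2 -[RHS]/(e * 1) mulr1.
by rewrite linearZ/= -deriveE// df2.
Qed.

Lemma is_deriveMr (f g : R -> R) (t df dg : R) : is_derive t 1 f df -> is_derive t 1 g dg ->
  is_derive t 1 (fun x => f x * g x) (df * g t + f t * dg).
Proof.
move=> hf hg; have := is_deriveM hf hg.
by rewrite addrC; congr is_derive; rewrite mulrC.
Qed.

Lemma is_deriveDr (f g : R -> R) (t df dg : R) : is_derive t 1 f df -> is_derive t 1 g dg ->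
  is_derive t 1 (fun x => f x + g x) (df + dg).
Proof. exact: is_deriveD. Qed.

Lemma continuous_subr (T : topologicalType) (f g : T -> R) x :
  {for x, continuous f} -> {for x, continuous g} -> {for x, continuous (fun y => f y - g y)}.
Proof. by move=> cf cg; apply: cvgB. Qed.

Lemma le_of_forall_eps (X Y k : R) : (forall e, 0 < e -> X <= Y + e * k) -> X <= Y.
Proof.
move=> H; apply/ler_addgt0Pr => e e0.
have k0 : 0 < `|k| + 1 by rewrite ltr_wpDl.
have := H _ (divr_gt0 e0 k0) => /le_trans; apply; rewrite lerD2l.
apply: (@le_trans _ _ (e / (`|k| + 1) * (`|k| + 1))); last by rewrite divfK// gt_eqF.
rewrite ler_wpM2l ?divr_ge0 ?(ltW e0) ?(ltW k0)//.
by apply: (le_trans (ler_norm k)); rewrite lerDl.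
Qed.

End DerivativeTools.

Section GeodesicEquation.
Context {R : realType} {n : nat} {M : riemannianManifold R n}.
Implicit Types (c : chart R n M) (x w : 'rV[R]_n).

Definition metric_partial c x (l a b : 'I_n) : R := partial l (fun y => metric c y a b) x.

Definition geodesic_acc c x w : 'rV[R]_n :=
  \row_k - \sum_a \sum_b christoffel c x k a b * w 0 a * w 0 b.

(** Lowering the upper index removes the inverse metric. *)
Lemma christoffel_lower c x l a b : atlas c -> im c x ->
  \sum_k metric c x l k * christoffel c x k a b =
  2^-1 * (metric_partial c x a b l + metric_partial c x b a l - metric_partial c x l a b).
Proof.
move=> ac cx; set X := fun l => metric_partial c x a b l + metric_partial c x b a l - metric_partial c x l a b.
transitivity (2^-1 * \sum_m (metric c x *m invmx (metric c x)) l m * X m).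
  rewrite mulr_sumr; under [RHS]eq_bigr do rewrite mxE mulr_suml mulr_sumr.
  rewrite exchange_big; apply: eq_bigr => k _ /=.
  rewrite /christoffel mulrCA mulr_sumr mulr_sumr; apply: eq_bigr => m _.
  by rewrite /X /metric_partial !mulrA.
rewrite mulmxV ?metric_unit//; congr (_ * _).
rewrite (bigD1 l)//= big1 ?addr0 ?mxE ?eqxx ?mul1r// => m ml.
by rewrite mxE eq_sym (negbTE ml) mul0r.
Qed.

Lemma geodesic_acc_lower c x w l : atlas c -> im c x ->
  \sum_k metric c x l k * geodesic_acc c x w 0 k =
  - (\sum_a \sum_b metric_partial c x a b l * w 0 a * w 0 b) +
  2^-1 * \sum_a \sum_b metric_partial c x l a b * w 0 a * w 0 b.
Proof.
move=> ac cx.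
transitivity (- \sum_a \sum_b (\sum_k metric c x l k * christoffel c x k a b) * w 0 a * w 0 b).
  rewrite -sumrN.
  transitivity (\sum_k \sum_a \sum_b - (metric c x l k * christoffel c x k a b * w 0 a * w 0 b)).
    apply: eq_bigr => k _; rewrite mxE mulrN mulr_sumr -sumrN; apply: eq_bigr => a _.
    by rewrite mulr_sumr -sumrN; apply: eq_bigr => b _; rewrite !mulrA.
  rewrite exchange_big; apply: eq_bigr => a _; rewrite exchange_big -sumrN.
  apply: eq_bigr => b _; rewrite -mulrA mulr_suml -sumrN; apply: eq_bigr => k _.
  by rewrite !mulrA.
transitivity (- (2^-1 * (\sum_a \sum_b metric_partial c x a b l * w 0 a * w 0 b +
   \sum_a \sum_b metric_partial c x b a l * w 0 a * w 0 b -
   \sum_a \sum_b metric_partial c x l a b * w 0 a * w 0 b))).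
  congr (- _); rewrite -big_split/= -sumrB mulr_sumr; apply: eq_bigr => a _.
  rewrite -big_split/= -sumrB mulr_sumr; apply: eq_bigr => b _.
  by rewrite christoffel_lower//; ring.
rewrite [X in _ + X - _]exchange_big/=.
under [X in _ + X - _]eq_bigr do under eq_bigr do rewrite mulrAC.
by field.
Qed.

Context (c : chart R n M) (u v : R -> 'rV[R]_n) (t : R).

(** The covector dual to the velocity. *)
Definition momentum (s : R) l : R := \sum_k v s 0 k * metric c (u s) k l.

Lemma innerE_momentum w s : inner c (u s) (v s) w = \sum_l momentum s l * w 0 l.
Proof. by rewrite innerE. Qed.

Context (ac : atlas c) (cu : im c (u t)) (du : is_derive t 1 u (v t))
  (dv : is_derive t 1 v (geodesic_acc c (u t) (v t))).

Lemma metric_along a b :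
  is_derive t 1 (fun s => metric c (u s) a b) (\sum_l v t 0 l * metric_partial c (u t) l a b).
Proof.
exact: (Ck1_is_derive_comp (@im_open _ _ _ c) (metric_entry_Ck 1 a b ac) cu du).
Qed.

Lemma velocity_along k : is_derive t 1 (fun s => v s 0 k) (geodesic_acc c (u t) (v t) 0 k).
Proof. by move/is_derive_rVP : dv; apply. Qed.

Lemma metric_entry_sym a b : metric c (u t) a b = metric c (u t) b a.
Proof. by rewrite -{1}(metric_sym ac cu) mxE. Qed.

(** The Euler-Lagrange form of the geodesic equation. *)
Lemma momentum_derive l :
  is_derive t 1 (momentum ^~ l) (2^-1 * \sum_a \sum_b metric_partial c (u t) l a b * v t 0 a * v t 0 b).
Proof.
have := is_derive_sumf (index_enum 'I_n) (fun k => is_deriveMr (velocity_along k) (metric_along k l)).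
move=> h; refine (@is_derive_eq _ _ _ _ _ _ _ _ h _); clear h; rewrite big_split/=.
have -> : \sum_k geodesic_acc c (u t) (v t) 0 k * metric c (u t) k l =
          \sum_k metric c (u t) l k * geodesic_acc c (u t) (v t) 0 k.
  by apply: eq_bigr => k _; rewrite mulrC metric_entry_sym.
rewrite geodesic_acc_lower// addrAC -[RHS]add0r; congr (_ + _).
apply/eqP; rewrite addrC subr_eq0; apply/eqP.
rewrite exchange_big/=; apply: eq_bigr => k _; rewrite mulr_sumr; apply: eq_bigr => a _.
by ring.
Qed.

(** Conservation of energy, by cancellation of the three terms in the derivatives of
    the metric. *)
Lemma energy_derive : is_derive t 1 (fun s => inner c (u s) (v s) (v s)) 0.
Proof.
have -> : (fun s => inner c (u s) (v s) (v s)) = (fun s => \sum_l momentum s l * v s 0 l).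
  by apply/funext => s; rewrite innerE_momentum.
have := is_derive_sumf (index_enum 'I_n) (fun l => is_deriveMr (momentum_derive l) (velocity_along l)).
move=> h; refine (@is_derive_eq _ _ _ _ _ _ _ _ h _); clear h; rewrite big_split/=.
set T := \sum_l v t 0 l * \sum_a \sum_b metric_partial c (u t) l a b * v t 0 a * v t 0 b.
have -> : \sum_l 2^-1 * (\sum_a \sum_b metric_partial c (u t) l a b * v t 0 a * v t 0 b) * v t 0 l = 2^-1 * T.
  by rewrite mulr_sumr; apply: eq_bigr => l _; rewrite -mulrA; congr (_ * _); rewrite mulrC.
have -> : \sum_l momentum t l * geodesic_acc c (u t) (v t) 0 l =
   \sum_k v t 0 k * \sum_l metric c (u t) k l * geodesic_acc c (u t) (v t) 0 l.
  rewrite /momentum; under eq_bigr do rewrite mulr_suml.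
  rewrite exchange_big/=; apply: eq_bigr => k _; rewrite mulr_sumr; apply: eq_bigr => l _.
  by rewrite mulrA.
under [X in _ + X]eq_bigr do rewrite geodesic_acc_lower// mulrDr mulrN mulrCA.
rewrite big_split/= sumrN -mulr_sumr -/T.
have -> : \sum_k v t 0 k * (\sum_a \sum_b metric_partial c (u t) a b k * v t 0 a * v t 0 b) = T.
  under eq_bigr do rewrite mulr_sumr; rewrite exchange_big/= /T; apply: eq_bigr => l _.
  rewrite mulr_sumr; under eq_bigr do rewrite mulr_sumr.
  rewrite exchange_big/=; apply: eq_bigr => a _; rewrite mulr_sumr; apply: eq_bigr => b _.
  by ring.
by field.
Qed.

End GeodesicEquation.

(** * Calibrations *)

Section PointwiseCalibration.
Context {R : realType} {n : nat} {M : riemannianManifold R n}.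
Implicit Types (c : chart R n M) (x y v w : 'rV[R]_n).

Lemma bilinear_bound (f : 'I_n -> 'I_n -> R) (E : R) v w : 0 <= E ->
  (forall a b, `|f a b| <= E) ->
  `|\sum_a \sum_b f a b * v 0 a * w 0 b| <= n%:R ^+ 2 * E * `|v| * `|w|.
Proof.
move=> E0 H.
apply: (@le_trans _ _ (\sum_(a < n) \sum_(b < n) E * `|v| * `|w|)).
  apply: (le_trans (ler_norm_sum _ _ _)); apply: ler_sum => a _.
  apply: (le_trans (ler_norm_sum _ _ _)); apply: ler_sum => b _.
  rewrite !normrM ler_pM ?mulr_ge0//; last exact: mx_entry_norm.
  by rewrite ler_pM//; exact: mx_entry_norm.
rewrite sumr_const card_ord sumr_const card_ord.
rewrite -[E * _ * _ *+ n]mulr_natl -[_ *+ n]mulr_natl.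
by rewrite !mulrA -expr2.
Qed.

Lemma inner_sum c x v w : inner c x v w = \sum_a \sum_b metric c x a b * v 0 a * w 0 b.
Proof.
rewrite innerE exchange_big; apply: eq_bigr => b _; rewrite mulr_suml.
by apply: eq_bigr => a _; congr (_ * _); rewrite mulrC.
Qed.

Lemma norm_sq_le_sum (v : 'rV[R]_n) : `|v| ^+ 2 <= \sum_l v 0 l ^+ 2.
Proof.
have S0 : 0 <= \sum_l v 0 l ^+ 2 by apply: sumr_ge0 => l _; exact: sqr_ge0.
rewrite -[leRHS]sqr_sqrtr// lerXn2r ?nnegrE ?sqrtr_ge0//.
apply: rV_norm_le; first exact: sqrtr_ge0.
move=> j; rewrite -sqrtr_sqr ler_wsqrtr// (bigD1 j)//= lerDl.
by apply: sumr_ge0 => l _; exact: sqr_ge0.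
Qed.

Lemma dot_bound (v w : 'rV[R]_n) : `|\sum_l v 0 l * w 0 l| <= n%:R * `|v| * `|w|.
Proof.
apply: (@le_trans _ _ (\sum_(a < n) `|v| * `|w|)).
  apply: (le_trans (ler_norm_sum _ _ _)); apply: ler_sum => a _.
  by rewrite normrM ler_pM//; exact: mx_entry_norm.
by rewrite sumr_const card_ord -[_ * _ *+ n]mulr_natl mulrA.
Qed.

(** The estimate behind calibration_pointwise: h, o and k stand for the norms of
    y - x, w - v and v. The errors of the Taylor expansions of the metric are absorbed by
    theta h^2 and by the lower bound o^2 / B of the metric, the remaining quadratic form
    in h and o being theta / 2 times (h - 8 N1 o)^2. *)
Lemma calibration_scalar (N N1 B k kappa theta h o S sq cr phi T1 T2 Dvv Dvo I : R) :
  0 <= N -> N <= N1 -> 1 <= N1 -> 0 < B -> 0 <= k -> k <= kappa -> 0 < theta ->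
  0 <= h -> 0 <= o ->
  32 * (N1 ^+ 2 * B * theta) <= 1 -> N1 ^+ 3 * B * kappa <= theta -> 2 * (N1 * kappa) <= 1 ->
  `|phi| <= 3 * theta -> h ^+ 2 <= sq -> `|cr| <= N * h * o -> o ^+ 2 <= B * I ->
  `|Dvv - T1| <= N ^+ 2 * (N * (N * B) * h ^+ 2) * k * k ->
  `|Dvo| <= N ^+ 2 * (N * B * h) * k * o ->
  T1 + 2 * T2 - theta * sq + 2 * phi * cr <= Dvv + 2 * T2 + 2 * Dvo + I.
Proof.
move=> N0 NN N11 B0 k0 kk th0 h0 o0 H1 H2 H3 Hphi Hsq Hcr HI HD HDo.
have N10 : 0 <= N1 by exact: le_trans NN.
have I0 : 0 <= I by rewrite -(pmulr_rge0 _ B0) (le_trans _ HI)// sqr_ge0.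
have Ha : N ^+ 3 * B * k <= theta.
  apply: le_trans H2; rewrite ler_pM// ?mulr_ge0 ?exprn_ge0 ?(ltW B0)//.
  by rewrite ler_wpM2r ?(ltW B0)// lerXn2r.
have Hb : N * k <= 2^-1.
  have : N * k <= N1 * kappa by rewrite ler_pM.
  by lra.
have a0 : 0 <= N ^+ 3 * B * k by rewrite !mulr_ge0 ?exprn_ge0 ?(ltW B0).
have b0 : 0 <= N * k by rewrite mulr_ge0.
have {HD}HD : `|Dvv - T1| <= theta * 2^-1 * h ^+ 2.
  apply: (le_trans HD).
  have -> : N ^+ 2 * (N * (N * B) * h ^+ 2) * k * k = (N ^+ 3 * B * k) * (N * k) * h ^+ 2 by ring.
  by rewrite ler_wpM2r ?sqr_ge0// ler_pM.
have {HDo}HDo : `|Dvo| <= theta * (h * o).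
  apply: (le_trans HDo).
  have -> : N ^+ 2 * (N * B * h) * k * o = (N ^+ 3 * B * k) * (h * o) by ring.
  by rewrite ler_wpM2r ?mulr_ge0.
set m := N1 * o; have om : o <= m by rewrite /m ler_peMl.
have hm : h * o <= h * m by rewrite ler_wpM2l.
have Hpc : `|phi * cr| <= 3 * (theta * (h * m)).
  rewrite normrM; apply: (@le_trans _ _ ((3 * theta) * (N * h * o))); first by rewrite ler_pM.
  have -> : 3 * theta * (N * h * o) = 3 * (theta * (h * (N * o))) by ring.
  rewrite ler_pM2l// ler_wpM2l ?(ltW th0)// ler_wpM2l// /m.
  by rewrite ler_wpM2r.
have HI2 : 32 * (theta * m ^+ 2) <= I.
  apply: (@le_trans _ _ (32 * (N1 ^+ 2 * theta) * (B * I))).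
    have -> : 32 * (theta * m ^+ 2) = 32 * (N1 ^+ 2 * theta) * o ^+ 2 by rewrite /m; ring.
    by rewrite ler_wpM2l// !mulr_ge0 ?sqr_ge0 ?(ltW th0).
  have -> : 32 * (N1 ^+ 2 * theta) * (B * I) = 32 * (N1 ^+ 2 * B * theta) * I by ring.
  by rewrite ler_piMl.
have Hs : theta * h ^+ 2 <= theta * sq by rewrite ler_wpM2l// (ltW th0).
have Hq : 0 <= theta * (h - 8 * m) ^+ 2 by rewrite mulr_ge0 ?sqr_ge0 ?(ltW th0).
have Hho : theta * (h * o) <= theta * (h * m) by rewrite ler_wpM2l// (ltW th0).
have Hq2 : theta * (h - 8 * m) ^+ 2 = theta * h ^+ 2 - 16 * (theta * (h * m)) + 64 * (theta * m ^+ 2) by ring.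
move: HD HDo Hpc; rewrite !ler_norml => /andP[D1 D2] /andP[E1 E2] /andP[F1 F2].
rewrite Hq2 in Hq.
have -> : 2 * phi * cr = 2 * (phi * cr) by rewrite mulrA.
have D1' : T1 - 2^-1 * (theta * h ^+ 2) <= Dvv.
  have E : theta * 2^-1 * h ^+ 2 = 2^-1 * (theta * h ^+ 2) by ring.
  by rewrite E in D1; move: D1; clear; lra.
move: D1' E1 F2 HI2 Hs Hq Hho; clear.
move: (theta * (h * o)) (theta * (h * m)) (theta * h ^+ 2) (theta * m ^+ 2) (theta * sq) (phi * cr).
move=> X1 X2 X3 X4 X5 X6 *.

lra.
Qed.

Lemma metric_lipschitz c x0 r B x y a b : chart_bounds c x0 r B -> 0 < B ->
  ball x0 r x -> ball x0 r y ->
  `|metric c y a b - metric c x a b| <= n%:R * B * `|y - x|.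
Proof.
move=> H B0 xr yr.
apply: (partial_lipschitz (f := fun z => metric c z a b) (ltW B0) _ xr yr) => w wr i.
by have [_ _ /(_ a b)[_ /(_ i)]] := H _ wr.
Qed.

Lemma metric_taylor c x0 r B x y a b : chart_bounds c x0 r B -> 0 < B ->
  ball x0 (r / 3) x -> ball x0 (r / 3) y ->
  `|metric c y a b - metric c x a b - \sum_l (y - x) 0 l * metric_partial c x l a b|
    <= n%:R * (n%:R * B) * `|y - x| ^+ 2.
Proof.
move=> H B0 xr yr.
apply: (taylor2_bound (f := fun z => metric c z a b) (ltW B0) _ xr yr) => w wr i.
have [_ _ /(_ a b)[_ /(_ i)[Hd _]] H4 _] := H _ wr.
by split=> [//|j]; have [_ /(_ j)] := H4 a b i.
Qed.

(** The energy of w at y dominates that of v at x up to the first order terms of its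
    Taylor expansion, corrected by the quadratic terms with theta and phi. *)
Lemma calibration_pointwise c x0 r B kappa theta phi x y v w : atlas c ->
  0 < B -> chart_bounds c x0 r B -> 0 < r -> ball x0 (r / 3) x -> ball x0 (r / 3) y ->
  `|v| <= kappa -> 0 < theta -> `|phi| <= 3 * theta ->
  32 * ((n%:R + 1) ^+ 2 * B * theta) <= 1 -> (n%:R + 1) ^+ 3 * B * kappa <= theta ->
  2 * ((n%:R + 1) * kappa) <= 1 ->
  \sum_l (\sum_a \sum_b metric_partial c x l a b * v 0 a * v 0 b) * (y - x) 0 l
  + 2 * (\sum_l (\sum_k v 0 k * metric c x k l) * (w - v) 0 l)
  - theta * (\sum_l (y - x) 0 l ^+ 2) + 2 * phi * (\sum_l (y - x) 0 l * (w - v) 0 l)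
  <= inner c y w w - inner c x v v.
Proof.
move=> ac B0 H r0 xr yr vk th0 hphi H1 H2 H3.
have r3 : r / 3 <= r by rewrite ler_piMr ?(ltW r0)// invf_le1// ler1n.
have xr' : ball x0 r x by apply: le_ball xr.
have yr' : ball x0 r y by apply: le_ball yr.
have [yc HB _ _ _] := H _ yr'; have [xc _ _ _ _] := H _ xr'.
set o := w - v; set e := y - x.
set D := fun u z : 'rV[R]_n => \sum_a \sum_b (metric c y a b - metric c x a b) * u 0 a * z 0 b.
have HDD u z : D u z = inner c y u z - inner c x u z.
  rewrite /D !inner_sum -sumrB; apply: eq_bigr => a _; rewrite -sumrB.
  by apply: eq_bigr => b _; ring.
have -> : inner c y w w - inner c x v v =
    D v v + 2 * inner c x v o + 2 * D v o + inner c y o o.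
  have -> : w = v + o by rewrite /o addrC subrK.
  rewrite !HDD !(@innerDl _ _ _ c y v o) !(@innerDr _ _ _ c y _ v o) (innerC o v ac yc); ring.
rewrite -innerE.
apply: (@calibration_scalar n%:R (n%:R + 1) B `|v| kappa theta `|e| `|o|) => //.
- by rewrite lerDl.
- by rewrite lerDr.
- exact: norm_sq_le_sum.
- exact: dot_bound.
- have -> : D v v - \sum_l (\sum_a \sum_b metric_partial c x l a b * v 0 a * v 0 b) * e 0 l =
    \sum_a \sum_b (metric c y a b - metric c x a b - \sum_l e 0 l * metric_partial c x l a b) * v 0 a * v 0 b.
    under [X in _ - X = _]eq_bigr do rewrite mulr_suml.
    rewrite exchange_big/= /D -sumrB; apply: eq_bigr => a _.
    under [X in _ - X = _]eq_bigr do rewrite mulr_suml.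
    rewrite exchange_big/= -sumrB; apply: eq_bigr => b _.
    rewrite !mulrBl; congr (_ - _); rewrite -mulrA mulr_suml; apply: eq_bigr => l _; ring.
  apply: bilinear_bound; last by move=> a b; exact: (metric_taylor a b H B0 xr yr).
  by rewrite !mulr_ge0 ?(ltW B0)// exprn_ge0.
- apply: bilinear_bound; last by move=> a b; exact: (metric_lipschitz a b H B0 xr' yr').
  by rewrite !mulr_ge0 ?(ltW B0).
Qed.

End PointwiseCalibration.

Section Calibration.
Context {R : realType} {n : nat} {M : riemannianManifold R n}.
Implicit Types (g : R -> M).
Context (c : chart R n M) (ac : atlas c) (x0 : 'rV[R]_n) (r B kappa theta : R).
Context (u v : R -> 'rV[R]_n).

(** A solution of the geodesic equation in a coordinate ball, so slow (kappa) that the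
    quadratic form of calibration_scalar is nonnegative. *)
Definition calibrating_geodesic :=
  [/\ 0 < r, 0 < B, chart_bounds c x0 r B, 0 < theta &
  [/\ 32 * ((n%:R + 1) ^+ 2 * B * theta) <= 1, (n%:R + 1) ^+ 3 * B * kappa <= theta,
      2 * ((n%:R + 1) * kappa) <= 1 &
      forall t : R, -2 <= t <= 3 -> [/\ is_derive t 1 u (v t),
        is_derive t 1 v (geodesic_acc c (u t) (v t)), ball x0 (r / 3) (u t) & `|v t| <= kappa]]].

(** A function of time and position that vanishes along the geodesic u, and whose
    derivative in the direction y there is twice the momentum, as for the solutions of the
    Hamilton-Jacobi equation used in the calculus of variations. The quadratic term, whose
    coefficient decreases in time, turns the Hamilton-Jacobi equation into the strict
    inequality of calibration_inner, which is stable under all errors of second order. *)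
Definition calibration (alpha t : R) (y : 'rV[R]_n) : R :=
  2 * (\sum_l momentum c u v t l * (y - u t) 0 l) +
  (alpha - theta * t) * \sum_l (y - u t) 0 l ^+ 2.

Context (cg : calibrating_geodesic).

Let chart_ball y : ball x0 (r / 3) y -> im c y.
Proof.
case: cg => r0 _ H _ _ yr.
have r3 : r / 3 <= r by rewrite ler_piMr ?(ltW r0)// invf_le1// ler1n.
by have [] := H _ (le_ball r3 yr).
Qed.

Lemma energy_constant t : -2 <= t <= 3 ->
  inner c (u t) (v t) (v t) = inner c (u 0) (v 0) (v 0).
Proof.
case: cg => r0 B0 H th0 [_ _ _ Hg] t3.
have HD : forall s : R, -2 <= s <= 3 -> is_derive s 1 (fun s => inner c (u s) (v s) (v s)) 0.
  move=> s s3; have [du dv bu _] := Hg _ s3.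
  exact: (energy_derive ac (chart_ball bu) du dv).
have HC s : -2 <= s <= 3 -> {for s, continuous (fun s => inner c (u s) (v s) (v s))}.
  by move=> s3; exact: is_derive_continuous (HD _ s3).
have K a b : -2 <= a -> a <= b -> b <= 3 ->
    inner c (u a) (v a) (v a) = inner c (u b) (v b) (v b).
  move=> a3 ab b3; apply: (@constant_off_finite R [::] (fun s => inner c (u s) (v s) (v s)) a b ab).
    by move=> s /andP[sa sb]; apply: HC; rewrite (le_trans a3 sa) (le_trans sb b3).
  move=> s /andP[sa sb] _; apply: HD.
  by rewrite (le_trans a3 (ltW sa)) (le_trans (ltW sb) b3).
case/andP: t3 => t1 t2; have [t0|t0] := leP t 0; first by apply: K => //; lra.
by symmetry; apply: K => //; lra.
Qed.

Lemma calibration_derive alpha (tau : R -> R) (Y : R -> 'rV[R]_n) (s e : R) w :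
  -2 <= tau s <= 3 -> is_derive s 1 tau e -> is_derive s 1 Y (e *: w) ->
  is_derive s 1 (fun s => calibration alpha (tau s) (Y s))
   (e * (\sum_l (\sum_a \sum_b metric_partial c (u (tau s)) l a b * v (tau s) 0 a * v (tau s) 0 b)
          * (Y s - u (tau s)) 0 l
     + 2 * (\sum_l momentum c u v (tau s) l * (w - v (tau s)) 0 l)
     - theta * (\sum_l (Y s - u (tau s)) 0 l ^+ 2)
     + 2 * (alpha - theta * tau s) * (\sum_l (Y s - u (tau s)) 0 l * (w - v (tau s)) 0 l))).
Proof.
case: cg => r0 B0 H th0 [_ _ _ Hg] t3 dtau dY.
have [du dv bu _] := Hg _ t3.
have dm l := is_derive_reparam (momentum_derive ac (chart_ball bu) du dv l) dtau.
have deta : is_derive s 1 (fun s => Y s - u (tau s)) (e *: (w - v (tau s))).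
  by rewrite scalerBr; exact: (is_deriveB dY (is_derive_reparam du dtau)).
have dl l : is_derive s 1 (fun s => (Y s - u (tau s)) 0 l) ((e *: (w - v (tau s))) 0 l).
  by move/is_derive_rVP : deta; apply.
have d1 := is_derive_sumf (index_enum 'I_n) (fun l => is_deriveMr (dm l) (dl l)).
have d2 := is_derive_sumf (index_enum 'I_n) (fun l => is_deriveMr (dl l) (dl l)).
have dphi : is_derive s 1 (fun s => alpha - theta * tau s) (- (theta * e)).
  have := is_deriveB (is_derive_cst alpha s 1) (is_deriveMr (is_derive_cst theta s 1) dtau).
  by move=> h; refine (@is_derive_eq _ _ _ _ _ _ _ _ h _); rewrite mul0r !add0r.
have d3 := is_deriveDr (is_deriveMr (is_derive_cst (2 : R) s 1) d1) (is_deriveMr dphi d2).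
have E : (fun s => calibration alpha (tau s) (Y s)) =
  (fun x => 2 * (\sum_l (momentum c u v ^~ l \o tau) x * (Y x - u (tau x)) 0 l) +
   (alpha - theta * tau x) * (\sum_l (Y x - u (tau x)) 0 l * (Y x - u (tau x)) 0 l)).
  apply/funext => x; rewrite /calibration.
  have -> // : \sum_l (Y x - u (tau x)) 0 l ^+ 2 = \sum_l (Y x - u (tau x)) 0 l * (Y x - u (tau x)) 0 l.
  by apply: eq_bigr => l _; rewrite expr2.
rewrite E; refine (@is_derive_eq _ _ _ _ _ _ _ _ d3 _); clear.
set eta := Y s - u (tau s); set o := w - v (tau s); set p := momentum c u v.
set q := fun l => \sum_a \sum_b metric_partial c (u (tau s)) l a b * v (tau s) 0 a * v (tau s) 0 b.
rewrite -[\sum_l _ * eta 0 l]/(\sum_l q l * eta 0 l) /=.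
have hZ l : (e *: o) 0 l = e * o 0 l by rewrite [LHS]mxE.
have -> : \sum_l ((e *: (2^-1 * q l)) * eta 0 l + p (tau s) l * (e *: o) 0 l) =
   e * (2^-1 * (\sum_l q l * eta 0 l) + \sum_l p (tau s) l * o 0 l).
  rewrite mulr_sumr -big_split mulr_sumr; apply: eq_bigr => l _ /=.
  by rewrite hZ -[e *: (2^-1 * q l)]/(e * (2^-1 * q l)); ring.
have -> : \sum_l ((e *: o) 0 l * eta 0 l + eta 0 l * (e *: o) 0 l) =
   e * (2 * \sum_l eta 0 l * o 0 l).
  rewrite mulr_sumr mulr_sumr; apply: eq_bigr => l _ /=.
  by rewrite hZ; ring.
have -> : \sum_l eta 0 l * eta 0 l = \sum_l eta 0 l ^+ 2.
  by apply: eq_bigr => l _; rewrite expr2.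
by field.
Qed.
Lemma calibration_continuous alpha (tau : R -> R) (Y : R -> 'rV[R]_n) (s : R) :
  -2 <= tau s <= 3 -> {for s, continuous tau} -> {for s, continuous Y} ->
  {for s, continuous (fun s => calibration alpha (tau s) (Y s))}.
Proof.
case: cg => r0 B0 H th0 [_ _ _ Hg] t3 ct cY.
have [du dv bu _] := Hg _ t3.
have cm l : {for s, continuous (fun s => momentum c u v (tau s) l)}.
  have h := is_derive_continuous (momentum_derive ac (chart_ball bu) du dv l).
  exact: (continuous_comp ct h).
have cu : {for s, continuous (fun s => u (tau s))}.
  exact: (continuous_comp ct (is_derive_continuous du)).
have ce l : {for s, continuous (fun s => (Y s - u (tau s)) 0 l)}.
  by move: l; apply/continuous_rVP; exact: (cvgB cY cu).
apply: continuous_addr.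
  apply: continuous_mulr; first exact: continuous_cst.
  by apply: continuous_sumr => l; apply: continuous_mulr.
apply: continuous_mulr; last first.
  by apply: continuous_sumr => l; apply: continuous_mulr.
by apply: cvgB; [exact: continuous_cst|apply: continuous_mulr; [exact: continuous_cst|]].
Qed.

(** The derivative of the calibration along (1, w) is at most the energy of w,
    up to the energy of the geodesic. *)
Lemma calibration_inner alpha (t : R) y w : 0 <= alpha <= theta -> -2 <= t <= 3 ->
  ball x0 (r / 3) y ->
  \sum_l (\sum_a \sum_b metric_partial c (u t) l a b * v t 0 a * v t 0 b) * (y - u t) 0 l
  + 2 * (\sum_l momentum c u v t l * (w - v t) 0 l)
  - theta * (\sum_l (y - u t) 0 l ^+ 2)
  + 2 * (alpha - theta * t) * (\sum_l (y - u t) 0 l * (w - v t) 0 l)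
  <= inner c y w w - inner c (u 0) (v 0) (v 0).
Proof.
move=> /andP[a0 a1] t3 yr; rewrite -(energy_constant t3).
case: cg => r0 B0 H th0 [H1 H2 H3 Hg].
have [du dv bu vk] := Hg _ t3.
refine (@calibration_pointwise _ _ _ _ _ _ _ _ _ (alpha - theta * t) _ _ _ w
  ac B0 H r0 bu yr vk th0 _ H1 H2 H3).
case/andP: t3 => t1 t2; rewrite ler_norml.
have K1 : theta * t <= theta * 3 by rewrite ler_pM2l.
have K2 : theta * -2 <= theta * t by rewrite ler_pM2l.
by apply/andP; split; lra.
Qed.

(** The curve is run from time t0 to time t1 with a speed proportional to its own,
    perturbed by e so that the change of parameter tau is regular where the curve stops. In
    the new parameter the inequality of calibration_inner integrates; the integral of the
    energy is the square of the length divided by the duration. *)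
Lemma calibrated_length g (a b : R) (S : R -> R) (s : seq R) (t0 t1 alpha : R) :
  a < b -> arclength g a b S s ->
  (forall t, a <= t <= b -> dom c (g t) /\ ball x0 (r / 3) (c (g t))) ->
  -2 <= t0 -> t0 < t1 -> t1 <= 3 -> 0 <= alpha <= theta ->
  calibration alpha t1 (c (g b)) - calibration alpha t0 (c (g a))
    <= S b ^+ 2 / (t1 - t0) - (t1 - t0) * inner c (u 0) (v 0) (v 0).
Proof.
move=> ab ar gin t02 t01 t13 ha; set D2 := inner c (u 0) (v 0) (v 0).
have T0 : 0 < t1 - t0 by rewrite subr_gt0.
have ba0 : 0 < b - a by rewrite subr_gt0.
have S0 t : a <= t <= b -> 0 <= S t by apply: arclength_ge0 ar.
have Sa : S a = 0 by case: ar.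
apply: (@le_of_forall_eps _ _ _ ((b - a) * S b / (t1 - t0))) => e e0.
pose L := S b + e * (b - a).
have L0 : 0 < L by rewrite ltr_wpDl ?mulr_gt0// S0// lexx ltW.
pose k := (t1 - t0) / L; have k0 : 0 < k by rewrite divr_gt0.
pose tau t := t0 + k * (S t + e * (t - a)).
pose Y t := c (g (clamp a b t)).
have ctau t : {for t, continuous tau}.
  apply: continuous_addr; first exact: continuous_cst.
  apply: continuous_mulr; first exact: continuous_cst.
  apply: continuous_addr; first by case: ar.
  apply: continuous_mulr; first exact: continuous_cst.
  by apply: cvgB; [exact: cvg_id|exact: continuous_cst].
have taua : tau a = t0 by rewrite /tau Sa subrr mulr0 addr0 mulr0 addr0.
have taub : tau b = t1 by rewrite /tau -/L /k divfK ?gt_eqF// addrC subrK.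
have taut t : a <= t <= b -> -2 <= tau t <= 3.
  move=> /andP[at_ tb]; rewrite -[X in _ <= X <= _]/(tau t).
  have : tau t <= tau b.
    rewrite /tau lerD2l ler_pM2l// lerD ?ler_pM2l ?lerD2r//.
    exact: (arclength_mono ar at_ tb).
  rewrite taub => h; rewrite (le_trans h t13) andbT (le_trans t02)// /tau lerDl.
  by rewrite mulr_ge0 ?(ltW k0)// addr_ge0 ?S0 ?at_// mulr_ge0 ?(ltW e0)// subr_ge0.
(* F is nondecreasing: its derivative is at least S' / k - S'^2 / tau', where
   tau' = k (S' + e). *)
pose F t := S t * (k^-1) - tau t * D2 - calibration alpha (tau t) (Y t).
have Fab : F a <= F b.
  apply: (@nondecreasing_off_finite _ s F a b (ltW ab)).
    move=> t tab; have [dt bt] := gin _ tab.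
    have cY : {for t, continuous Y}.
      by apply: (clamped_chart_continuous ar); rewrite clamp_id.
    have c1 : {for t, continuous (fun t => S t * k^-1)}.
      by apply: continuous_mulr; [case: ar|exact: continuous_cst].
    have c2 : {for t, continuous (fun t => tau t * D2)}.
      by apply: continuous_mulr; [exact: ctau|exact: continuous_cst].
    have c3 := calibration_continuous (alpha := alpha) (taut _ tab) (ctau t) cY.
    exact: (continuous_subr (continuous_subr c1 c2) c3).
  move=> t tab ts; have tab' : a <= t <= b by case/andP: tab => *; rewrite !ltW.
  have [dt bt] := gin _ tab'.
  have [w [dY dS sp]] := clamped_is_derive ar ac tab ts dt.
  have sp0 : 0 <= speed g t by exact: speed_ge0.
  pose q := k * (speed g t + e).
  have q0 : 0 < q by rewrite mulr_gt0// ltr_wpDl.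
  have dtau : is_derive t 1 tau q.
    have h := is_deriveDr dS (is_deriveMr (is_derive_cst e t 1) (is_deriveB (is_derive_id t 1) (is_derive_cst a t 1))).
    have h2 := is_deriveDr (is_derive_cst t0 t 1) (is_deriveMr (is_derive_cst k t 1) h).
    by refine (@is_derive_eq _ _ _ _ _ _ _ _ h2 _); rewrite /q /=; ring.
  have dY' : is_derive t 1 Y (q *: (q^-1 *: w)).
    by rewrite scalerA divff ?gt_eqF// scale1r.
  have yb : ball x0 (r / 3) (Y t) by rewrite /Y clamp_id.
  have dP := calibration_derive alpha (taut _ tab') dtau dY'.
  have hP := calibration_inner (q^-1 *: w) ha (taut _ tab') yb.
  set P := (X in X <= _) in hP; rewrite -/P in dP.
  exists (speed g t / k - q * D2 - q * P).
    have h1 := is_deriveMr dS (is_derive_cst k^-1 t 1).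
    have h2 := is_deriveMr dtau (is_derive_cst D2 t 1).
    have h := is_deriveB (is_deriveB h1 h2) dP.
    by refine (@is_derive_eq _ _ _ _ _ _ _ _ h _) => /=; ring.
  have hsq : speed g t ^+ 2 = inner c (Y t) w w.
    rewrite sp /Y clamp_id// sqr_sqrtr// inner_ge0//; exact: chart_im.
  rewrite innerZl innerZr -hsq in hP.
  have hq : q * (q^-1 * (q^-1 * speed g t ^+ 2)) <= speed g t / k.
    rewrite mulVKf ?gt_eqF// expr2 mulrA -[leRHS]mulr1.
    have -> : q^-1 * speed g t * speed g t = speed g t / k * (speed g t / (speed g t + e)).
      by rewrite /q; field; rewrite !gt_eqF// ltr_wpDl.
    apply: ler_wpM2l; first exact: (divr_ge0 sp0 (ltW k0)).
    by rewrite ler_pdivrMr ?ltr_wpDl// mul1r lerDl (ltW e0).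
  have : q * P <= q * (q^-1 * (q^-1 * speed g t ^+ 2) - D2) by rewrite ler_pM2l.
  by rewrite mulrBr -/D2; lra.
move: Fab; rewrite /F taua taub Sa mul0r /Y !clamp_id ?lexx ?(ltW ab)//.
have -> : S b * k^-1 = S b ^+ 2 / (t1 - t0) + e * ((b - a) * S b / (t1 - t0)).
  rewrite /k invf_div /L; field. by rewrite gt_eqF.
by rewrite -/D2; lra.
Qed.

(** A curve shorter than l that starts well inside the ball stays in it, so that
    calibrated_length applies to it. *)
Lemma calibrated_edist (p q : M) (l t0 t1 : R) : dom c p ->
  `|x0 - c p| + Num.sqrt B * l < r / 3 -> (edist p q < l%:E)%E ->
  -2 <= t0 -> t0 < t1 -> t1 <= 3 ->
  [/\ dom c q, `|c q - c p| <= Num.sqrt B * l &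
    forall alpha, 0 <= alpha <= theta ->
    calibration alpha t1 (c q) - calibration alpha t0 (c p)
      <= l ^+ 2 / (t1 - t0) - (t1 - t0) * inner c (u 0) (v 0) (v 0)].
Proof.
move=> dp small /edist_ltP[g [a [b [ab pw ga gb lt_l]]]] t02 t01 t13.
case: cg => r0 B0 H _ _.
have [S [s [ar lE]]] := piecewise_arclength pw.
rewrite lE lte_fin in lt_l.
have Sb0 : 0 <= S b by apply: (arclength_ge0 ar); rewrite lexx ltW.
have l0 : 0 <= l := le_trans Sb0 (ltW lt_l).
have sB0 : 0 <= Num.sqrt B by exact: sqrtr_ge0.
have r3 : r / 3 <= r by rewrite ler_piMr ?(ltW r0)// invf_le1// ler1n.
have H3 : chart_bounds c x0 (r / 3) B by move=> y yr; apply: H; exact: le_ball yr.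
have small' : `|x0 - c (g a)| + Num.sqrt B * S b < r / 3.
  rewrite ga; apply: le_lt_trans small; rewrite lerD2l ler_wpM2l//; exact: ltW.
have dga : dom c (g a) by rewrite ga.
have stay := short_curve_in_ball ac pw ar B0 H3 dga small'.
have Sle t : a <= t <= b -> S t <= S b.
  by case/andP=> ta tb; apply: (arclength_mono ar ta tb).
have [dq nq] : dom c (g b) /\ `|c (g b) - c (g a)| <= Num.sqrt B * S b.
  by apply: stay; rewrite lexx ltW.
rewrite gb ga in nq; rewrite gb in dq.
split; first exact: dq.
  by apply: (le_trans nq); rewrite ler_wpM2l// ltW.
move=> alpha ha.
have := calibrated_length ab ar _ t02 t01 t13 ha; rewrite ga gb => h.
apply: le_trans (h _) _ => [t tab|].
  have [dt nt] := stay _ tab; split; first exact: dt.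
  apply/ballE_norm; rewrite -ga in small; apply: le_lt_trans small'.
  have -> : x0 - c (g t) = (x0 - c (g a)) - (c (g t) - c (g a)).
    by rewrite opprB addrA subrK.
  apply: (le_trans (ler_normB _ _)); rewrite lerD2l.
  by apply: (le_trans nt); rewrite ler_wpM2l// Sle.
rewrite lerD2r ler_wpM2r ?invr_ge0 ?subr_ge0 ?(ltW t01)// lerXn2r ?nnegrE//.
exact: ltW.
Qed.

End Calibration.

(** * Short geodesics minimise *)

Section LocalGeodesics.
Context {R : realType} {n : nat} {M : riemannianManifold R n}.
Implicit Types (c : chart R n M) (x y v w : 'rV[R]_n).

Lemma le_of_small_eps (X Y k e0 : R) : 0 < e0 -> 0 <= k ->
  (forall e, 0 < e -> e <= e0 -> X <= Y + e * k) -> X <= Y.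
Proof.
move=> e00 k0 H; apply: (@le_of_forall_eps _ _ _ k) => e e1.
have m0 : 0 < Num.min e e0 by rewrite lt_min e1.
apply: (le_trans (H _ m0 _)); first by rewrite ge_min lexx orbT.
by rewrite lerD2l ler_wpM2r// ge_min lexx.
Qed.

Definition acc_const (B : R) : R := n%:R ^+ 3 * B + n%:R ^+ 2 * B + 1.

Lemma geodesic_acc_bound c x0 r B x v : 0 < B -> chart_bounds c x0 r B -> ball x0 r x ->
  `|geodesic_acc c x v| <= acc_const B * `|v| ^+ 2.
Proof.
move=> B0 H xr; have [_ _ _ _ HG] := H _ xr.
apply: (@le_trans _ _ (n%:R ^+ 2 * B * `|v| ^+ 2)).
  apply: rV_norm_le; first by rewrite !mulr_ge0 ?exprn_ge0 ?(ltW B0).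
  move=> k; rewrite mxE normrN expr2 mulrA; apply: bilinear_bound (ltW B0) _ => a b.
  by have [] := HG k a b.
rewrite ler_wpM2r ?sqr_ge0// /acc_const addrAC lerDr addr_ge0//.
by rewrite !mulr_ge0 ?exprn_ge0 ?(ltW B0).
Qed.

Lemma geodesic_acc_lipschitz c x0 r B x x' v v' : 0 < B -> chart_bounds c x0 r B ->
  ball x0 r x -> ball x0 r x' ->
  `|geodesic_acc c x v - geodesic_acc c x' v'| <=
   acc_const B * (`|x - x'| * `|v| ^+ 2 + `|v - v'| * (`|v| + `|v'|)).
Proof.
move=> B0 H xr xr'; set N := n%:R : R.
have N0 : 0 <= N by exact: ler0n.
apply: (@le_trans _ _ (N ^+ 3 * B * (`|x - x'| * `|v| ^+ 2) +
                       N ^+ 2 * B * (`|v - v'| * (`|v| + `|v'|)))).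
  apply: rV_norm_le.
    by rewrite addr_ge0// !mulr_ge0 ?exprn_ge0 ?(ltW B0) ?addr_ge0.
  move=> k; rewrite !mxE.
  (* The difference of the two quadratic expressions, one factor at a time. *)
  pose G1 := \sum_a \sum_b (christoffel c x k a b - christoffel c x' k a b) * v 0 a * v 0 b.
  pose G2 := \sum_a \sum_b christoffel c x' k a b * (v - v') 0 a * v 0 b.
  pose G3 := \sum_a \sum_b christoffel c x' k a b * v' 0 a * (v - v') 0 b.
  have -> : - (\sum_a \sum_b christoffel c x k a b * v 0 a * v 0 b) -
      - (\sum_a \sum_b christoffel c x' k a b * v' 0 a * v' 0 b) = - (G1 + (G2 + G3)).
    rewrite -opprD; congr (- _); rewrite -sumrB /G1 /G2 /G3 -!big_split/=.
    apply: eq_bigr => a _; rewrite -sumrB -!big_split/=; apply: eq_bigr => b _.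
    by rewrite !mxE; ring.
  rewrite normrN; apply: (le_trans (ler_normD _ _)); apply: lerD.
    have -> : N ^+ 3 * B * (`|x - x'| * `|v| ^+ 2) = N ^+ 2 * (N * B * `|x - x'|) * `|v| * `|v|.
      by ring.
    apply: bilinear_bound; first by rewrite !mulr_ge0 ?(ltW B0).
    move=> a b; apply: (partial_lipschitz (f := fun z => christoffel c z k a b) (ltW B0) _ xr' xr).
    by move=> w wr i; have [_ _ _ _ /(_ k a b)[_ /(_ i)]] := H _ wr.
  apply: (le_trans (ler_normD _ _)).
  have HB a b : `|christoffel c x' k a b| <= B by have [_ _ _ _ /(_ k a b)[]] := H _ xr'.
  have E : N ^+ 2 * B * (`|v - v'| * (`|v| + `|v'|)) =
    N ^+ 2 * B * `|v - v'| * `|v| + N ^+ 2 * B * `|v'| * `|v - v'| by ring.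
  by rewrite E; apply: lerD; apply: bilinear_bound HB; exact: ltW.
have p1 : 0 <= `|x - x'| * `|v| ^+ 2 by rewrite mulr_ge0 ?exprn_ge0.
have p2 : 0 <= `|v - v'| * (`|v| + `|v'|) by rewrite mulr_ge0 ?addr_ge0.
have q1 : 0 <= N ^+ 3 * B by rewrite mulr_ge0 ?exprn_ge0 ?(ltW B0).
have q2 : 0 <= N ^+ 2 * B by rewrite mulr_ge0 ?exprn_ge0 ?(ltW B0).
rewrite [leRHS]mulrDr; apply: lerD; apply: ler_wpM2r => //; rewrite /acc_const -/N; lra.
Qed.

(** The interval of definition leaves room around [0, 1], to extend geodesics
    beyond their end points. *)
Definition chart_geodesic c (u v : R -> 'rV[R]_n) (D : R) :=
  forall s : R, -2 <= s <= 3 -> [/\ im c (u s), is_derive s 1 u (v s),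
    is_derive s 1 v (geodesic_acc c (u s) (v s)) & inner c (u s) (v s) (v s) = D ^+ 2].

Lemma chart_geodesic_C1 c (u v : R -> 'rV[R]_n) (D t : R) : atlas c -> 0 <= D ->
  chart_geodesic c u v D ->
  -2 < t < 3 -> C1_at (inv c \o u) t /\ speed (inv c \o u) t = D.
Proof.
move=> ac D0 H t3.
have t3' : -2 <= t <= 3 by case/andP: t3 => *; rewrite !ltW.
have [cu du dv iv] := H _ t3'.
have hn : \forall s \near t, im c (u s) /\ is_derive (s : R) 1 u (v s).
  apply: filterS (near_itv t3) => s /andP[s1 s2].
  have s3 : -2 <= s <= 3 by rewrite !ltW.
  by have [] := H _ s3.
have [C1 sp] := chart_curve_C1 ac hn (is_derive_continuous dv).
split; first exact: C1.
by rewrite sp iv sqrtr_sqr ger0_norm.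
Qed.

Lemma chart_geodesic_edist_le c (u v : R -> 'rV[R]_n) (D s t : R) : atlas c -> 0 <= D ->
  chart_geodesic c u v D ->
  -1 <= s -> s < t -> t <= 2 ->
  (edist (inv c (u s)) (inv c (u t)) <= ((t - s) * D)%:E)%E.
Proof.
move=> ac D0 H s1 st t2.
have pw : piecewise_C1 (inv c \o u) s t.
  apply: pw_segment st _; exists (inv c \o u), 1; split; [by []|by []|].
  move=> x /andP[x1 x2].
  by have [] := @chart_geodesic_C1 c u v D x ac D0 H _; first by apply/andP; split; lra.
apply: (le_trans (edist_le_length pw)); rewrite mulrC.
apply: (curve_length_le pw) => x /andP[x1 x2] _.
have [|_ ->//] := @chart_geodesic_C1 c u v D x ac D0 H _.
by apply/andP; split; lra.
Qed.

Lemma near_small (k m : R) : 0 < m -> \forall d \near 0^'+, k * d < m.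
Proof.
move=> m0; have K : 0 < `|k| + 1 by rewrite ltr_wpDl.
near=> d.
have d0 : 0 < d by near: d; exact: nbhs_right_gt.
have dm : d < m / (`|k| + 1) by near: d; apply: nbhs_right_lt; rewrite divr_gt0.
apply: le_lt_trans (_ : (`|k| + 1) * d < m); last by rewrite mulrC -ltr_pdivlMr.
by rewrite ler_wpM2r ?(ltW d0)// (le_trans (ler_norm k))// lerDl.
Unshelve. all: end_near. Qed.

Lemma calibration_on_geodesic c theta (u v : R -> 'rV[R]_n) alpha t :
  calibration c theta u v alpha t (u t) = 0.
Proof.
rewrite /calibration subrr !big1 ?mulr0 ?addr0// => l _; first by rewrite mxE expr0n.
by rewrite mxE mulr0.
Qed.

Section Minimising.
Context (c : chart R n M) (ac : atlas c) (x0 : 'rV[R]_n) (r B kappa theta delta D : R).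
Context (u v : R -> 'rV[R]_n) (cg : calibrating_geodesic c x0 r B kappa theta u v).
Context (d0 : 0 < delta) (D0 : 0 <= D) (HD : inner c (u 0) (v 0) (v 0) = D ^+ 2).
Context (geod : chart_geodesic c u v D) (near_x0 : forall t, -2 <= t <= 3 -> `|x0 - u t| <= 16 * delta).
Context (small : 16 * delta + Num.sqrt B * (3 * D + 2 * delta) < r / 3).

(** The calibration vanishes at both ends, so calibrated_edist gives
    (t - s) D <= l for every l larger than the distance. *)
Lemma chart_geodesic_edist_ge s t : -1 <= s -> s < t -> t <= 2 ->
  (((t - s) * D)%:E <= edist (inv c (u s)) (inv c (u t)))%E.
Proof.
move=> s1 st t2; have ts0 : 0 < t - s by rewrite subr_gt0.
have s3 : -2 <= s <= 3 by apply/andP; split; lra.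
have t3 : -2 <= t <= 3 by apply/andP; split; lra.
have [cus _ _ _] := geod s3; have [cut _ _ _] := geod t3.
have [ds cs] := chart_invK cus; have [dt ct] := chart_invK cut.
have key l : (edist (inv c (u s)) (inv c (u t)) < l%:E)%E -> l <= 3 * D -> (t - s) * D <= l.
  move=> hl lD.
  have l0 : 0 <= l by rewrite -lee_fin; apply: le_trans (ltW hl); exact: edist_ge0.
  have sm : `|x0 - c (inv c (u s))| + Num.sqrt B * l < r / 3.
    rewrite cs; apply: le_lt_trans small; apply: lerD; first exact: near_x0.
    by rewrite ler_wpM2l ?sqrtr_ge0//; move: (ltW d0); lra.
  have s2' : -2 <= s by lra.
  have t3' : t <= 3 by lra.
  have [_ _ /(_ 0)] := calibrated_edist ac cg ds sm hl s2' st t3'.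
  have th0 : 0 <= theta by case: cg => _ _ _ /ltW.
  rewrite lexx th0 => /(_ isT); rewrite cs ct !calibration_on_geodesic subrr HD.
  rewrite subr_ge0 ler_pdivlMr// => h.
  rewrite -(@ler_pXn2r _ 2) ?nnegrE ?mulr_ge0 ?(ltW ts0)//.
  by apply: le_trans h; rewrite le_eqVlt; apply/orP; left; apply/eqP; ring.
rewrite leNgt; apply/negP => h.
have e0 := edist_ge0 (inv c (u s)) (inv c (u t)).
case E : (edist (inv c (u s)) (inv c (u t))) => [d| |]; rewrite E in h e0 => //.
rewrite lte_fin in h; rewrite E in key.
have h1 : (t - s) * D <= 3 * D by rewrite ler_wpM2r//; lra.
have h2 : ((t - s) * D <= (d + (t - s) * D) / 2) by apply: key; rewrite ?lte_fin; lra.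
by lra.
Qed.

Lemma chart_geodesic_edist s t : -1 <= s <= 2 -> -1 <= t <= 2 ->
  edist (inv c (u s)) (inv c (u t)) = (`|s - t| * D)%:E.
Proof.
have key a b : -1 <= a -> a < b -> b <= 2 -> edist (inv c (u a)) (inv c (u b)) = ((b - a) * D)%:E.
  move=> a1 ab b2; apply/eqP; rewrite eq_le (chart_geodesic_edist_le ac D0 geod a1 ab b2).
  exact: chart_geodesic_edist_ge.
move=> /andP[s1 s2] /andP[t1 t2]; case: (ltgtP s t) => [st|ts|->].
- by rewrite key// distrC gtr0_norm ?subr_gt0.
- by rewrite edist_sym key// gtr0_norm ?subr_gt0.
- by rewrite edist_refl subrr normr0 mul0r.
Qed.

(** Along a shortest chain from u 0 to m to u 1, the calibration inequalities before
    and after m bound the calibration at (s, m) above and below by zero. This holds for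
    alpha = 0 and for alpha = theta; the difference of the two calibrations is theta times
    a squared norm. *)
Lemma chart_geodesic_unique s m : 0 < s < 1 ->
  (edist (inv c (u 0)) m <= (s * D)%:E)%E -> (edist m (inv c (u 1)) <= ((1 - s) * D)%:E)%E ->
  m = inv c (u s).
Proof.
move=> /andP[s0 s1] h1 h2.
have I0 : -2 <= (0 : R) <= 3 by apply/andP; split; lra.
have I1 : -2 <= (1 : R) <= 3 by apply/andP; split; lra.
have [cu0 _ _ _] := geod I0; have [cu1 _ _ _] := geod I1.
have [dd0 c0] := chart_invK cu0; have [dd1 c1] := chart_invK cu1.
have th0 : 0 < theta by case: cg.
have sB0 := sqrtr_ge0 B.
have s1' : 0 < 1 - s by rewrite subr_gt0.
have sD1 : s * D <= D by rewrite ler_piMl// ltW.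
have sD2 : (1 - s) * D <= D by rewrite ler_piMl//; lra.
have sD : 0 <= s * D by rewrite mulr_ge0 ?(ltW s0).
have sD' : 0 <= (1 - s) * D by rewrite mulr_ge0 ?(ltW s1').
have I3 : -2 <= s by lra.
have I4 : s <= 3 by lra.
have I5 : -2 <= (0 : R) by lra.
have I6 : (1 : R) <= 3 by lra.
have L1 e : 0 < e -> e <= delta -> [/\ dom c m, `|c m - u 0| <= Num.sqrt B * (s * D + e) &
    forall alpha, 0 <= alpha <= theta -> calibration c theta u v alpha s (c m)
      <= (s * D + e) ^+ 2 / s - s * D ^+ 2].
  move=> e0 ed.
  have hl : (edist (inv c (u 0)) m < (s * D + e)%:E)%E by apply: (le_lt_trans h1); rewrite lte_fin ltrDl.
  have sm : `|x0 - c (inv c (u 0))| + Num.sqrt B * (s * D + e) < r / 3.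
    rewrite c0; apply: le_lt_trans small; apply: lerD; first exact: near_x0.
    by rewrite ler_wpM2l//; lra.
  have [dm nm H] := calibrated_edist ac cg dd0 sm hl I5 s0 I4.
  rewrite c0 in nm; split; [exact: dm|exact: nm|].
  by move=> alpha /H; rewrite c0 calibration_on_geodesic !subr0 HD.
have L2 e : 0 < e -> e <= delta -> forall alpha, 0 <= alpha <= theta ->
   - calibration c theta u v alpha s (c m) <= ((1 - s) * D + e) ^+ 2 / (1 - s) - (1 - s) * D ^+ 2.
  move=> e0 ed; have [dm nm _] := L1 _ e0 ed.
  have hl : (edist m (inv c (u 1)) < ((1 - s) * D + e)%:E)%E by apply: (le_lt_trans h2); rewrite lte_fin ltrDl.
  have sm : `|x0 - c m| + Num.sqrt B * ((1 - s) * D + e) < r / 3.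
    have -> : x0 - c m = (x0 - u 0) - (c m - u 0) by rewrite opprB addrA subrK.
    apply: le_lt_trans small.
    apply: (@le_trans _ _ (16 * delta + Num.sqrt B * (s * D + e) + Num.sqrt B * ((1 - s) * D + e))).
      rewrite lerD2r (le_trans (ler_normB _ _))//; apply: lerD; [exact: near_x0|exact: nm].
    by rewrite -addrA lerD2l -mulrDr ler_wpM2l//; lra.
  have [_ _ H] := calibrated_edist ac cg dm sm hl I3 s1 I6.
  by move=> alpha /H; rewrite c1 calibration_on_geodesic sub0r HD.
have sq (k e : R) : 0 < k -> 0 < e -> e <= delta -> 0 <= k * D -> k * D <= D ->
   (k * D + e) ^+ 2 / k - k * D ^+ 2 <= 0 + e * ((2 * D + delta) / k).
  move=> k0 e0 ed kD kD'.
  have -> : (k * D + e) ^+ 2 / k - k * D ^+ 2 = e * ((2 * (k * D) + e) / k).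
    by field; rewrite gt_eqF.
  by rewrite add0r ler_wpM2l ?(ltW e0)// ler_wpM2r ?invr_ge0 ?(ltW k0)//; lra.
have z alpha : 0 <= alpha <= theta -> calibration c theta u v alpha s (c m) = 0.
  move=> ha; apply/eqP; rewrite eq_le; apply/andP; split.
    apply: (@le_of_small_eps _ _ ((2 * D + delta) / s) delta d0).
      by rewrite divr_ge0 ?(ltW s0)// addr_ge0 ?mulr_ge0 ?(ltW d0).
    move=> e e0 ed; have [_ _ /(_ _ ha) h] := L1 _ e0 ed.
    by apply: (le_trans h); apply: sq.
  rewrite -oppr_le0.
  apply: (@le_of_small_eps _ _ ((2 * D + delta) / (1 - s)) delta d0).
    by rewrite divr_ge0 ?(ltW s1')// addr_ge0 ?mulr_ge0 ?(ltW d0).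
  move=> e e0 ed; apply: (le_trans (L2 _ e0 ed _ ha)); exact: sq.
have z0 := z 0; have zt := z theta.
rewrite lexx (ltW th0) in z0; rewrite lexx (ltW th0) in zt.
have {z0}z0 := z0 isT; have {zt}zt := zt isT.
have S0 : theta * \sum_l (c m - u s) 0 l ^+ 2 = 0.
  by move: zt z0; rewrite /calibration mulrBl sub0r mulNr; lra.
have S1 : \sum_l (c m - u s) 0 l ^+ 2 = 0.
  by apply/eqP; rewrite -(mulrI_eq0 _ (mulfI (lt0r_neq0 th0))) S0.
have cm : c m = u s.
  apply/eqP; rewrite -subr_eq0 -normr_le0 -(@ler_pXn2r _ 2) ?nnegrE// expr0n/=.
  by rewrite (le_trans (norm_sq_le_sum _))// S1.
have [dm _ _] := L1 _ d0 (lexx _).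
by rewrite -cm chart_coordK.
Qed.

End Minimising.

(** A geodesic from a to b that minimises even between points beyond its ends,
    and contains all points m between a and b in the metric sense. *)
Definition local_geodesic c (a b : M) (D : R) (u v : R -> 'rV[R]_n) :=
  [/\ inv c (u 0) = a, inv c (u 1) = b, 0 <= D &
  [/\ chart_geodesic c u v D,
    forall s t, -1 <= s <= 2 -> -1 <= t <= 2 ->
      edist (inv c (u s)) (inv c (u t)) = (`|s - t| * D)%:E &
    forall s m, 0 < s < 1 -> (edist a m <= (s * D)%:E)%E ->
      (edist m b <= ((1 - s) * D)%:E)%E -> m = inv c (u s)]].

(** The constants are chosen in the order B, r, theta, kappa, delta: B bounds the metric
    near z, theta makes the calibration inequality hold, kappa is the admissible coordinate
    speed, and delta the distance within which boundary_value_problem has solutions of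
    that speed which stay in the ball of radius r / 3. *)
Lemma local_geodesics c (z : M) : atlas c -> dom c z ->
  exists2 e : R, 0 < e & forall a b, (edist z a < e%:E)%E -> (edist z b < e%:E)%E ->
    exists (D : R) (u v : R -> 'rV[R]_n), local_geodesic c a b D u v.
Proof.
move=> ac cz; have [B B0 HB] := chart_bounds_exist ac (chart_im cz).
near (0 : R)^'+ => r.
have r0 : 0 < r by near: r; exact: nbhs_right_gt.
have bnd : chart_bounds c (c z) r B by near: r.
pose N1 := n%:R + 1 : R; have N10 : 0 < N1 by rewrite /N1 ltr_wpDl.
pose theta := (32 * (N1 ^+ 2 * B))^-1.
have W0 : 0 < 32 * (N1 ^+ 2 * B) by rewrite !mulr_gt0 ?exprn_gt0.
have th0 : 0 < theta by rewrite /theta invr_gt0.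
have NB : 0 < N1 ^+ 3 * B by rewrite mulr_gt0 ?exprn_gt0.
pose kappa := Num.min (theta / (N1 ^+ 3 * B)) (2 * N1)^-1.
have k0 : 0 < kappa by rewrite lt_min divr_gt0//= invr_gt0 mulr_gt0.
have C0 : 0 < acc_const B.
  by rewrite /acc_const ltr_wpDl// addr_ge0// mulr_ge0 ?exprn_ge0 ?(ltW B0).
have sB : Num.sqrt B ^+ 2 = B by rewrite sqr_sqrtr ?(ltW B0).
have sB0 := sqrtr_ge0 B.
(* W delta bounds the coordinate distance from z of all curves to be compared. *)
pose W := 16 + 15 * (n%:R * B) + 2 * Num.sqrt B.
have r30 : 0 < r / 3 by rewrite divr_gt0.
near (0 : R)^'+ => delta.
have d0 : 0 < delta by near: delta; exact: nbhs_right_gt.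
have d1 : delta < 1 by near: delta; exact: nbhs_right_lt.
have d2 : 5 * delta < kappa by near: delta; exact: near_small.
have d3 : W * delta < r / 3 by near: delta; exact: near_small.
have d4 : 510 * acc_const B * delta < 1 by near: delta; exact: near_small.
have nB0 : 0 <= n%:R * B * delta by rewrite !mulr_ge0 ?(ltW B0) ?(ltW d0).
have sBd : 0 <= Num.sqrt B * delta by rewrite mulr_ge0 ?(ltW d0).
have d5 : 16 * delta < r / 3 by move: d3 nB0 sBd; rewrite /W !mulrDl; clear; lra.
have d6 : 16 * delta < r by move: d5 r0; clear; lra.
have [e e0 He] := edist_chart_ball ac cz d0.
exists e => [//|a b /He[da na] /He[db nb]].
have na' : ball (c z) delta (c a) by apply/ballE_norm.
have nb' : ball (c z) delta (c b) by apply/ballE_norm.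
have d4' : 510 * (acc_const B * delta) <= 1 by rewrite mulrA (ltW d4).
have [u [v [u0 u1 Huv]]] := boundary_value_problem C0
  (fun x v xr => geodesic_acc_bound v B0 bnd xr)
  (fun x x' v v' xr xr' => geodesic_acc_lipschitz v v' B0 bnd xr xr')
  d0 (ltW d1) d6 d4' na' nb'.
have r3 : r / 3 <= r by rewrite ler_piMr ?(ltW r0)// invf_le1// ler1n.
have cg : calibrating_geodesic c (c z) r B kappa theta u v.
  split; [exact: r0|exact: B0|exact: bnd|exact: th0|split].
  - by rewrite -/N1 mulrA divff ?gt_eqF.
  - apply: (@le_trans _ _ (N1 ^+ 3 * B * (theta / (N1 ^+ 3 * B)))).
      by rewrite ler_pM2l// ge_min lexx.
    by rewrite mulrC divfK ?gt_eqF.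
  - rewrite mulrA -/N1 -ler_pdivlMl ?mulr_gt0// mulr1.
    by rewrite ge_min lexx orbT.
  - move=> t t3; have [du dv nu nv] := Huv _ t3.
    split; [exact: du|exact: dv| |exact: le_trans nv (ltW d2)].
    by apply/ballE_norm; exact: le_lt_trans nu d5.
have cu t : -2 <= t <= 3 -> ball (c z) r (u t).
  by move=> t3; have [_ _ nu _] := Huv _ t3; apply/ballE_norm; exact: le_lt_trans nu d6.
pose D := Num.sqrt (inner c (u 0) (v 0) (v 0)).
have I0 : -2 <= (0 : R) <= 3 by rewrite oppr_le0 !ler0n.
have im0 : im c (u 0) by have [] := bnd _ (cu _ I0).
have D0 : 0 <= D by exact: sqrtr_ge0.
have HD : inner c (u 0) (v 0) (v 0) = D ^+ 2 by rewrite sqr_sqrtr// inner_ge0.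
have Dle : D <= 5 * n%:R * Num.sqrt B * delta.
  rewrite -(@ler_pXn2r _ 2) ?nnegrE//; last first.
    by rewrite !mulr_ge0 ?(ltW d0).
  rewrite -HD; apply: (le_trans (ler_norm _)).
  have [_ _ hG _ _] := bnd _ (cu _ I0).
  have hG' i j : `|metric c (u 0) i j| <= B by have [] := hG i j.
  apply: (le_trans (inner_upper _ _ hG')).
  have [_ _ _ nv] := Huv _ I0.
  have -> : (5 * n%:R * Num.sqrt B * delta) ^+ 2 = n%:R ^+ 2 * B * (5 * delta) * (5 * delta).
    by rewrite -[in RHS]sB; ring.
  have q0 : 0 <= n%:R ^+ 2 * B by rewrite mulr_ge0 ?exprn_ge0 ?(ltW B0).
  by apply: ler_pM => //; [exact: mulr_ge0|exact: ler_wpM2l].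
have small : 16 * delta + Num.sqrt B * (3 * D + 2 * delta) < r / 3.
  apply: le_lt_trans d3; rewrite /W.
  have h : Num.sqrt B * D <= 5 * (n%:R * B * delta).
    apply: (le_trans (ler_wpM2l sB0 Dle)); rewrite -[in leRHS]sB.
    by rewrite le_eqVlt; apply/orP; left; apply/eqP; ring.
  have -> : Num.sqrt B * (3 * D + 2 * delta) = 3 * (Num.sqrt B * D) + 2 * (Num.sqrt B * delta) by ring.
  have -> : (16 + 15 * (n%:R * B) + 2 * Num.sqrt B) * delta =
    16 * delta + 15 * (n%:R * B * delta) + 2 * (Num.sqrt B * delta) by ring.
  by move: h; clear; lra.
have geod : chart_geodesic c u v D.
  move=> t t3; have [du dv nu nv] := Huv _ t3; have [it _ _ _ _] := bnd _ (cu _ t3).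
  split; [exact: it|exact: du|exact: dv|].
  by rewrite (energy_constant ac cg t3) HD.
have nx t : -2 <= t <= 3 -> `|c z - u t| <= 16 * delta by move=> /Huv[].
have ia : inv c (u 0) = a by rewrite u0 chart_coordK.
have ib : inv c (u 1) = b by rewrite u1 chart_coordK.
exists D, u, v; split; [exact: ia|exact: ib|exact: D0|split; first exact: geod].
  move=> s t s2 t2; exact: (chart_geodesic_edist ac cg d0 D0 HD geod nx small s2 t2).
move=> s m s1; rewrite -{1}ia -{1}ib => h1 h2.
exact: (chart_geodesic_unique ac cg d0 D0 HD geod nx small s1 h1 h2).
Unshelve. all: end_near. Qed.

End LocalGeodesics.

(** * Shortest paths are geodesics *)

Section GeodesicsInCharts.
Context {R : realType} {n : nat} {M : riemannianManifold R n}.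
Implicit Types (c : chart R n M) (g : R -> M).

(** The witness w is the velocity in the chart c; it serves to speak of the second
    derivative near t and of the speed at once. *)
Definition solves_geodesic c g (D t : R) := exists w : R -> 'rV[R]_n,
  (\forall s \near t, [/\ dom c (g s), is_derive (s : R) 1 (c \o g) (w s) &
     is_derive (s : R) 1 w (geodesic_acc c (c (g s)) (w s))]) /\
  inner c (c (g t)) (w t) (w t) = D ^+ 2.

Definition regular_geodesic g (D t : R) :=
  {for t, continuous g} /\ forall c, atlas c -> dom c (g t) -> solves_geodesic c g D t.

Lemma solves_geodesic_eq c g h (D t : R) : (\forall s \near t, g s = h s) ->
  solves_geodesic c g D t -> solves_geodesic c h D t.
Proof.
move=> gh [w [Hw iw]]; exists w; rewrite -(nbhs_singleton gh); split; last exact: iw.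
have cgh : \forall s \near t, \forall r \near s, (c \o g) r = (c \o h) r.
  by apply: near_join; apply: filterS gh => s /= ->.
apply: filterS3 gh cgh Hw => s e e2 [d1 d2 d3]; rewrite -e; split; [exact: d1| |exact: d3].
exact: near_eq_is_derive e2 d2.
Qed.

Lemma regular_geodesic_eq g h (D t : R) : (\forall s \near t, g s = h s) ->
  regular_geodesic g D t -> regular_geodesic h D t.
Proof.
move=> gh [cg H]; split; first exact: near_eq_continuous gh cg.
move=> c ac; rewrite -(nbhs_singleton gh) => /(H _ ac).
exact: solves_geodesic_eq.
Qed.

Lemma solves_geodesic_derive c g (D t : R) (w : R -> 'rV[R]_n) :
  (\forall s \near t, [/\ dom c (g s), is_derive (s : R) 1 (c \o g) (w s) &
     is_derive (s : R) 1 w (geodesic_acc c (c (g s)) (w s))]) ->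
  [/\ \forall s \near t, derivable (c \o g) s 1,
    derive1 (c \o g) t = w t &
    is_derive (t : R) 1 (derive1 (c \o g)) (geodesic_acc c (c (g t)) (w t))].
Proof.
move=> Hw; have [_ dg dw] := nbhs_singleton Hw; split.
- by apply: filterS Hw => s [_ []].
- by rewrite derive1E; case: dg.
- apply: near_eq_is_derive dw; apply: filterS Hw => s [_ [_ h] _].
  by rewrite derive1E h.
Qed.

Lemma geodesic_at_of_regular g (D t : R) : regular_geodesic g D t -> geodesic_at g t.
Proof.
move=> [cg H]; split; first exact: cg.
move=> c ac ct; have [w [Hw _]] := H c ac ct.
have [d1 d2 d3] := solves_geodesic_derive D Hw; split; [exact: d1|by case: d3|].
move=> k; rewrite -[derive1n 2 _ _]/(derive1 (derive1 (c \o g)) t) derive1E d2.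
have [_ ->] := d3; rewrite mxE addrC; apply/eqP; rewrite subr_eq0; apply/eqP.
by [].
Qed.

Lemma C1_of_regular g (D t : R) : 0 <= D -> regular_geodesic g D t ->
  C1_at g t /\ speed g t = D.
Proof.
move=> D0 [cg H]; split.
  split; first exact: cg.
  move=> c ac ct; have [w [Hw _]] := H c ac ct.
  have [d1 d2 d3] := solves_geodesic_derive D Hw; split; first exact: d1.
  exact: is_derive_continuous d3.
have ct := chart_at_dom (g t); have ac := chart_at_atlas (g t).
have [w [Hw iw]] := H _ ac ct; have [_ dw _] := nbhs_singleton Hw.
by rewrite (speedE ac cg ct dw) iw sqrtr_sqr ger0_norm.
Qed.

Lemma geodesic_accZ c (x v : 'rV[R]_n) (k : R) :
  geodesic_acc c x (k *: v) = (k * k) *: geodesic_acc c x v.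
Proof.
apply/rowP => l; rewrite !mxE mulrN mulr_sumr; congr (- _); apply: eq_bigr => a _.
by rewrite mulr_sumr; apply: eq_bigr => b _; rewrite !mxE; ring.
Qed.

Lemma chart_geodesic_solves c (u v : R -> 'rV[R]_n) (D k l t : R) : atlas c ->
  chart_geodesic c u v D -> -2 < k * t + l < 3 ->
  {for t, continuous (fun s => inv c (u (k * s + l)))} /\
  solves_geodesic c (fun s => inv c (u (k * s + l))) (k * D) t.
Proof.
move=> ac H t3.
have n1 : \forall s \near t, -2 < k * s + l < 3.
  exact: (@near_comp _ _ (fun s : R => k * s + l) t (fun y => -2 < y < 3)
    (@affine_continuous _ k l t) (near_itv t3)).
have H' s : -2 < k * s + l < 3 -> [/\ im c (u (k * s + l)), is_derive (k * s + l) 1 u (v (k * s + l)),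
    is_derive (k * s + l) 1 v (geodesic_acc c (u (k * s + l)) (v (k * s + l))) &
    inner c (u (k * s + l)) (v (k * s + l)) (v (k * s + l)) = D ^+ 2].
  by move=> /andP[s1 s2]; apply: H; rewrite !ltW.
split.
  have [cu du _ _] := H' _ t3.
  have c1 := is_derive_continuous (is_derive_affine du).
  exact: (continuous_comp c1 (chart_inv_continuous cu)).
exists (fun s => k *: v (k * s + l)); split; last first.
  have [cu _ _ iv] := H' _ t3; have [_ ->] := chart_invK cu.
  by rewrite innerZl innerZr iv; ring.
have n2 : \forall s \near t, \forall r \near s, u (k * r + l) = (c \o (fun s => inv c (u (k * s + l)))) r.
  apply: near_join; apply: filterS n1 => s /H'[cu _ _ _] /=.
  by have [_ ->] := chart_invK cu.
apply: filterS2 n1 n2 => s /H'[cu du dv _] e; have [dc ->] := chart_invK cu.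
split; [exact: dc|exact: near_eq_is_derive e (is_derive_affine du)|].
have dkv := is_deriveZ k (is_derive_affine dv).
by rewrite geodesic_accZ -scalerA.
Qed.

Definition metric_geodesic g (D a b : R) := forall s t, a <= s <= b -> a <= t <= b ->
  edist (g s) (g t) = (`|s - t| * D)%:E.

(** The points of the metric geodesic lie between the ends of a short piece, hence on
    the chart geodesic joining them, by uniqueness. The latter extends to both sides by
    the length of the piece and is still a metric geodesic there. *)
Lemma metric_geodesic_chart g (D a b t0 : R) c : atlas c -> 0 <= D -> a <= t0 <= b ->
  dom c (g t0) -> metric_geodesic g D a b ->
  exists2 h : R, 0 < h & forall a' b', a <= a' -> a' < b' -> b' <= b ->
    `|t0 - a'| < h -> `|t0 - b'| < h ->
    exists f : R -> M, [/\ metric_geodesic f D (a' - (b' - a')) (b' + (b' - a')),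
      forall t, a' <= t <= b' -> g t = f t &
      forall t, a' - (b' - a') < t < b' + (b' - a') ->
        {for t, continuous f} /\ solves_geodesic c f D t].
Proof.
move=> ac D0 t0ab ct mg; have [e e0 He] := local_geodesics ac ct.
have D1 : 0 < D + 1 by rewrite ltr_wpDl.
exists (e / (D + 1)); first by rewrite divr_gt0.
move=> a' b' aa ab bb ha hb.
have close t : a <= t <= b -> `|t0 - t| < e / (D + 1) -> (edist (g t0) (g t) < e%:E)%E.
  move=> tab ht; rewrite mg// lte_fin; apply: le_lt_trans (_ : `|t0 - t| * (D + 1) < e).
    by rewrite ler_wpM2l// lerDl.
  by rewrite -ltr_pdivlMr.
have aI : a <= a' <= b by rewrite aa (le_trans (ltW ab) bb).
have bI : a <= b' <= b by rewrite bb (le_trans aa (ltW ab)).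
have [D' [u [v [ia ib D'0 [geod dist uniq]]]]] := He _ _ (close _ aI ha) (close _ bI hb).
have w0 : 0 < b' - a' by rewrite subr_gt0.
have D'E : D' = (b' - a') * D.
  have N1 : -1 <= (0 : R) by rewrite oppr_le0.
  have I0 : -1 <= (0 : R) <= 2 by rewrite N1 ler0n.
  have I1 : -1 <= (1 : R) <= 2 by rewrite (le_trans N1 ler01) ler1n.
  have := dist _ _ I0 I1; rewrite ia ib mg// => -[].
  by rewrite sub0r normrN normr1 mul1r distrC gtr0_norm.
pose k := (b' - a')^-1; pose l := - a' * k.
have k0 : 0 < k by rewrite invr_gt0.
have kl t : k * t + l = (t - a') / (b' - a') by rewrite /l -/k; ring.
have kD : k * D' = D by rewrite D'E mulrA mulVf ?gt_eqF// mul1r.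
exists (fun t => inv c (u (k * t + l))); split.
- have inI t : a' - (b' - a') <= t <= b' + (b' - a') -> -1 <= k * t + l <= 2.
    move=> /andP[t1 t2]; rewrite kl; apply/andP; split.
      by rewrite ler_pdivlMr//; lra.
    by rewrite ler_pdivrMr//; lra.
  move=> s t /inI s1 /inI t1; rewrite dist//.
  have -> : k * s + l - (k * t + l) = k * (s - t) by ring.
  by rewrite normrM gtr0_norm// mulrAC kD mulrC.
- move=> t /andP[t1 t2].
  have tI : a <= t <= b by rewrite (le_trans aa t1) (le_trans t2 bb).
  have [ta|ta] := eqVneq t a'; first by rewrite kl ta subrr mul0r ia.
  have [tb|tb] := eqVneq t b'; first by rewrite kl tb divff ?gt_eqF// ib.
  have t1' : a' < t by rewrite lt_neqAle eq_sym ta.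
  have t2' : t < b' by rewrite lt_neqAle tb.
  apply: uniq.
  + by rewrite kl divr_gt0 ?subr_gt0//= ltr_pdivrMr// mul1r ltrD2r.
  + rewrite mg// lee_fin le_eqVlt; apply/orP; left; apply/eqP.
    rewrite D'E distrC ger0_norm ?subr_ge0// kl mulrA divfK ?gt_eqF//.
  + rewrite mg// lee_fin le_eqVlt; apply/orP; left; apply/eqP.
    rewrite D'E distrC ger0_norm ?subr_ge0// kl; field.
    by rewrite gt_eqF.
- move=> t /andP[t1 t2]; rewrite -kD; apply: (chart_geodesic_solves ac geod).
  rewrite kl; apply/andP; split.
    by rewrite ltr_pdivlMr//; lra.
  by rewrite ltr_pdivrMr//; lra.
Qed.

Lemma metric_geodesic_regular g (D a b t : R) : 0 <= D -> metric_geodesic g D a b ->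
  a < t < b -> regular_geodesic g D t.
Proof.
move=> D0 mg /andP[at_ tb].
have tab : a <= t <= b by rewrite !ltW.
have key c : atlas c -> dom c (g t) -> {for t, continuous g} /\ solves_geodesic c g D t.
  move=> ac ct; have [h h0 H] := metric_geodesic_chart ac D0 tab ct mg.
  pose k := Num.min (h / 2) (Num.min (t - a) (b - t)).
  have k0 : 0 < k by rewrite !lt_min divr_gt0//= !subr_gt0 at_.
  have kh : k < h.
    by apply: le_lt_trans (_ : h / 2 < h); [rewrite ge_min lexx|lra].
  have ka : k <= t - a by rewrite !ge_min lexx orbT.
  have kb : k <= b - t by rewrite !ge_min lexx !orbT.
  have [||||| f [_ fE fS]] := H (t - k) (t + k); try lra.
  - by rewrite subKr gtr0_norm.
  - by rewrite opprD addrA subrr sub0r normrN gtr0_norm.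
  have e : \forall s \near t, f s = g s.
    have tk : t - k < t < t + k by apply/andP; split; lra.
    apply: filterS (near_itv tk) => s /andP[s1 s2].
    by rewrite fE// !ltW.
  have [|cf sf] := fS t; first by apply/andP; split; lra.
  split; [exact: near_eq_continuous e cf|exact: solves_geodesic_eq e sf].
split; last by move=> c ac ct; have [] := key c ac ct.
by have [] := key _ (chart_at_atlas (g t)) (chart_at_dom (g t)).
Qed.

(** Short pieces at both ends are continued by metric_geodesic_chart; each point of
    the glued curve is interior to a segment on which it is a metric geodesic. *)
Lemma metric_geodesic_extension g (D : R) : 0 <= D -> metric_geodesic g D 0 1 ->
  exists f e, [/\ 0 < e, forall t, 0 <= t <= 1 -> f t = g t &
    forall t, - e < t < 1 + e -> regular_geodesic f D t].
Proof.
move=> D0 mg.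
have I0 : 0 <= (0 : R) <= 1 by rewrite lexx ler01.
have I1 : 0 <= (1 : R) <= 1 by rewrite lexx ler01.
have [h0 h00 H0] := metric_geodesic_chart (chart_at_atlas _) D0 I0 (chart_at_dom _) mg.
have [h1 h10 H1] := metric_geodesic_chart (chart_at_atlas _) D0 I1 (chart_at_dom _) mg.
pose k := Num.min (2^-1) (Num.min (h0 / 2) (h1 / 2)).
have k0 : 0 < k by rewrite !lt_min invr_gt0 !divr_gt0//= ltr0n.
have k2 : k <= 2^-1 by rewrite !ge_min lexx.
have kh0 : k <= h0 / 2 by rewrite !ge_min lexx !orbT.
have kh1 : k <= h1 / 2 by rewrite !ge_min lexx !orbT.
have [||||| f0 [m0 e0 _]] := H0 0 k; try lra.
- by rewrite subrr normr0.
- by rewrite sub0r normrN gtr0_norm//; lra.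
have [||||| f1 [m1 e1 _]] := H1 (1 - k) 1; try lra.
- by rewrite subKr gtr0_norm//; lra.
- by rewrite subrr normr0.
pose f t := if t < k / 2 then f0 t else if t < 1 - k / 2 then g t else f1 t.
have f0E t : t < k -> 0 <= t -> f t = f0 t.
  move=> tk t0; rewrite /f; case: ifP => // _; rewrite e0; last by rewrite t0 ltW.
  by rewrite ifT//; lra.
have f0E' t : t < 0 -> f t = f0 t by move=> t0; rewrite /f ifT//; lra.
have gE t : 0 <= t <= 1 -> f t = g t.
  move=> /andP[t0 t1]; rewrite /f; case: ifPn => [tk|].
    by rewrite e0// t0/=; lra.
  rewrite -leNgt => tk; case: ifPn => // ; rewrite -leNgt => tk'.
  by rewrite e1// t1 andbT; lra.
have f1E t : 1 - k < t -> f t = f1 t.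
  move=> tk; rewrite /f ifF; last by apply/negbTE; rewrite -leNgt; lra.
  by case: ifPn => // tk'; rewrite e1//; apply/andP; split; lra.
exists f, (k / 2); split; [by rewrite divr_gt0|exact: gE|move=> t /andP[t1 t2]].
have [tk|kt] := ltP t (k / 2).
  have It : - k < t < k / 2 by apply/andP; split; lra.
  apply: (@regular_geodesic_eq f0); last by apply: (metric_geodesic_regular D0 m0); lra.
  apply: filterS (near_itv It) => s /andP[s1 s2]; have [s0|s0] := ltP s 0; first by rewrite f0E'.
  by rewrite f0E//; lra.
have [tk'|kt'] := ltP t (1 - k / 2).
  have It : 0 < t < 1 by apply/andP; split; lra.
  apply: (@regular_geodesic_eq g); last exact: (metric_geodesic_regular D0 mg).
  by apply: filterS (near_itv It) => s /andP[s1 s2]; rewrite gE// !ltW.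
have It : 1 - k < t < 1 + k by apply/andP; split; lra.
apply: (@regular_geodesic_eq f1); last by apply: (metric_geodesic_regular D0 m1); lra.
by apply: filterS (near_itv It) => s /andP[s1 s2]; rewrite f1E.
Qed.

Lemma riemannian_length_distance : length_distance (@edist R n M).
Proof.
split.
- exact: edist_ge0.
- exact: edist_refl.
- exact: edist_sym.
- exact: edist_triangle.
- move=> x y H; apply: contrapT => xy.
  have nx : nbhs x (~` [set y]).
    apply: open_nbhs_nbhs; split; last exact: xy.
    apply: closed_openC.
    exact: (accessible_closed_set1 (hausdorff_accessible (@carrier_hausdorff _ _ M))).
  have [e e0 He] := nbhs_edist nx.
  exact: He (H _ e0) erefl.
- exact: edist_near.
- exact: nbhs_edist.
- exact: lipschitz_path.
- exact: compact_nbhs.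
Qed.

Lemma minimising_geodesic_exists (x y : M) (D : R) : metrically_complete M ->
  edist x y = D%:E -> exists f e, [/\ 0 < e, f 0 = x, f 1 = y &
    forall t, - e < t < 1 + e -> regular_geodesic f D t].
Proof.
move=> Mc xy.
have [g [g0 g1 gD]] := shortest_path_exists riemannian_length_distance Mc xy.
have D0 : 0 <= D by rewrite -lee_fin -xy edist_ge0.
have mg : metric_geodesic g D 0 1 by exact: gD.
have [f [e [e0 fg fr]]] := metric_geodesic_extension D0 mg.
exists f, e; split; [exact: e0| | |exact: fr].
  by rewrite fg ?lexx ?ler01.
by rewrite fg ?lexx ?ler01.
Qed.

End GeodesicsInCharts.

(** * Lifting of homotopies *)

Section Propagation.
Context {R : realType}.

(** The form of induction along a segment that suits coverings, where the
    neighbourhood of t comes from a trivialisation. *)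
Lemma segment_propagation (a b : R) (P : R -> Prop) : a <= b -> P a ->
  (forall t, a <= t <= b -> exists2 e : R, 0 < e & forall s s', a <= s -> s <= s' -> s' <= b ->
     `|t - s| < e -> `|t - s'| < e -> P s -> P s') ->
  forall t, a <= t <= b -> P t.
Proof.
move=> ab Pa H; apply: (segment_induction ab Pa) => [t /andP[at_ tb] Pt|t /andP[at_ tb] Pt].
  have [|e e0 He] := H t; first by rewrite at_ ltW.
  exists e => // s /andP[ts se] sb; apply: (He t s) => //.
  - exact: ltW.
  - by rewrite subrr normr0.
  - by rewrite distrC gtr0_norm ?subr_gt0//; lra.
  - by apply: Pt; rewrite at_ lexx.
have [|e e0 He] := H t; first by rewrite tb ltW.
pose s := Num.max a (t - e / 2).
have st : s < t by rewrite gt_max at_/=; lra.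
have as_ : a <= s by rewrite le_max lexx.
apply: (He s t) => //; last by apply: Pt; rewrite as_.
- exact: ltW.
- rewrite gtr0_norm ?subr_gt0//; have : t - e / 2 <= s by rewrite le_max lexx orbT.
  by move: e0; lra.
- by rewrite subrr normr0.
Qed.

Lemma near_dist (t : R) (P : R -> Prop) : (\forall s \near t, P s) ->
  exists2 e : R, 0 < e & forall s, `|t - s| < e -> P s.
Proof. by move=> /nbhs_ballP[e e0 He]; exists e => // s hs; apply: He. Qed.

Lemma glue_continuous (T : topologicalType) (f g : R -> T) (a t : R) :
  {for t, continuous f} -> {for t, continuous g} -> f a = g a ->
  {for t, continuous (fun s => if s <= a then f s else g s)}.
Proof.
move=> cf cg fg; have [ta|at_|ta] := ltgtP t a.
- have It : t - 1 < t < a by rewrite ta andbT; lra.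
  apply: near_eq_continuous cf; apply: filterS (near_itv It) => s /andP[_ sa].
  by rewrite (ltW sa).
- have It : a < t < t + 1 by rewrite at_/=; lra.
  apply: near_eq_continuous cg; apply: filterS (near_itv It) => s /andP[sa _].
  by rewrite leNgt sa.
- move=> N; rewrite ta lexx => nN; rewrite ta in cf cg.
  have nN' : nbhs (g a) N by rewrite -fg.
  have h1 : \forall s \near a, N (f s) by exact: cf.
  have h2 : \forall s \near a, N (g s) by exact: cg.
  have h : \forall s \near a, N (if s <= a then f s else g s).
    by apply: filterS2 h1 h2 => s /= Nf Ng; case: ifP.
  exact: h.
Qed.

End Propagation.

Section CoveringMaps.
Context {R : realType} {T S : topologicalType} (p : T -> S) (pc : covering_map p).

(** The content of evenly_covered in pointwise form: sections continuous at each
    point of U, and disjointness as uniqueness of the sheet. *)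
Definition trivialises (U : set S) (sheets : set (set T)) :=
  [/\ open U,
    forall V W z, sheets V -> sheets W -> V z -> W z -> V = W,
    forall z, U (p z) -> exists2 V, sheets V & V z &
    forall V, sheets V -> [/\ open V, forall x, V x -> U (p x) &
      exists f : S -> T, [/\ forall y, U y -> {for y, continuous f},
        forall y, U y -> V (f y) /\ p (f y) = y & forall x, V x -> f (p x) = x]]].

Lemma trivialisation_exists y : exists2 U, U y & exists sheets, trivialises U sheets.
Proof.
have [_ _ /(_ y)[U [oU Uy [sh [tr cover H]]]]] := pc.
exists U => //; exists sh; split.
- exact: oU.
- by move=> V W z sV sW Vz Wz; apply: (tr V W sV sW); exists z.
- move=> z Uz; have : (p @^-1` U) z by [].
  by rewrite -cover => -[V sV Vz]; exists V.
- move=> V sV; have [oV [f [cf f1 f2]]] := H V sV; split; [exact: oV| |exists f; split].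
  + by move=> x Vx; have : (p @^-1` U) x by rewrite -cover; exists V.
  + move=> z Uz; move: cf; rewrite continuous_open_subspace//; apply; exact: mem_set.
  + exact: f1.
  + exact: f2.
Qed.

(** The sheets are open and disjoint. *)
Lemma path_in_sheet U sheets V (f : R -> T) a b : trivialises U sheets -> sheets V ->
  a <= b -> (forall t, {for t, continuous f}) -> (forall t, a <= t <= b -> U (p (f t))) ->
  V (f a) -> forall t, a <= t <= b -> V (f t).
Proof.
move=> [oU dj cov sh] sV ab cf fU Va; apply: (segment_propagation ab Va) => t tab.
have [W sW Wt] := cov _ (fU _ tab); have [oW _ _] := sh _ sW.
have [e e0 He] := near_dist (near_comp (cf t) (open_nbhs_nbhs (conj oW Wt))).
exists e => // s s' as_ ss' sb /He Ws /He Ws' Vs.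
by rewrite (dj _ _ _ sV sW Vs Ws).
Qed.

Lemma unique_lift (f g : R -> T) (b : R) : (forall t, {for t, continuous f}) ->
  (forall t, {for t, continuous g}) -> (forall t, 0 <= t <= b -> p (f t) = p (g t)) ->
  0 <= b -> f 0 = g 0 -> f b = g b.
Proof.
move=> cf cg pfg b0 fg0.
have key : forall t, 0 <= t <= b -> f t = g t.
  apply: (segment_propagation b0 fg0) => t tb.
  have [U Ut [sheets [oU dj cov sh]]] := trivialisation_exists (p (f t)).
  have [V sV Vt] := cov _ Ut; have [oV _ [f1 [_ _ h1]]] := sh _ sV.
  rewrite pfg// in Ut; have [W sW Wt] := cov _ Ut; have [oW _ [f2 [_ _ h2]]] := sh _ sW.
  have [e1 e10 H1] := near_dist (near_comp (cf t) (open_nbhs_nbhs (conj oV Vt))).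
  have [e2 e20 H2] := near_dist (near_comp (cg t) (open_nbhs_nbhs (conj oW Wt))).
  exists (Num.min e1 e2); first by rewrite lt_min e10.
  move=> s s' s0 ss' sb; rewrite !lt_min => /andP[/H1 Vs /H2 Ws] /andP[/H1 Vs' /H2 Ws'] fs.
  have VW : V = W by apply: (dj _ _ (f s) sV sW Vs); rewrite fs.
  rewrite -(h1 _ Vs') pfg; last by rewrite (le_trans s0).
  by apply: h1; rewrite VW.
by apply: key; rewrite b0 lexx.
Qed.

(** Existence of a lift up to time t with its value there; an arbitrary path of T
    continues the lift after t. *)
Definition lift_reaches (h : R -> S) (z : T) (t : R) (k : T) := exists f : R -> T,
  [/\ forall x, {for x, continuous f}, forall x, 0 <= x <= t -> p (f x) = h x, f 0 = z & f t = k].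

Lemma lift_reaches_unique h z t k k' : 0 <= t ->
  lift_reaches h z t k -> lift_reaches h z t k' -> k = k'.
Proof.
move=> t0 [f [cf pf f0 <-]] [g [cg pg g0 <-]].
apply: unique_lift cf cg _ t0 _; last by rewrite f0 g0.
by move=> x xt; rewrite pf// pg.
Qed.

(** While h stays in a trivialising set, its lift is continued by the section of the
    sheet of k. *)
Lemma lift_reaches_extend U sheets V h z t1 t2 k : trivialises U sheets -> sheets V ->
  lift_reaches h z t1 k -> V k -> 0 <= t1 -> t1 <= t2 -> (forall x, {for x, continuous h}) ->
  (forall x, t1 <= x <= t2 -> U (h x)) ->
  forall f : S -> T, (forall y, U y -> {for y, continuous f}) ->
    (forall y, U y -> V (f y) /\ p (f y) = y) -> (forall x, V x -> f (p x) = x) ->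
    lift_reaches h z t2 (f (h t2)).
Proof.
move=> tr sV [g [cg pg g0 gk]] Vk t10 t12 ch Uh f cf f1 f2.
have e1 : g t1 = f (h (clamp t1 t2 t1)).
  rewrite clamp_id ?lexx// -pg ?t10 ?lexx// gk; exact/esym/f2.
have E2 x : t1 <= x -> x <= t2 -> (if x <= t1 then g x else f (h (clamp t1 t2 x))) = f (h x).
  move=> tx xt; have [xt1|_] := leP x t1; last by rewrite clamp_id// tx.
  have -> : x = t1 by apply/eqP; rewrite eq_le xt1.
  by rewrite e1 clamp_id// lexx.
exists (fun x => if x <= t1 then g x else f (h (clamp t1 t2 x))); split.
- move=> x; apply: glue_continuous (cg x) _ e1.
  have c1 : {for x, continuous (fun x => h (clamp t1 t2 x))}.
    exact: (continuous_comp (@clamp_continuous R t1 t2 x) (ch _)).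
  exact: (continuous_comp c1 (cf _ (Uh _ (clamp_in x t12)))).
- move=> x /andP[x0 x2]; have [xt|tx] := leP x t1; first by rewrite pg// x0.
  by rewrite clamp_id ?(ltW tx)//; have [] := f1 _ (Uh x _); rewrite ?(ltW tx).
- by rewrite t10.
- exact: E2.
Qed.

Lemma continuous_pair (X Y Z : topologicalType) (f : X -> Y) (g : X -> Z) (x : X) :
  {for x, continuous f} -> {for x, continuous g} -> {for x, continuous (fun y => (f y, g y))}.
Proof. by move=> cf cg; exact: (cvg_pair cf cg). Qed.

Lemma continuous_idfun (X : topologicalType) (x : X) : {for x, continuous (fun y : X => y)}.
Proof. exact: cvg_id. Qed.

Lemma slice_continuous (H : R * R -> S) (s t : R) : continuous H ->
  {for s, continuous (fun s => H (s, t))} /\ {for t, continuous (fun t => H (s, t))}.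
Proof.
move=> cH.
have c1 : {for s, continuous (fun s : R => (s, t))} by apply: continuous_pair; [exact: continuous_idfun|exact: continuous_cst].
have c2 : {for t, continuous (fun t : R => (s, t))} by apply: continuous_pair; [exact: continuous_cst|exact: continuous_idfun].
split; [exact: (continuous_comp c1 (cH _))|exact: (continuous_comp c2 (cH _))].
Qed.

Lemma near_square (s t : R) (P : R * R -> Prop) : (\forall z \near (s, t), P z) ->
  exists2 e : R, 0 < e & forall s' t', `|s - s'| < e -> `|t - t'| < e -> P (s', t').
Proof.
move=> [[A B] [/= nA nB] AB].
have [e1 e10 H1] := near_dist nA; have [e2 e20 H2] := near_dist nB.
exists (Num.min e1 e2); first by rewrite lt_min e10.
move=> s' t'; rewrite !lt_min => /andP[/H1 As _] /andP[_ /H2 Bt].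
exact: (AB (s', t')).
Qed.

(** For the paths t |-> H (s, t) with s near s0, the lifts exist up to any time and
    depend continuously on s at s0: this passes from t1 to t2 when the homotopy maps a
    neighbourhood of {s0} x [t1, t2] into a trivialising set, by continuing the lifts in
    the sheet of the value at t1. *)
Lemma lift_stable (H : R * R -> S) z (s0 : R) : continuous H -> (forall s, H (s, 0) = p z) ->
  forall t, 0 <= t <= 1 -> exists2 k0, lift_reaches (fun t => H (s0, t)) z t k0 &
    forall N, nbhs k0 N -> \forall s \near s0,
      exists2 k, N k & lift_reaches (fun t => H (s, t)) z t k.
Proof.
move=> cH H0.
have const s : lift_reaches (fun t => H (s, t)) z 0 z.
  exists (fun=> z); split => // [x|x x0]; first exact: continuous_cst.
  by have -> : x = 0 by apply/eqP; rewrite eq_le andbC.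
apply: (segment_propagation ler01).
  exists z; first exact: const.
  move=> N nN; apply: (@filterE _ (nbhs s0)) => s.
  by exists z; [exact: nbhs_singleton nN|exact: const].
move=> t t01.
have [U Ut [sheets tr]] := trivialisation_exists (H (s0, t)).
have [oU dj cov sh] := tr.
have [e e0 He] := near_square (near_comp (cH (s0, t)) (open_nbhs_nbhs (conj oU Ut))).
exists e => // t1 t2 t10 t12 t21 d1 d2 [k0 L0 HN].
have UH s x : `|s0 - s| < e -> t1 <= x <= t2 -> U (H (s, x)).
  move=> hs /andP[x1 x2]; apply: He => //; move: d1 d2; rewrite !ltr_norml.
  by move=> /andP[a1 a2] /andP[b1 b2]; apply/andP; split; lra.
have s00 : `|s0 - s0| < e by rewrite subrr normr0.
have pk0 : p k0 = H (s0, t1).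
  by case: L0 => f [_ pf _ <-]; rewrite pf// t10 lexx.
have [|V sV Vk0] := cov k0; first by rewrite pk0; apply: UH; rewrite ?lexx.
have [oV _ [f [cf f1 f2]]] := sh _ sV.
have ch s x : {for x, continuous (fun t => H (s, t))} by have [] := slice_continuous s x cH.
have ext s k : `|s0 - s| < e -> V k -> lift_reaches (fun t => H (s, t)) z t1 k ->
    lift_reaches (fun t => H (s, t)) z t2 (f (H (s, t2))).
  move=> hs Vk L.
  exact: (lift_reaches_extend tr sV L Vk t10 t12 (ch s) (fun x => @UH s x hs) cf f1 f2).
exists (f (H (s0, t2))); first exact: ext Vk0 L0.
move=> N nN.
have U2 : U (H (s0, t2)) by apply: UH; rewrite ?lexx ?t12.
have [c1 _] := slice_continuous s0 t2 cH.
have n1 : \forall s \near s0, N (f (H (s, t2))).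
  exact: (near_comp (continuous_comp c1 (cf _ U2)) nN).
have n2 := HN _ (open_nbhs_nbhs (conj oV Vk0)).
have n3 : \forall s \near s0, `|s0 - s| < e by apply/nbhs_ballP; exists e.
apply: (@filterS3 _ (nbhs s0) _ _ _ _ _ _ n1 n2 n3) => s Ns [k Vk L] hs.
exists (f (H (s, t2))); first exact: Ns.
exact: ext L.
Qed.

(** The ends of the lifts of close paths are close and have the same projection, so
    they lie in one sheet and coincide. *)
Lemma lift_end_locally_constant (H : R * R -> S) z (s0 : R) q : continuous H ->
  (forall s, H (s, 0) = p z) -> (forall s, H (s, 1) = q) ->
  exists k0, \forall s \near s0, lift_reaches (fun t => H (s, t)) z 1 k0.
Proof.
move=> cH H0 H1; have I1 : 0 <= (1 : R) <= 1 by rewrite ler01 lexx.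
have [k0 L0 HN] := lift_stable s0 cH H0 I1; exists k0.
have pk s k : lift_reaches (fun t => H (s, t)) z 1 k -> p k = q.
  by move=> [f [_ pf _ <-]]; rewrite pf// H1.
have [U Uq [sheets [oU dj cov sh]]] := trivialisation_exists q.
have [|V sV Vk0] := cov k0; first by rewrite (pk _ _ L0).
have [oV _ [f [_ _ f2]]] := sh _ sV.
apply: filterS (HN _ (open_nbhs_nbhs (conj oV Vk0))) => s [k Vk L].
have -> // : k0 = k by rewrite -(f2 _ Vk0) (pk _ _ L0) -(pk _ _ L) f2.
Qed.

Lemma homotopy_lift_end (H : R * R -> S) z q k : continuous H ->
  (forall s, H (s, 0) = p z) -> (forall s, H (s, 1) = q) ->
  lift_reaches (fun t => H (0, t)) z 1 k -> lift_reaches (fun t => H (1, t)) z 1 k.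
Proof.
move=> cH H0 H1 L0.
have key : forall s, 0 <= s <= 1 -> lift_reaches (fun t => H (s, t)) z 1 k.
  apply: (segment_propagation ler01 L0) => s s01.
  have [k0 /near_dist[e e0 He]] := lift_end_locally_constant s cH H0 H1.
  exists e => // s1 s2 _ _ _ /He L1 /He L2 L.
  by rewrite (lift_reaches_unique ler01 L L1).
by apply: key; rewrite ler01 lexx.
Qed.

(** The homotopy is extended to the plane by clamping both variables; then the end
    of the lift of its rows is locally constant, hence constant. *)
Lemma homotopic_lifts_end (f g : R -> T) : (forall t, {for t, continuous f}) ->
  (forall t, {for t, continuous g}) -> f 0 = g 0 ->
  path_homotopic (p \o f) (p \o g) -> f 1 = g 1.
Proof.
move=> cf cg fg0 [H [cH Hf Hg Hs0 Hs1]].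
pose I := clamp 0 1 : R -> R.
have Iin s : 0 <= I s <= 1 by apply: clamp_in.
have Iid s : 0 <= s <= 1 -> I s = s by apply: clamp_id.
pose H' (z : R * R) := H (I z.1, I z.2).
have cH' : continuous H'.
  move=> z; move/subspace_continuousP : cH => /(_ (I z.1, I z.2)) cH.
  have Sz x : (`[0, 1] `*` `[0, 1])%classic (I x.1, I x.2) by split; rewrite /= in_itv/=; exact: Iin.
  move=> N nN; have h := cH (Sz z) N nN.
  have c1 : {for z, continuous (fun x : R * R => (I x.1, I x.2))}.
    apply: continuous_pair.
      exact: (@continuous_comp _ _ _ fst I z cvg_fst (@clamp_continuous R 0 1 _)).
    exact: (@continuous_comp _ _ _ snd I z cvg_snd (@clamp_continuous R 0 1 _)).
  have h' : \forall y \near (I z.1, I z.2), (`[0, 1] `*` `[0, 1])%classic y -> N (H y) by exact: h.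
  have h2 : \forall x \near z, N (H' x).
    by apply: filterS (near_comp c1 h') => x; apply; exact: Sz.
  exact: h2.
have I0 : 0 <= (0 : R) <= 1 by rewrite ler01 lexx.
have I1 : 0 <= (1 : R) <= 1 by rewrite ler01 lexx.
have L0 : lift_reaches (fun t => H' (0, t)) (f 0) 1 (f 1).
  by exists f; split => // x x01; rewrite /H'/= !Iid// Hf.
have L1 : lift_reaches (fun t => H' (1, t)) (f 0) 1 (g 1).
  by exists g; split => // x x01; rewrite /H'/= !Iid// Hg.
have K0 s : H' (s, 0) = p (f 0) by rewrite /H'/= (Iid 0)// Hs0.
have K1 s : H' (s, 1) = p (f 1) by rewrite /H'/= (Iid 1)// Hs1.
exact: (lift_reaches_unique ler01 (homotopy_lift_end cH' K0 K1 L0) L1).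
Qed.

End CoveringMaps.

(** * The covering as a local isometry *)

Section LiftedCharts.
Context {R : realType} {n : nat} {T S : topologicalType} (p : T -> S) (pc : covering_map p).

(** The inverse is the section of a sheet after the inverse of d. *)
Lemma lifted_chart (d : chart R n S) z : dom d (p z) ->
  exists (c : chart R n T) (U : set S) (f : S -> T),
   [/\ dom c z, forall y, dom c y -> [/\ U (p y), dom d (p y) & f (p y) = y],
     forall y, c y = d (p y), forall x, inv c x = f (inv d x) &
     forall x, im c x -> im d x /\ p (inv c x) = inv d x].
Proof.
move=> dz; have [cp _ _] := pc.
have [U Uz [sheets [oU dj cov sh]]] := trivialisation_exists pc (p z).
have [V sV Vz] := cov _ Uz; have [oV VU [f [cf f1 f2]]] := sh _ sV.
pose W := V `&` p @^-1` (dom d).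
have oW : open W by apply: openI => //; apply: open_comp => // *; exact: dom_open.
pose I := [set x | im d x /\ U (inv d x)].
have IW : (d \o p) @` W = I.
  apply/seteqP; split => [_ [y [Vy dy] <-]|x [dx Ux]] /=.
    by split; [exact: chart_im|rewrite chart_coordK//; exact: VU].
  have [dx1 dx2] := chart_invK dx; have [Vf pf] := f1 _ Ux.
  by exists (f (inv d x)); [split => //; rewrite /= pf|rewrite /= pf].
have oI : open I.
  rewrite openE => x [dx Ux].
  have h1 := near_comp (chart_inv_continuous dx) (open_nbhs_nbhs (conj oU Ux)).
  exact: filterS2 (chart_im_near dx) h1 => y *.
have oI' : open ((d \o p) @` W) by rewrite IW.
have cW : {within W, continuous (d \o p)}.
  rewrite continuous_open_subspace// => y /set_mem[_ dy].
  exact: (continuous_comp (cp y) (chart_continuous dy)).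
have cI : {within (d \o p) @` W, continuous (f \o inv d)}.
  rewrite IW continuous_open_subspace// => x /set_mem[dx Ux].
  exact: (continuous_comp (chart_inv_continuous dx) (cf _ Ux)).
have K : {in W, cancel (d \o p) (f \o inv d)}.
  by move=> y /set_mem[Vy dy] /=; rewrite chart_coordK// f2.
exists (Chart oW oI' cW cI K), U, f; split => //.
- by move=> y [Vy dy]; split => //; [exact: VU|exact: f2].
- move=> x; rewrite -[im _ x]/(((d \o p) @` W) x) IW => -[dx Ux].
  by split => //=; have [] := f1 _ Ux.
Qed.

End LiftedCharts.

Section LocalIsometry.
Context {R : realType} {n : nat} {K M : riemannianManifold R n} (p : K -> M)
  (pc : covering_map p).
Context (pp : forall (c : chart R n K) (d : chart R n M), atlas c -> atlas d ->
  smooth_in p c d /\ pulls_back p c d (metric c) (metric d)).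

Lemma jacobian_of_id (f : 'rV[R]_n -> 'rV[R]_n) x : (\forall y \near x, f y = y) ->
  'J f x = 1%:M.
Proof.
move=> H; have fx := nbhs_singleton H.
suff [//] : differentiable f x /\ 'J f x = 1%:M.
apply: differentiable_of_taylor => e e0.
apply: filterS H => y fy; rewrite fy fx mulmx1 subrr normr0.
by rewrite mulr_ge0 ?(ltW e0).
Qed.

(** Against a chart of K, the lifted chart reads as the local expression of p or as
    its inverse, and the Jacobian of p is invertible because p pulls a definite metric back
    to a definite one; maximality of the atlas concludes. In the pair of charts (c, d) the
    map p is the identity, so the two metrics have the same matrix. *)
Lemma lifted_chart_atlas (d : chart R n M) z : atlas d -> dom d (p z) ->
  exists c : chart R n K, [/\ atlas c, dom c z,
    forall y, dom c y -> dom d (p y) /\ c y = d (p y),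
    {in dom c &, injective p} &
    forall x, im c x -> [/\ im d x, p (inv c x) = inv d x & metric c x = metric d x]].
Proof.
move=> ad dz; have [cp _ _] := pc.
have [c [U [f [cz cd cE cI cim]]]] := lifted_chart pc dz.
have ac : atlas c.
  apply: atlas_maximal => c' ac'; have [sp pb] := pp ac' ad.
  have cid : continuous (idfun : K -> K) by move=> x; exact: continuous_idfun.
  have FE x : local_expr idfun c' c x = local_expr p c' d x by rewrite /local_expr/= cE.
  have FE' : local_expr idfun c' c = local_expr p c' d by apply/funext.
  have sub x : local_dom idfun c' c x -> local_dom p c' d x.
    by move=> [x1 /cd[_ x2 _]]; split.
  have sF : smooth_in idfun c' c.
    by move=> k; rewrite FE'; exact: Ck_on_sub (sp k).
  split; last exact: sF.
  pose F := local_expr idfun c' c; pose G := local_expr idfun c c'.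
  apply: (@smooth_inverse _ _ (local_dom idfun c' c) _ F G _ _ _ _ _ _ _ sF).
  - exact: local_dom_open cid.
  - exact: local_dom_open cid.
  - move=> x [x1 x2]; have [d1 d2] := chart_invK x1; rewrite /F /local_expr/=.
    by split; [exact: chart_im|rewrite chart_coordK].
  - move=> x [x1 x2]; have [d1 d2] := chart_invK x1.
    by rewrite /F /G /local_expr/= chart_coordK// d2.
  - move=> y [y1 y2]; have [d1 d2] := chart_invK y1; rewrite /G /local_expr/=.
    by split; [exact: chart_im|rewrite chart_coordK].
  - move=> y [y1 y2]; have [d1 d2] := chart_invK y1.
    by rewrite /F /G /local_expr/= chart_coordK.
  - move=> y [y1 y2].
    exact: (continuous_comp (chart_inv_continuous y1) (chart_continuous y2)).
  - move=> x xd; have [x1 _] := xd; rewrite /F FE'.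
    have := metric_unit ac' x1; rewrite (pb _ (sub _ xd)) -mulmxA unitmx_mul.
    by case/andP.
exists c; split => //.
- by move=> y /[dup] /cd[_ dy _] _; rewrite cE.
- by move=> y y' /set_mem/cd[_ _ fy] /set_mem/cd[_ _ fy'] e; rewrite -fy -fy' e.
- move=> x cx; have [dx px] := cim _ cx; split => //.
  have [_ pb] := pp ac ad.
  have ld y : im c y -> local_dom p c d y.
    by move=> cy; split => //; have [/cd[]] := chart_invK cy.
  have idE y : im c y -> local_expr p c d y = y.
    move=> cy; rewrite /local_expr/=; have [_ ->] := cim _ cy.
    by have [dy _] := cim _ cy; have [] := chart_invK dy.
  have J1 : 'J (local_expr p c d) x = 1%:M.
    apply: jacobian_of_id; apply: filterS (chart_im_near cx) => y; exact: idE.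
  by rewrite (pb _ (ld _ cx)) J1 idE// trmx1 mulmx1 mul1mx.
Qed.

Lemma christoffel_eq (c : chart R n K) (d : chart R n M) x :
  (forall y, im c y -> metric c y = metric d y) -> im c x ->
  christoffel c x = christoffel d x.
Proof.
move=> H cx; have pE a i j : partial a (fun y => metric c y i j) x = partial a (fun y => metric d y i j) x.
  by apply: near_eq_derive; apply: filterS (chart_im_near cx) => y /H ->.
apply/funext => k; apply/funext => a; apply/funext => b.
by rewrite /christoffel (H _ cx); congr (_ * _); apply: eq_bigr => l _; rewrite !pE.
Qed.

(** In a lifted chart the curve and its projection have the same coordinates, and the
    geodesic equations coincide. *)
Lemma regular_geodesic_project (g : R -> K) (D t : R) :
  regular_geodesic g D t -> regular_geodesic (p \o g) D t.
Proof.
have [cp _ _] := pc; move=> [cg H]; split; first exact: (continuous_comp cg (cp _)).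
move=> d ad dt; have [c [ac cz cd _ cim]] := lifted_chart_atlas ad dt.
have Hm x : im c x -> metric c x = metric d x by case/cim.
have [w [Hw iw]] := H c ac cz; exists w; split; last first.
  have [_ cE] := cd _ cz; rewrite -iw /= -cE /inner Hm//; exact: chart_im.
have near2 : \forall s \near t, \forall r \near s, (c \o g) r = (d \o (p \o g)) r.
  by apply: near_join; apply: filterS (curve_near cg cz) => s /cd[].
apply: filterS2 Hw near2 => s [cs d1 d2] e; have [ds cE] := cd _ cs; split.
- exact: ds.
- exact: near_eq_is_derive e d1.
- have h : geodesic_acc c (c (g s)) (w s) = geodesic_acc d (d (p (g s))) (w s).
    by rewrite -cE /geodesic_acc (christoffel_eq Hm)//; exact: chart_im.
  by rewrite -h.
Qed.

Lemma C1_project (g : R -> K) (t : R) : C1_at g t ->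
  C1_at (p \o g) t /\ speed (p \o g) t = speed g t.
Proof.
have [cp _ _] := pc; move=> [cg H].
have cpg : {for t, continuous (p \o g)} by exact: (continuous_comp cg (cp _)).
have ad := chart_at_atlas (p (g t)); have dt := chart_at_dom (p (g t)).
set d := chart_at (p (g t)) in ad dt.
have [c [ac cz cd _ cim]] := lifted_chart_atlas ad dt.
have [d1 d2] := H c ac cz.
have near2 : \forall s \near t, \forall r \near s, (c \o g) r = (d \o (p \o g)) r.
  by apply: near_join; apply: filterS (curve_near cg cz) => s /cd[].
have d1' : \forall s \near t, derivable (d \o (p \o g)) s 1.
  by apply: filterS2 near2 d1 => s; exact: near_eq_derivable.
split.
  apply: (C1_at_of_chart ad cpg dt d1').
  by apply: near_eq_continuous d2; apply: filterS near2 => s; exact: near_eq_derive1.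
have dg : is_derive t 1 (c \o g) (derive1 (c \o g) t).
  rewrite derive1E; exact: (DeriveDef (nbhs_singleton d1) erefl).
have dpg := near_eq_is_derive (nbhs_singleton near2) dg.
have [_ cE] := cd _ cz.
rewrite (speedE ac cg cz dg) (speedE ad cpg dt dpg) /= -cE /inner.
by have [_ _ ->] := cim _ (chart_im cz).
Qed.

Lemma piecewise_C1_project (g : R -> K) (a b : R) : piecewise_C1 g a b ->
  piecewise_C1 (p \o g) a b.
Proof.
move=> [s [sp sl]]; exists s; split; last exact: sl.
apply: sub_path sp => x y /andP[xy /asboolP[h [e [e0 hg hC]]]]; rewrite xy/=.
apply/asboolP; exists (p \o h), e; split; [exact: e0| |].
  by move=> t /hg /= ->.
by move=> t /hC/C1_project[].
Qed.

Lemma curve_length_project (g : R -> K) (a b : R) : piecewise_C1 g a b ->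
  curve_length (p \o g) a b = curve_length g a b.
Proof.
move=> pw; have [S [s [[Sa cS cg HS] ->]]] := piecewise_arclength pw.
have h1 t : a <= t <= b -> {for t, continuous S} by move=> _; exact: cS.
have h2 t : a < t < b -> t \notin s -> is_derive t 1 S (speed (p \o g) t).
  by move=> tab ts; have [/C1_project[_ ->]] := HS _ tab ts.
by have := curve_lengthE (piecewise_C1_project pw) h1 h2; rewrite Sa subr0.
Qed.

Lemma edist_project y y' (l : R) : (edist y y' < l%:E)%E -> (edist (p y) (p y') < l%:E)%E.
Proof.
move=> /edist_ltP[g [a [b [_ pw <- <- ll]]]].
apply: le_lt_trans ll; rewrite -(curve_length_project pw).
exact: (edist_le_length (piecewise_C1_project pw)).
Qed.

(** The projected sequence converges to a point l; a ball around l is evenly covered.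
    Terms of the sequence that are close are joined by a short curve, whose projection stays
    in that ball, so they lie in one sheet, on which p is a homeomorphism. *)
Lemma covering_complete : metrically_complete M -> metrically_complete K.
Proof.
move=> Mc s sC; have [cp _ _] := pc.
have [|l sl] := Mc (p \o s).
  move=> e e0; have [N HN] := sC e e0; exists N => i j Ni Nj.
  exact: edist_project (HN _ _ Ni Nj).
have [U Ul [sheets tr]] := trivialisation_exists pc l.
have [oU dj cov sh] := tr.
have [e e0 He] := nbhs_edist (open_nbhs_nbhs (conj oU Ul)).
have e2 : 0 < e / 2 by rewrite divr_gt0.
have [N1 HN1] := sC _ e2; have [N2 HN2] := sl _ e2.
pose N := maxn N1 N2.
have lN : (edist l (p (s N)) < (e / 2)%:E)%E by rewrite edist_sym; apply: HN2; exact: leq_maxr.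
have UN : U (p (s N)).
  by apply: He; apply: (lt_le_trans lN); rewrite lee_fin; lra.
have [V sV VN] := cov _ UN; have [oV _ [f [cf f1 f2]]] := sh _ sV.
have sE i : (N <= i)%N -> s i = f (p (s i)).
  move=> Ni; have : (edist (s N) (s i) < (e / 2)%:E)%E.
    by apply: HN1; [exact: leq_maxl|apply: leq_trans Ni; exact: leq_maxl].
  move=> /edist_ltP[g [a [b [ab pw ga gb ll]]]].
  have [S [s' [ar lE]]] := piecewise_arclength pw; rewrite lE lte_fin in ll.
  have ab' : a <= b by exact: ltW.
  have gU t : a <= t <= b -> U (p (g (clamp a b t))).
    move=> tab; rewrite clamp_id//; case/andP: tab => ta tb.
    apply: He; have -> : e = e / 2 + e / 2 by rewrite -splitr.
    apply: (edist_triangle lN); rewrite -ga; apply: edist_project.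
    have aa : a <= a by [].
    apply: (le_lt_trans (edist_le_arclength pw ar aa ta tb)); rewrite lte_fin.
    have -> : S a = 0 by case: ar.
    by rewrite subr0; apply: le_lt_trans ll; exact: (arclength_mono ar ta tb).
  have cg : forall t, {for t, continuous (fun x => g (clamp a b x))} by case: ar.
  have Va : V (g (clamp a b a)) by rewrite clamp_id ?lexx// ga.
  have Ib : a <= b <= b by rewrite ab' lexx.
  have := path_in_sheet tr sV ab' cg gU Va Ib.
  by rewrite clamp_id// gb => /f2.
exists (f l) => r r0.
have [d d0 Hd] := nbhs_edist (near_comp (cf _ Ul) (edist_near (f l) r0)).
have [N3 HN3] := sl _ d0; exists (maxn N N3) => i; rewrite geq_max => /andP[Ni N3i].
rewrite sE// edist_sym; apply: Hd; rewrite edist_sym; exact: HN3.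
Qed.

End LocalIsometry.

(** * Counting preimages by volume *)

Section BorelImages.

Lemma borel_preimage (S T : ptopologicalType) (O : set S) (g : S -> T)
    (A : set (g_sigma_algebraType (@open T))) : open O ->
  (forall y, O y -> {for y, continuous g}) -> measurable A ->
  measurable (O `&` g @^-1` A : set (g_sigma_algebraType (@open S))).
Proof.
move=> oO cg mA.
have mO : measurable (O : set (g_sigma_algebraType (@open S))) by exact: sub_sigma_algebra.
have mg : measurable_fun (O : set (g_sigma_algebraType (@open S)))
    (g : g_sigma_algebraType (@open S) -> g_sigma_algebraType (@open T)).
  refine (@measurability _ _ (g_sigma_algebraType (@open S)) (g_sigma_algebraType (@open T))
    O g (@open T) erefl _) => _ [B oB <-].
  apply: sub_sigma_algebra.
  have : open (O `&` g @^-1` B).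
    rewrite openE => y [Oy By].
    have h1 := near_comp (cg _ Oy) (open_nbhs_nbhs (conj oB By)).
    exact: filterS2 (open_nbhs_nbhs (conj oO Oy)) h1 => z *.
  exact.
exact: mg.
Qed.

End BorelImages.

Section Volume.
Context {R : realType} {n : nat} {K M : riemannianManifold R n} (p : K -> M)
  (pc : covering_map p).
Context (pp : forall (c : chart R n K) (d : chart R n M), atlas c -> atlas d ->
  smooth_in p c d /\ pulls_back p c d (metric c) (metric d)).
Context (volM : {measure set (g_sigma_algebraType (@open M)) -> \bar R})
  (volK : {measure set (g_sigma_algebraType (@open K)) -> \bar R})
  (hM : riemannian_volume volM) (hK : riemannian_volume volK).

Definition volume_preserving_on (W : set K) :=
  forall A : set (g_sigma_algebraType (@open K)), measurable A -> A `<=` W ->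
    measurable (p @` A : set (g_sigma_algebraType (@open M))) /\ volM (p @` A) = volK A.

(** Both volumes are the same integral in the coordinates of a lifted chart. *)
Lemma lifted_chart_volume z : exists2 W : set K, open_nbhs z W & volume_preserving_on W.
Proof.
have [cp _ _] := pc.
have ad := chart_at_atlas (p z); have dz := chart_at_dom (p z).
set d := chart_at (p z) in ad dz.
have [c [ac cz cd _ cim]] := lifted_chart_atlas pc pp ad dz.
exists (dom c); first by split => //; exact: dom_open.
move=> A mA Ac; pose O := dom d `&` d @^-1` (im c).
have oO : open O.
  rewrite openE => y [dy cy].
  have h1 := near_comp (chart_continuous dy) (chart_im_near cy).
  exact: filterS2 (chart_near dy) h1 => x *.
have pO x : dom c x -> O (p x).
  by move=> cx; have [dx cE] := cd _ cx; split => //; rewrite /= -cE; exact: chart_im.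
have pA : p @` A = O `&` (inv c \o d) @^-1` A.
  apply/seteqP; split => [_ [x Ax <-]|y [[dy cy] Ay]].
    split; first exact/pO/Ac.
    by rewrite /= -(proj2 (cd _ (Ac _ Ax))) chart_coordK//; exact: Ac.
  exists ((inv c \o d) y); first exact: Ay.
  by rewrite /=; have [_ -> _] := cim _ cy; rewrite chart_coordK.
have mpA : measurable (p @` A : set (g_sigma_algebraType (@open M))).
  rewrite pA; apply: borel_preimage oO _ mA => y [dy cy].
  exact: (continuous_comp (chart_continuous dy) (chart_inv_continuous cy)).
split; first exact: mpA.
have pAd : p @` A `<=` dom d by move=> _ [x /Ac/cd[dx _] <-].
rewrite (hM ad mpA pAd) (hK ac mA Ac); congr (integral_rV _).
have cA : d @` (p @` A) = c @` A.
  rewrite image_comp; apply/seteqP; split => _ [x Ax <-]; exists x => //=;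
    by have [_ ->] := cd _ (Ac _ Ax).
apply/funext => x; rewrite cA !indicE; case: (boolP (x \in c @` A)) => [/set_mem[y Ay <-]|_].
  by have [_ _ ->] := cim _ (chart_im (Ac _ Ay)).
by rewrite !mulr0.
Qed.

(** Members of a countable basis on which p preserves volumes still cover K; an
    injection of the basis into nat numbers them. *)
Lemma volume_preserving_cover : exists b : nat -> set K,
  [/\ forall i, open (b i), forall i, volume_preserving_on (b i) & forall z, exists i, b i z].
Proof.
have [B cB [oB bB]] := @carrier_second_countable _ _ K.
have /countable_injP[f finj] := cB.
pose B' := [set b | B b /\ volume_preserving_on b].
exists (fun i => \bigcup_(b in [set b | B' b /\ f b = i]) b); split.
- by move=> i; apply: bigcup_open => b [[Bb _] _]; exact: oB.
- move=> i A mA Ab.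
  have [[b [B'b fb]]|none] := pselect (exists b, B' b /\ f b = i).
    have [_ vb] := B'b; apply: vb => // x /Ab[b' [[Bb' _] fb'] bx].
    have -> // : b = b'; apply: finj; rewrite ?inE//; last by rewrite fb.
    by case: B'b.
  have -> : A = set0.
    by apply/seteqP; split => // x /Ab[b Hb _]; apply: none; exists b.
  by rewrite image_set0 !measure0; split.
- move=> z; have [W oz vW] := lifted_chart_volume z.
  have [b [Bb bz] bW] := bB z W (open_nbhs_nbhs oz).
  exists (f b); exists b => //; split => //; split => // A mA Ab.
  by apply: vW => // x /Ab/bW.
Qed.

(** Cut B into countably many disjoint pieces, on each of which p preserves volumes.
    If every point had at most m preimages in B, the indicators of the images of the pieces
    would add up to at most m, and integration would give volK B <= m volM. *)
Lemma many_preimages (B : set K) (m : nat) : open B ->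
  (m%:R%:E * volM [set: M] < volK B)%E ->
  exists (q : M) (y : nat -> K), (forall i, (i <= m)%N -> B (y i) /\ p (y i) = q) /\
    forall i j, (i <= m)%N -> (j <= m)%N -> y i = y j -> i = j.
Proof.
move=> oB big; apply: contrapT => none.
have [b [ob vb cb]] := volume_preserving_cover.
pose A i : set (g_sigma_algebraType (@open K)) := seqDU (fun k => B `&` b k) i.
have mB i : measurable (B `&` b i : set (g_sigma_algebraType (@open K))).
  by apply: sub_sigma_algebra; exact: openI.
have mA i : measurable (A i).
  by apply: measurableD => //; exact: bigsetU_measurable.
have tA : trivIset setT A by exact: trivIset_seqDU.
have Asub i : A i `<=` b i by move=> x [[]].
have BE : B = \bigcup_i A i.
  rewrite -seqDU_bigcup_eq -setI_bigcupr; apply/seteqP; split => [x Bx|x []//].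
  by split => //; have [i bx] := cb x; exists i.
have mpA i : measurable (p @` A i : set (g_sigma_algebraType (@open M))).
  by have [] := vb i _ (mA i) (@Asub i).
have vA i : volM (p @` A i) = volK (A i) by have [] := vb i _ (mA i) (@Asub i).
have count_le q N : (count (fun i => q \in p @` A i) (iota 0 N) <= m)%N.
  rewrite leqNgt; apply/negP => cN; apply: none.
  pose s := [seq i <- iota 0 N | q \in p @` A i].
  have sz : (m < size s)%N by rewrite size_filter.
  have sP k : (k <= m)%N -> exists2 x, A (nth 0%N s k) x & p x = q.
    move=> km; have : nth 0%N s k \in s by rewrite mem_nth//; exact: leq_ltn_trans km sz.
    by rewrite mem_filter => /andP[/set_mem[x Ax px] _]; exists x.
  have : forall k, exists x, (k <= m)%N -> A (nth 0%N s k) x /\ p x = q.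
    move=> k; have [km|mk] := leqP k m; last by exists point.
    by have [x Ax px] := sP _ km; exists x.
  move=> /choice[y Hy]; exists q, y; split => [i im|i j im jm yij].
    have [Ay py] := Hy _ im; split => //; rewrite BE; by exists (nth 0%N s i).
  have us : uniq s by rewrite filter_uniq// iota_uniq.
  have [Ai _] := Hy _ im; have [Aj _] := Hy _ jm.
  have /eqP : nth 0%N s i = nth 0%N s j by apply: tA => //; exists (y i); split => //; rewrite yij.
  by rewrite nth_uniq//; [move/eqP|exact: leq_ltn_trans im sz|exact: leq_ltn_trans jm sz].
have part N : (\sum_(0 <= i < N) volK (A i) <= m%:R%:E * volM [set: M])%E.
  have -> : (\sum_(0 <= i < N) volK (A i) =
      \int[volM]_(x in setT) (\sum_(0 <= i < N) (\1_(p @` A i) x)%:E))%E.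
    rewrite ge0_integral_sum//.
      apply: eq_bigr => i _; by rewrite (integral_indic volM measurableT (mpA i)) setIT vA.
    by move=> i; apply/measurable_EFinP; exact: measurable_indic.
  rewrite -integral_cst//; apply: ge0_le_integral => //.
  - by move=> x _; apply: sume_ge0 => i _; rewrite lee_fin indicE.
  - by apply: emeasurable_sum => i; apply/measurable_EFinP; exact: measurable_indic.
  - move=> x _; rewrite sumEFin lee_fin /cst.
    under eq_bigr do rewrite indicE.
    rewrite -natr_sum ler_nat; apply: leq_trans (count_le x N).
    rewrite -sum1_count [leqRHS]big_mkcond/= /index_iota subn0.
    by apply: leq_sum => i _; case: (_ \in _).
have volE : volK B = (\sum_(i <oo) volK (A i))%E.
  by rewrite BE measure_semi_bigcup//; exact: bigcup_measurable.
move: big; rewrite volE; apply/negP; rewrite -leNgt.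
apply: lime_le; first by apply: is_cvg_nneseries => i _ _.
by apply: nearW => N; exact: part.
Qed.

End Volume.

(** * The loops *)

Section Loops.
Context {R : realType} {n : nat} {K M : riemannianManifold R n} (p : K -> M)
  (pc : covering_map p).
Context (pp : forall (c : chart R n K) (d : chart R n M), atlas c -> atlas d ->
  smooth_in p c d /\ pulls_back p c d (metric c) (metric d)).

Lemma edist_rball (x y z : K) (r : R) : rball x r y -> rball x r z ->
  exists2 D : R, edist y z = D%:E & 0 <= D /\ D < 2 * r.
Proof.
rewrite /rball/= edist_sym => xy xz; have := edist_triangle xy xz; have := edist_ge0 y z.
case: (edist y z) => // D; rewrite lee_fin lte_fin => D0 Dr.
by exists D => //; split => //; rewrite mulr2n mulrDl !mul1r.
Qed.

(** The geodesic is frozen outside [0, 1], which makes it continuous on the line, as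
    homotopic_lifts_end requires. *)
Lemma projected_geodesic (y z : K) (D : R) : metrically_complete M -> 0 <= D ->
  edist y z = D%:E -> exists g : R -> K,
    [/\ forall t, {for t, continuous g}, g 0 = y, g 1 = z,
      geodesic_arc (p \o g) 0 1 & (curve_length (p \o g) 0 1 <= D%:E)%E].
Proof.
move=> Mc D0 yz.
have [f [e [e0 f0 f1 fr]]] := minimising_geodesic_exists (covering_complete pc pp Mc) yz.
have I01 t : 0 <= t <= 1 -> - e < t < 1 + e.
  by move=> /andP[t0 t1]; apply/andP; split; lra.
have cl t : 0 <= t <= 1 -> f (clamp 0 1 t) = f t by move=> t01; rewrite clamp_id.
have I0 : 0 <= (0 : R) <= 1 by rewrite lexx ler01.
have I1 : 0 <= (1 : R) <= 1 by rewrite lexx ler01.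
have fr' t : - e < t < 1 + e -> regular_geodesic (p \o f) D t.
  by move=> te; apply: (regular_geodesic_project pc pp); exact: fr.
have pf t : 0 <= t <= 1 -> (p \o f) t = (p \o (fun t => f (clamp 0 1 t))) t.
  by move=> t01; rewrite /= cl.
exists (fun t => f (clamp 0 1 t)); split.
- apply: (clamp_comp_continuous ler01) => t t01.
  by have [] := fr _ (I01 _ t01).
- by rewrite cl.
- by rewrite cl.
- exists (p \o f), e; split; [exact: e0|exact: pf|].
  by move=> t; rewrite sub0r => te; exact: geodesic_at_of_regular (fr' _ te).
- have pw : piecewise_C1 (p \o f) 0 1.
    apply: (pw_segment ltr01); exists (p \o f), e; split; [exact: e0|by []|].
    by move=> t; rewrite sub0r => te; have [] := C1_of_regular D0 (fr' _ te).
  rewrite (curve_length_eq pf pw).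
  have := @curve_length_le _ _ _ _ _ _ D pw; rewrite subr0 mulr1; apply.
  move=> t /andP[t0 t1] _.
  have te : - e < t < 1 + e by apply: I01; rewrite !ltW.
  by have [_ ->] := C1_of_regular D0 (fr' _ te).
Qed.

End Loops.

Theorem corollary1p2 (R : realType) (n : nat)
    (M K : riemannianManifold R n) (p : K -> M)
    (volM : {measure set (g_sigma_algebraType (@open M)) -> \bar R})
    (volK : {measure set (g_sigma_algebraType (@open K)) -> \bar R})
    (x : K) (r : R) (m : nat) :
  connected [set: M] ->
  metrically_complete M ->
  nonpositively_curved M ->
  riemannian_volume volM ->
  (volM [set: M] < +oo)%E ->
  riemannian_universal_covering p ->
  riemannian_volume volK ->
  0 < r ->
  (1 <= m)%N ->
  (m%:R%:E * volM [set: M] < volK (rball x r))%E ->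
  exists (q : M) (delta : nat -> R -> M),
    (forall i : nat, (2 <= i <= m)%N ->
       [/\ geodesic_loop q (delta i),
           ~ path_homotopic (delta i) (fun=> q) &
           (curve_length (delta i) 0 1 <= (2 * r)%:E)%E]) /\
    (forall i j : nat, (2 <= i <= m)%N -> (2 <= j <= m)%N -> i <> j ->
       ~ path_homotopic (delta i) (delta j)).
Proof.
move=> _ Mc _ hM _ [pc _ pp] hK r0 m1 big.
have [q [y [yP yinj]]] := many_preimages pc pp hM hK (@rball_open _ _ _ x r) big.
have [By1 py1] := yP _ m1.
have : forall i, exists g : R -> K, (2 <= i <= m)%N ->
    [/\ forall t, {for t, continuous g}, g 0 = y 1%N, g 1 = y i,
      geodesic_arc (p \o g) 0 1 & (curve_length (p \o g) 0 1 <= (2 * r)%:E)%E].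
  move=> i; have [/andP[_ im]|_] := boolP (2 <= i <= m)%N; last by exists (fun=> point).
  have [Byi _] := yP _ im.
  have [D yD [D0 Dr]] := edist_rball By1 Byi.
  have [g [cg g0 g1 gg gl]] := projected_geodesic pc pp Mc D0 yD.
  exists g => _; split; [exact: cg|exact: g0|exact: g1|exact: gg|].
  by apply: (le_trans gl); rewrite lee_fin ltW.
move=> /choice[g Hg]; exists q, (fun i => p \o g i); split.
- move=> i i2; have [cg g0 g1 gg gl] := Hg _ i2; have /andP[i2' im] := i2.
  split; last exact: gl.
  + split; [exact: gg|by rewrite /= g0|by rewrite /= g1; have [] := yP _ im].
  + rewrite -py1 => h.
    have h' : path_homotopic (p \o g i) (p \o (fun=> y 1%N)) by exact: h.
    have := homotopic_lifts_end pc cg (fun t => @continuous_cst _ _ _ t) g0 h'.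
    rewrite g1 => /(yinj _ _ im m1) e.
    by rewrite e in i2'.
- move=> i j i2 j2 ij h; apply: ij.
  have [ci i0 i1 _ _] := Hg _ i2; have [cj j0 j1 _ _] := Hg _ j2.
  have /andP[_ im] := i2; have /andP[_ jm] := j2.
  apply: (yinj _ _ im jm); rewrite -i1 -j1.
  by apply: (homotopic_lifts_end pc ci cj _ h); rewrite i0 j0.
Qed.
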